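(* Let $\nu\in(0,1]$ and $0\le t_0<t_1\le t_2<\infty$, and let $\mathfrak{T}^\nu_t(x)=T(\mathfrak{B}^x_\nu(t))$ be the composition of a zero-mean isotropic random field $T$ on $\mathbb{S}^2_1$ with angular power spectrum $(C_l)_{l\ge0}$ and independent time-changed rotational Brownian motions $\mathfrak{B}^x_\nu$ started at $x$ at time $t_0$. Then: (i) for every $x\in\mathbb{S}^2_1$ and every $g\in SO(3)$, $$\mathbb{E}\big[\mathfrak{T}^{\nu}_{t_0}(gx)\,\mathfrak{T}^{\nu}_{t_1}(gx)\big]=\sum_{l\ge0}\frac{2l+1}{4\pi}\,C_l\,E_\nu\big(-\mu_l(t_1-t_0)^\nu\big);$$ (ii) for all $x,y\in\mathbb{S}^2_1$ with $x\ne y$, $$\mathbb{E}\big[\mathfrak{T}^{\nu}_{t_1}(x)\,\mathfrak{T}^{\nu}_{t_2}(y)\big]=\sum_{l\ge0}\frac{2l+1}{4\pi}\,C_l\,\mathcal{E}_l(t_0,t_1,t_2)\,P_l(\langle x,y\rangle),\qquad \mathcal{E}_l(t_0,t_1,t_2)=\prod_{i=1}^{2}E_\nu\big(-\mu_l(t_i-t_0)^\nu\big).$$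
   Context: $\mathbb{S}^2_1$ is the unit sphere in $\mathbb{R}^3$ with surface measure $\lambda$ ($\lambda(\mathbb{S}^2_1)=4\pi$), $\langle\cdot,\cdot\rangle$ is the inner product of $\mathbb{R}^3$, $\triangle_{\mathbb{S}^2_1}$ the Laplace–Beltrami operator, $\mu_l=l(l+1)$, $P_l$ the Legendre polynomials, $Y_{lm}$ ($l\ge0$, $|m|\le l$) the orthonormal complex spherical harmonics, $\triangle_{\mathbb{S}^2_1}Y_{lm}=-\mu_lY_{lm}$, $Y^*_{lm}=(-1)^mY_{l,-m}$. $E_\nu(z)=\sum_{n\ge0}z^n/\Gamma(1+n\nu)$ is the Mittag-Leffler function. Random field: $T=\{T(x):x\in\mathbb{S}^2_1\}$ is a real-valued (measurable) random field with $\mathbb{E}T(x)=0$, isotropic ($T(g\,\cdot)$ and $T(\cdot)$ have the same law for all $g\in SO(3)$) and $2$-weakly isotropic: $\mathbb{E}|T(gx)|^2<\infty$ and $\mathbb{E}[T(x_1)T(x_2)]=\mathbb{E}[T(gx_1)T(gx_2)]$ for all $x,x_1,x_2\in\mathbb{S}^2_1$, $g\in SO(3)$. It admits the spectral representation $T(x)=\sum_{l\ge0}\sum_{|m|\le l}a_{lm}Y_{lm}(x)$, $a_{lm}=\int_{\mathbb{S}^2_1}T(x)Y^*_{lm}(x)\lambda(dx)$, convergent in $L^2(P)$ for each $x$ and in $L^2(P\otimes\lambda)$, and its angular power spectrum $(C_l)$ is defined by $\mathbb{E}[a_{l_1m_1}a^*_{l_2m_2}]=\delta_{l_1}^{l_2}\delta_{m_1}^{m_2}C_{l_1}$;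 $\sum_l(2l+1)C_l<\infty$. Time-changed rotational Brownian motion: $\mathfrak{B}^x(t)$ is Brownian motion on $\mathbb{S}^2_1$ started at $x$ (the diffusion with generator $\triangle_{\mathbb{S}^2_1}$, with no factor $1/2$). For $\nu\in(0,1)$, $\mathfrak{H}^\nu_t$ is the stable subordinator with $\mathbb{E}e^{-s\mathfrak{H}^\nu_t}=e^{-ts^\nu}$ and $\mathfrak{L}^\nu_t=\inf\{\tau>0:\mathfrak{H}^\nu_\tau>t\}$, independent of $\mathfrak{B}^x$; $\mathfrak{L}^1_t=t$. Then $\mathfrak{B}^x_\nu(t)=\mathfrak{B}^x(\mathfrak{L}^\nu_{t-t_0})$, $t\ge t_0$, so $\mathfrak{B}^x_\nu(t_0)=x$ and $\mathfrak{T}^\nu_{t_0}(x)=T(x)$. Standing assumptions: $T$ is independent of the processes $\mathfrak{B}^x_\nu$; for $x\neq y$ the processes $\mathfrak{B}^x_\nu$ and $\mathfrak{B}^y_\nu$ are independent, while for $x=y$ the same process is used at both times. *)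

(* Defs.v *)
From HB Require Import structures.
From mathcomp Require Import all_boot all_order all_algebra.
From mathcomp Require Import complex.
From mathcomp Require Import all_classical all_reals all_analysis.
From mathcomp Require Import measurable_realfun.
Set Implicit Arguments.
Unset Strict Implicit.
Unset Printing Implicit Defensive.
Import Order.TTheory GRing.Theory Num.Theory.
Import numFieldNormedType.Exports.
Local Open Scope classical_set_scope.
Local Open Scope ring_scope.

(* The sigma-algebra on [T] generated by the maps [X i], [i] in [D]. *)
Definition sigma_generated (I T : Type) (d : measure_display)
    (S : measurableType d) (D : set I) (X : I -> T -> S) : set (set T) :=
  <<s [set A | exists2 i, D i & exists2 U, measurable U & A = X i @^-1` U] >>.

Definition independent (d : measure_display) (Omega : measurableType d)
    (R : realType) (P : probability Omega R) (F G : set (set Omega)) : Prop :=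
  forall A B, F A -> G B -> P (A `&` B) = (P A * P B)%E.

(* The canonical norm of ['cV[R]_3] is the sup norm, hence the explicit
   Euclidean one. *)
Definition enorm (R : realType) (v : 'cV[R]_3) : R :=
  Num.sqrt (\sum_i v i 0 ^+ 2).

Definition inner (R : realType) (u v : 'cV[R]_3) : R := (u^T *m v) 0 0.

Record sphere (R : realType) := Sphere {
  sphere_val :> 'cV[R]_3 ;
  sphere_valP : \sum_i sphere_val i 0 ^+ 2 == 1 }.

HB.instance Definition _ (R : realType) := [isSub for @sphere_val R].
HB.instance Definition _ (R : realType) := [Choice of sphere R by <:].

Lemma north_subproof (R : realType) :
  \sum_i (delta_mx ord_max 0 : 'cV[R]_3) i 0 ^+ 2 == 1.
Proof.
rewrite (bigD1 ord_max) //= big1 => [|i /negbTE ni]; last first.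
  by rewrite mxE ni /= expr0n.
by rewrite mxE !eqxx /= expr1n addr0.
Qed.

Definition north (R : realType) : sphere R := Sphere (north_subproof R).

HB.instance Definition _ (R : realType) := isPointed.Build (sphere R) (north R).

(* The trace on the sphere of the Borel sigma-algebra of R^3, generated by the
   three coordinates. *)
Definition sphere_measurable (R : realType) : set (set (sphere R)) :=
  sigma_generated setT (fun (i : 'I_3) (x : sphere R) => x i 0).

Section sphere_measurable.
Variable R : realType.

Let sphere_measurable0 : @sphere_measurable R set0.
Proof. exact: sigma_algebra0. Qed.

Let sphere_measurableC A :
  @sphere_measurable R A -> @sphere_measurable R (~` A).
Proof. exact: sigma_algebraC. Qed.

Let sphere_measurable_bigcup (F : (set (sphere R))^nat) :
  (forall i, @sphere_measurable R (F i)) ->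
  @sphere_measurable R (\bigcup_i F i).
Proof. exact: sigma_algebra_bigcup. Qed.

HB.instance Definition _ := @isMeasurable.Build default_measure_display
  (sphere R) (@sphere_measurable R)
  sphere_measurable0 sphere_measurableC sphere_measurable_bigcup.

End sphere_measurable.

Record SO3 (R : realType) := MkSO3 {
  SO3_val :> 'M[R]_3 ;
  SO3_orth : SO3_val^T *m SO3_val = 1%:M ;
  SO3_det : \det SO3_val = 1 }.

Lemma sum_sqr_inner (R : realType) (v : 'cV[R]_3) :
  \sum_i v i 0 ^+ 2 = inner v v.
Proof. by rewrite /inner mxE; apply: eq_bigr => i _; rewrite mxE expr2. Qed.

Lemma so3_act_subproof (R : realType) (g : SO3 R) (x : sphere R) :
  \sum_i (g *m x) i 0 ^+ 2 == 1.
Proof.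
rewrite sum_sqr_inner /inner trmx_mul -mulmxA (mulmxA (SO3_val g)^T) SO3_orth mul1mx.
by rewrite -[X in X == _]/(inner x x) -sum_sqr_inner sphere_valP.
Qed.

Definition so3_act (R : realType) (g : SO3 R) (x : sphere R) : sphere R :=
  Sphere (so3_act_subproof g x).

Lemma sph_subproof (R : realType) (p : R * R) :
  \sum_i (\col_(i < 3) [:: sin p.1 * cos p.2; sin p.1 * sin p.2; cos p.1]`_i
            : 'cV[R]_3) i 0 ^+ 2 == 1.
Proof.
rewrite !big_ord_recl big_ord0 !mxE /= addr0 !exprMn addrA -mulrDr.
by rewrite cos2Dsin2 mulr1 addrC cos2Dsin2.
Qed.

Definition sph (R : realType) (p : R * R) : sphere R :=
  Sphere (sph_subproof p).

Definition sph_domain (R : realType) : set (R * R) :=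
  `[0, pi] `*` `[0, 2 * pi].
Arguments sph_domain : clear implicits.

(* The image of [sin theta dtheta dphi] under spherical coordinates. *)
Definition surface_measure (R : realType) (A : set (sphere R)) : \bar R :=
  (\int[(@lebesgue_measure R \x @lebesgue_measure R)]_(p in
     sph_domain R `&` @sph R @^-1` A) (sin p.1)%:E)%E.

Section surface_measure.
Variable R : realType.
Local Open Scope ereal_scope.

Lemma measurable_sph_domain : measurable (sph_domain R).
Proof. by apply: measurableX; exact: measurable_itv. Qed.

Lemma measurable_sph : measurable_fun setT (@sph R).
Proof.
pose G := [set A : set (sphere R) | exists2 i : 'I_3, setT i &
  exists2 U : set R, measurable U & A = (fun x : sphere R => x i 0%R) @^-1` U].
have mG : @measurable _ (sphere R) = <<s G >> by [].
apply: (@measurability _ _ (R * R)%type (sphere R) setT (@sph R) G mG).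
have m1 : measurable_fun setT (fun p : R * R => p.1) by exact: measurable_fst.
have m2 : measurable_fun setT (fun p : R * R => p.2) by exact: measurable_snd.
have ms (f : R * R -> R) : measurable_fun setT f ->
    measurable_fun setT (fun p => sin (f p)).
  by move=> mf; apply: measurableT_comp => //;
    apply: continuous_measurable_fun; exact: continuous_sin.
have mc (f : R * R -> R) : measurable_fun setT f ->
    measurable_fun setT (fun p => cos (f p)).
  by move=> mf; apply: measurableT_comp => //;
    apply: continuous_measurable_fun; exact: continuous_cos.
move=> _ [_ [i _ [U mU ->]] <-].
suff mi : measurable_fun setT (fun p : R * R => @sph R p i 0%R) by exact: mi.
case: i => [[|[|[|//]]] i3].
- rewrite (_ : (fun _ => _) = (fun p => sin p.1 * cos p.2)%R); last first.
    by apply/funext => p; rewrite /= mxE.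
  by apply: measurable_funM; [exact: ms|exact: mc].
- rewrite (_ : (fun _ => _) = (fun p => sin p.1 * sin p.2)%R); last first.
    by apply/funext => p; rewrite /= mxE.
  by apply: measurable_funM; exact: ms.
- rewrite (_ : (fun _ => _) = (fun p => cos p.1)%R); last first.
    by apply/funext => p; rewrite /= mxE.
  exact: mc.
Qed.

Let msph A : measurable A -> measurable (sph_domain R `&` @sph R @^-1` A).
Proof.
move=> mA; apply: measurableI; first exact: measurable_sph_domain.
by rewrite -[X in measurable X]setTI; exact: measurable_sph.
Qed.

Let sin_ge0 p : sph_domain R p -> 0 <= (sin p.1)%:E.
Proof.
by move=> [/= p1 _]; rewrite lee_fin sin_ge0_pi // -in_itv.
Qed.

Let msin : measurable_fun setT (fun p : R * R => (sin p.1)%:E).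
Proof.
apply/measurable_EFinP; apply: (@measurableT_comp _ _ _ _ _ _ (@sin R)) => //.
by apply: continuous_measurable_fun; exact: continuous_sin.
Qed.

Let surface_measure0 : @surface_measure R set0 = 0.
Proof. by rewrite /surface_measure preimage_set0 setI0 integral_set0. Qed.

Let surface_measure_ge0 A : 0 <= @surface_measure R A.
Proof. by apply: integral_ge0 => p [/sin_ge0]. Qed.

Let surface_measure_sigma_additive :
  semi_sigma_additive (@surface_measure R).
Proof.
move=> F mF tF mUF; rewrite /surface_measure preimage_bigcup setI_bigcupr.
rewrite ge0_integral_bigcup //=.
- by apply: is_cvg_ereal_nneg_natsum_cond => n _ _; exact: surface_measure_ge0.
- by move=> k; exact: msph.
- exact: measurable_funTS.
- by move=> p [k _ [/sin_ge0]].
- apply/trivIsetP => i j _ _ ij; rewrite setIACA setIid -preimage_setI.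
  by move/trivIsetP : tF => /(_ i j Logic.I Logic.I ij) ->;
    rewrite preimage_set0 setI0.
Qed.

HB.instance Definition _ := isMeasure.Build _ _ _ (@surface_measure R)
  surface_measure0 surface_measure_ge0 surface_measure_sigma_additive.

Let surface_measure_fin : fin_num_fun (@surface_measure R).
Proof.
have pi2 : (0 <= 2 * pi :> R)%R by rewrite mulr_ge0 // pi_ge0.
move=> A mA; rewrite ge0_fin_numE; last exact: surface_measure_ge0.
rewrite /surface_measure.
apply: (@le_lt_trans _ _ (\int[(@lebesgue_measure R \x @lebesgue_measure R)]_(p in
     sph_domain R `&` @sph R @^-1` A) 1%:E)).
  apply: ge0_le_integral => //=.
  - exact: msph.
  - by move=> p [/sin_ge0].
  - exact: measurable_funTS.
  - by move=> p _; rewrite lee_fin sin_le1.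
rewrite integral_cst //; last exact: msph.
rewrite mul1e.
apply: (@le_lt_trans _ _
  ((@lebesgue_measure R \x @lebesgue_measure R) (sph_domain R))).
  apply: le_measure; rewrite ?inE; [exact: msph|exact: measurable_sph_domain|].
  by move=> p [].
rewrite /sph_domain product_measure1E; [|exact: measurable_itv..].
have h x : (0 <= x)%R -> @lebesgue_measure R `[0%R, x]%classic < +oo.
  by move=> x0; rewrite lebesgue_measure_itv /=; case: ifP => _; rewrite ?ltry.
by apply: lte_mul_pinfty; rewrite ?ge0_fin_numE ?measure_ge0 //; apply: h;
  rewrite ?pi_ge0.
Qed.

HB.instance Definition _ := Measure_isFinite.Build _ _ _
  (@surface_measure R) surface_measure_fin.

End surface_measure.

(* Radial projection; [north] is the junk value at the origin. *)
Definition radial (R : realType) (v : 'cV[R]_3) : sphere R :=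
  insubd (north R) ((enorm v)^-1 *: v).

Definition radial_ext (R : realType) (f : sphere R -> R) : 'cV[R]_3 -> R :=
  fun v => f (radial v).

Definition partial (R : realType) (i : 'I_3) (F : 'cV[R]_3 -> R)
  : 'cV[R]_3 -> R := fun v => 'D_(delta_mx i 0) F v.

Definition C2_sphere (R : realType) (f : sphere R -> R) : Prop :=
  let F := radial_ext f in
  forall v : 'cV[R]_3, v != 0 -> forall i j : 'I_3,
    [/\ derivable F v (delta_mx i 0),
        derivable (partial i F) v (delta_mx j 0),
        {for v, continuous (partial i F)} &
        {for v, continuous (partial j (partial i F))}].

(* The Laplacian of R^3 applied to the extension of [f] that is constant along
   rays. *)
Definition laplace_beltrami (R : realType) (f : sphere R -> R)
  : sphere R -> R :=
  fun x => \sum_i partial i (partial i (radial_ext f)) x.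

Definition mu_ (R : realType) (l : nat) : R := (l * l.+1)%:R.

(* Rodrigues' formula. *)
Definition legendre (R : realType) (l : nat) : {poly R} :=
  (2 ^+ l * l`!%:R)^-1 *: (('X^2 - 1) ^+ l)^`(l).

Definition Gamma (R : realType) (z : R) : R :=
  \int[@lebesgue_measure R]_(t in `]0, +oo[) (t `^ (z - 1) * expR (- t)).

Definition mittag_leffler (R : realType) (nu z : R) : R :=
  limn (series (fun n => z ^+ n / Gamma (1 + n%:R * nu))).

(* For [0 <= m], in spherical coordinates the usual
   [sqrt ((2l+1)/(4 pi) (l-m)!/(l+m)!) P_l^m(cos theta) e^(i m phi)], where
   [P_l^m(t) = (-1)^m (1-t^2)^(m/2) P_l^(m)(t)]: the factor
   [sin(theta)^m e^(i m phi)] is [(x_1 + i x_2)^m]. *)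
Definition Ylm_nneg (R : realType) (l m : nat) (x : sphere R) : R[i] :=
  ((-1) ^+ m
   * Num.sqrt ((2 * l + 1)%:R / (4 * pi) * ((l - m)`!%:R / (l + m)`!%:R))
   * ((legendre R l)^`(m)).[x (inord 2) 0])%:C%C
  * (Complex (x (inord 0) 0) (x (inord 1) 0)) ^+ m.

(* For [m < 0], [Y_lm = (-1)^m Y_l,-m^*]; [Negz k] is [- k.+1]. *)
Definition Ylm (R : realType) (l : nat) (m : int) (x : sphere R) : R[i] :=
  match m with
  | Posz k => Ylm_nneg l k x
  | Negz k => (-1) ^+ k.+1 * conjc (Ylm_nneg l k.+1 x)
  end.

Definition csqnorm (R : realType) (z : R[i]) : R :=
  complex.Re z ^+ 2 + complex.Im z ^+ 2.

Section random_field.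
Variables (R : realType) (d : measure_display) (Omega : measurableType d).
Variable P : probability Omega R.
Implicit Types (T : sphere R -> Omega -> R) (C : nat -> R).

Definition measurable_field T : Prop :=
  measurable_fun setT (fun p : sphere R * Omega => T p.1 p.2).

(* Equality of the laws on the path space [sphere R -> R], endowed with its
   cylinder sigma-algebra. *)
Definition isotropic T : Prop :=
  forall (g : SO3 R) (E : set (sphere R -> R)),
    sigma_generated setT (fun x (h : sphere R -> R) => h x) E ->
    P [set w | E (fun x => T (so3_act g x) w)] = P [set w | E (fun x => T x w)].

Definition weakly_isotropic2 T : Prop :=
  (forall x (g : SO3 R), ('E_P[(fun w => T (so3_act g x) w ^+ 2)%R] < +oo)%E) /\
  (forall x1 x2 (g : SO3 R),
    'E_P[(fun w => T x1 w * T x2 w)%R] =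
    'E_P[(fun w => T (so3_act g x1) w * T (so3_act g x2) w)%R])%E.

Definition harmonic_coef T (l : nat) (m : int) (w : Omega) : R[i] :=
  Complex
    (\int[@surface_measure R]_x complex.Re ((T x w)%:C%C * conjc (Ylm l m x)))
    (\int[@surface_measure R]_x complex.Im ((T x w)%:C%C * conjc (Ylm l m x))).

(* The sum over [l < n] and [- l <= m <= l], with [m = k - l]. *)
Definition harmonic_sum T (n : nat) (x : sphere R) (w : Omega) : R[i] :=
  \sum_(l < n) \sum_(k < (2 * l).+1%N)
    harmonic_coef T l (k%:Z - l%:Z) w * Ylm l (k%:Z - l%:Z) x.

Definition spectral_representation T : Prop :=
  (forall x, (fun n => 'E_P[(fun w =>
      csqnorm ((T x w)%:C%C - harmonic_sum T n x w))%R])%E @ \oo --> 0%E) /\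
  (fun n => \int[(P \x @surface_measure R)]_p
      (csqnorm ((T p.2 p.1)%:C%C - harmonic_sum T n p.2 p.1))%:E)%E
    @ \oo --> 0%E.

Definition angular_power_spectrum T C : Prop :=
  (forall (l1 l2 : nat) (m1 m2 : int),
    - l1%:Z <= m1 <= l1%:Z -> - l2%:Z <= m2 <= l2%:Z ->
    let Z w := harmonic_coef T l1 m1 w * conjc (harmonic_coef T l2 m2 w) in
    'E_P[(fun w => complex.Re (Z w))%R]%E =
      ((l1 == l2)%:R * (m1 == m2)%:R * C l1)%:E /\
    'E_P[(fun w => complex.Im (Z w))%R]%E = 0%E) /\
  cvgn (series (fun l => (2 * l + 1)%:R * C l)).

Record isotropic_field T C : Prop := {
  field_measurable : measurable_field T ;
  field_centered : forall x, ('E_P[T x] = 0)%E ;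
  field_isotropic : isotropic T ;
  field_weakly_isotropic2 : weakly_isotropic2 T ;
  field_spectral : spectral_representation T ;
  field_spectrum : angular_power_spectrum T C }.

(* The random field [T] is independent of the process [X]: [T] is jointly
   measurable with respect to some sigma-algebra [G] of events independent of
   [X] (for instance when [T] and [X] live on the two factors of a product
   probability space).  Independence of [sigma_generated setT T] alone says
   nothing about the compositions [T (X i w) w]: the uncountable field
   [T x w = (x == X i w)%:R] may have all its marginals almost surely null. *)
Definition field_independent (I : Type) (d' : measure_display)
    (S : measurableType d') T (D : set I) (X : I -> Omega -> S) : Prop :=
  exists G : set (set Omega),
    [/\ sigma_algebra setT G, G `<=` measurable,
        (forall U : set R, measurable U ->
          <<s [set A `*` B | A in @measurable _ (sphere R) & B in G] >>
            ((fun p : sphere R * Omega => T p.1 p.2) @^-1` U)) &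
        independent P G (sigma_generated D X)].

End random_field.

Definition transition_function (R : realType)
    (p : R -> R.-pker (sphere R) ~> (sphere R)) : Prop :=
  (forall x (U : set (sphere R)), measurable U -> p 0 x U = \d_x U) /\
  (forall (s t : R) x (U : set (sphere R)), 0 <= s -> 0 <= t -> measurable U ->
    p (s + t) x U = (\int[p s x]_y p t y U)%E).

Definition generated_by_laplace_beltrami (R : realType)
    (p : R -> R.-pker (sphere R) ~> (sphere R)) : Prop :=
  forall f : sphere R -> R, C2_sphere f ->
  forall e : R, 0 < e -> \forall t \near 0^'+, forall x,
    `|t^-1 * ((\int[p t x]_y f y) - f x) - laplace_beltrami f x| <= e.

Definition markov_process (R : realType) (d : measure_display)
    (Omega : measurableType d) (P : probability Omega R)
    (p : R -> R.-pker (sphere R) ~> (sphere R))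
    (B : R -> Omega -> sphere R) : Prop :=
  forall (s t : R) (A : set Omega) (U : set (sphere R)), 0 <= s <= t ->
    sigma_generated [set u | 0 <= u <= s] B A -> measurable U ->
    P (A `&` B t @^-1` U) = (\int[P]_(w in A) p (t - s)%R (B s w) U)%E.

(* Normalized by the generator [laplace_beltrami], without factor [1/2]. *)
Record rotational_brownian_motion (R : realType) (d : measure_display)
    (Omega : measurableType d) (P : probability Omega R) (x : sphere R)
    (B : R -> Omega -> sphere R) : Prop := {
  rbm_measurable : forall t : R, 0 <= t -> measurable_fun setT (B t) ;
  rbm_start : forall w, B 0 w = x ;
  rbm_continuous : forall w,
    {within `[0, +oo[, continuous (fun t => B t w : 'cV[R]_3)} ;
  rbm_diffusion : exists p : R -> R.-pker (sphere R) ~> (sphere R),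
    [/\ transition_function p, generated_by_laplace_beltrami p &
        markov_process P p B] }.

Record stable_subordinator (R : realType) (d : measure_display)
    (Omega : measurableType d) (P : probability Omega R) (nu : R)
    (H : R -> Omega -> R) : Prop := {
  sub_measurable : forall t : R, 0 <= t -> measurable_fun setT (H t) ;
  sub_start : forall w, H 0 w = 0 ;
  sub_nondecreasing : forall w (s t : R), 0 <= s -> s <= t -> H s w <= H t w ;
  sub_right_continuous : forall w (t : R), 0 <= t ->
    H u w @[u --> t^'+] --> H t w ;
  sub_independent_increments : forall s t : R, 0 <= s -> s <= t ->
    independent P (sigma_generated [set u | 0 <= u <= s] H)
      (sigma_generated [set: unit] (fun=> fun w => H t w - H s w)) ;
  sub_stationary_increments : forall (s t : R) (U : set R), 0 <= s -> s <= t ->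
    measurable U ->
    P [set w | U (H t w - H s w)] = P [set w | U (H (t - s) w)] ;
  sub_laplace : forall s t : R, 0 <= s -> 0 <= t ->
    ('E_P[(fun w => expR (- s * H t w))%R] = (expR (- t * s `^ nu))%:E)%E }.

(* The set below is almost surely nonempty ([H] is unbounded); the real-valued
   [inf] of the empty set is [0]. *)
Definition inverse_subordinator (R : realType) (Omega : Type) (nu : R)
    (H : R -> Omega -> R) (t : R) (w : Omega) : R :=
  if nu == 1 then t else inf [set tau | 0 < tau /\ t < H tau w].

Definition time_changed (R : realType) (Omega : Type) (nu t0 : R)
    (B : R -> Omega -> sphere R) (H : R -> Omega -> R) (t : R) (w : Omega)
  : sphere R :=
  B (inverse_subordinator nu H (t - t0) w) w.

(* The family, indexed by the starting point [x], of time-changed rotational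
   Brownian motions, independent for distinct starting points. *)
Record time_changed_rbm_family (R : realType) (d : measure_display)
    (Omega : measurableType d) (P : probability Omega R) (nu t0 : R)
    (B : sphere R -> R -> Omega -> sphere R)
    (H : sphere R -> R -> Omega -> R) : Prop := {
  fam_rbm : forall x, rotational_brownian_motion P x (B x) ;
  fam_subordinator : nu < 1 -> forall x, stable_subordinator P nu (H x) ;
  fam_clock_independent : forall x,
    independent P (sigma_generated [set t | 0 <= t] (B x))
      (sigma_generated [set t | 0 <= t] (inverse_subordinator nu (H x))) ;
  fam_independent : forall x y, x <> y ->
    independent P
      (sigma_generated [set t | t0 <= t] (time_changed nu t0 (B x) (H x)))
      (sigma_generated [set t | t0 <= t] (time_changed nu t0 (B y) (H y))) }.

Definition composed_field (R : realType) (Omega : Type) (nu t0 : R)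
    (T : sphere R -> Omega -> R) (B : sphere R -> R -> Omega -> sphere R)
    (H : sphere R -> R -> Omega -> R) (t : R) (x : sphere R) (w : Omega) : R :=
  T (time_changed nu t0 (B x) (H x) t w) w.

(* Main.v *)
Require Import Defs.
From mathcomp Require Import all_boot all_order all_algebra.
From mathcomp Require Import complex.
From mathcomp Require Import all_classical all_reals all_analysis.
From mathcomp Require Import measurable_realfun.
From mathcomp Require Import ring lra zify.
Set Implicit Arguments.
Unset Strict Implicit.
Unset Printing Implicit Defensive.
Import Order.TTheory GRing.Theory Num.Theory.
Import numFieldNormedType.Exports.
Local Open Scope classical_set_scope.
Local Open Scope ring_scope.

(** The motions enter only through the law of the two positions they reach.
    As [T] is jointly measurable for a sigma-algebra independent of the
    motions, integrating first over the field and then over the motions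
    ([integral_indep_algebra], a form of Fubini's theorem) turns the
    expectation of [T Z1 * T Z2] into that of [K Z1 Z2], where [K x y] is the
    expectation of [T x * T y] ([integral_composition]).  Three facts then
    give the formulas.

    First, [K x y] is the sum of [(2l+1)/(4 pi) C_l P_l(<x,y>)]
    ([covariance]).  By weak isotropy a rotation moves [x] to the north pole,
    where [Y_lm] vanishes for [m <> 0].  The partial sums of the spectral
    representation of [T north] involve the coefficients [a_l0] only, so that
    in the product with the partial sums of [T y] orthogonality of the
    coefficients leaves the zonal harmonics [Y_l0 y].

    Second, by Legendre's equation, [P_l(<z,.>)] is an eigenfunction of the
    Laplace-Beltrami operator for the eigenvalue [- mu_l]
    ([laplace_beltrami_legendre]).  The generator is the uniform derivative at
    time [0] of the transition operators, so [n] steps of length [t/n] show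
    that Brownian motion multiplies the mean of [P_l(<z,.>)] by
    [exp (- mu_l t)] ([Rintegral_eigenfunction]).

    Third, the mean of [exp (- m L_t)] for the inverse [L] of the stable
    subordinator [H] is [E_nu (- m t^nu)] ([inverse_subordinator_laplace]).
    The duality between [tau <= L_t] and [H_tau <= t] gives the Laplace
    transform in [t] of the left-hand side; it coincides, for large arguments,
    with the termwise Laplace transform of the Mittag-Leffler series, and a
    monotone function is determined by these values
    ([mittag_leffler_of_laplace]).

    The clock being independent of the motion it runs, the time-changed motion
    multiplies the mean of [P_l(<z,.>)] by [E_nu (- mu_l t^nu)]
    ([integral_time_changed_legendre]).  Starting at [x] and taking [z = x]
    gives the first formula; using this twice, for two independent motions,
    gives the product in the second one.  The series and the expectation are
    exchanged by dominated convergence, because [|P_l| <= 1] on [[-1, 1]]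
    ([legendre_le1]) and the sum of [(2l+1) C_l] is finite
    ([cvg_expected_covariance]). *)

(** * Legendre polynomials *)

Section Legendre.
Variable R : realType.
Implicit Types (p q : {poly R}) (l k n : nat) (x : R).

(** The [k.+1]-fold derivative of the identity [(X^2 - 1) W' = 2 l X W]. Taking
    [k = l] in it gives Legendre's differential equation. *)
Lemma rodrigues_derivS l k : let W := ('X^2 - 1 : {poly R}) ^+ l in
  ('X^2 - 1) * W^`(k.+2) + (2 * k.+1)%:R *: ('X * W^`(k.+1)) +
    (k * k.+1)%:R *: W^`(k) =
  (2 * l)%:R *: ('X * W^`(k.+1)) + (2 * l * k.+1)%:R *: W^`(k).
Proof.
move=> W.
have D2 : ('X^2 - 1 : {poly R})^`() = 2%:R *: 'X.
  by rewrite derivB derivXn derivC subr0 scaler_nat.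
elim: k => [|k IH].
  have h : ('X^2 - 1) * W^`() = (2 * l)%:R *: ('X * W).
    rewrite /W; case: l {W} => [|l].
      by rewrite expr0 -[1]/(1%:P) derivC mulr0 muln0 scale0r.
    rewrite deriv_exp /= D2; set Q := _ - 1.
    rewrite [Q ^+ l.+1]exprS -!mul_polyC natrM -mulr_natl polyCM !polyC_natr.
    by rewrite -natr1; ring.
  have := congr1 (@deriv R) h.
  rewrite derivM D2 derivZ derivM derivX -derivn1 -derivnS derivn0 => /eqP.
  rewrite -subr_eq0 => /eqP e; apply/eqP; rewrite -subr_eq0; apply/eqP.
  rewrite -[RHS]e -!mul_polyC !polyC_natr.
  set w2 := W^`(2); set w1 := W^`(1); rewrite !natrM; ring.
have := congr1 (@deriv R) IH.
rewrite !derivD !derivZ !derivM D2 derivX -!derivnS => e.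
set w3 := W^`(k.+3) in e *; set w2 := W^`(k.+2) in e *.
set w1 := W^`(k.+1) in e *.
move: e; rewrite -!mul_polyC !polyC_natr => /eqP; rewrite -subr_eq0 => /eqP e.
apply/eqP; rewrite -subr_eq0; apply/eqP; rewrite -{}[RHS]e.
rewrite !natrM -!natr1; ring.
Qed.

Lemma legendre_ode l :
  (1 - 'X^2) * (legendre R l)^`(2) - 2%:R *: ('X * (legendre R l)^`()) =
  - (mu_ R l *: legendre R l).
Proof.
rewrite /legendre derivnS derivn1 derivZ -scalerN.
have := rodrigues_derivS l l.
rewrite /= derivZ -!derivnS; set W := _ ^+ l.
set w3 := W^`(l.+2); set w2 := W^`(l.+1); set w1 := W^`(l); set c := (_ ^-1).
rewrite -!mul_polyC /mu_ !natrM -!natr1 => /eqP; rewrite -subr_eq0 => /eqP e.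
apply/eqP; rewrite -subr_eq0; apply/eqP.
rewrite -[RHS](mulr0 (- c%:P)) -[in RHS]e !polyCM !polyCD !polyC_natr polyC1; ring.
Qed.

(** In Leibniz' rule only the term where all the derivatives fall on the power
    survives at its root. It yields the values of Legendre polynomials at [1]
    and [-1]. *)
Lemma derivn_root_pow n x p : (((('X - x%:P) ^+ n) * p)^`(n)).[x] = n`!%:R * p.[x].
Proof.
suff h k : (k <= n)%N -> exists q, q.[x] = (n ^_ k)%:R * p.[x] /\
    (('X - x%:P) ^+ n * p)^`(k) = ('X - x%:P) ^+ (n - k) * q.
  by have [q [qx ->]] := h n (leqnn n); rewrite subnn mul1r qx ffactnn.
elim: k => [_|k IH kn]; first by exists p; rewrite ffactn0 mul1r subn0.
have [q [qx e]] := IH (ltnW kn).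
exists ((n - k)%:R *: q + ('X - x%:P) * q^`()); split.
  by rewrite !hornerE qx subrr mul0r addr0 mulrA -natrM mulnC -ffactnSr.
rewrite derivnS e -(subnSK kn) derivM deriv_exp derivXsubC /= mul1r exprS.
by rewrite -!mul_polyC polyC_natr -mulr_natl; ring.
Qed.

Lemma legendre1 l : (legendre R l).[1] = 1.
Proof.
rewrite /legendre; have -> : 'X^2 - 1 = ('X - 1%:P) * ('X + 1%:P) :> {poly R}.
  by rewrite -[1 in LHS]/(1%:P) -[1 in LHS](expr1n _ 2) polyC_exp subr_sqr.
rewrite exprMn hornerZ derivn_root_pow horner_exp hornerD hornerX hornerC.
by rewrite -[1 + 1]/(2%:R) [_`!%:R * _]mulrC mulVf// mulf_neq0 ?expf_neq0 ?pnatr_eq0 -?lt0n ?fact_gt0.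
Qed.

Lemma legendreN1 l : (legendre R l).[-1] = (-1) ^+ l.
Proof.
rewrite /legendre; have -> : 'X^2 - 1 = ('X - (-1)%:P) * ('X - 1%:P) :> {poly R}.
  by rewrite polyCN !polyC1; ring.
rewrite exprMn hornerZ derivn_root_pow horner_exp hornerXsubC.
have -> : (-1 - 1 : R) = (-1) * 2%:R by ring.
have c0 : 2 ^+ l * l`!%:R != 0 :> R.
  by rewrite mulf_neq0 ?expf_neq0 ?pnatr_eq0 -?lt0n ?fact_gt0.
by apply: (canLR (mulKf c0)); rewrite exprMn; ring.
Qed.

(** The function [q = p^2 + (1 - x^2) p'^2 / mu_l] has derivative [2 x p'^2 /
    mu_l], by Legendre's equation. Hence [q] decreases on [[-1, 0]] and
    increases on [[0, 1]]; it dominates [p^2] and is [1] at both ends. *)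
Lemma legendre_le1 l x : -1 <= x <= 1 -> `|(legendre R l).[x]| <= 1.
Proof.
move=> /andP[xN1 x1].
(* The eigenvalue vanishes for [l = 0], where the polynomial is constant. *)
have [->|l0] := posnP l.
  by rewrite /legendre expr0 derivn0 fact0 mulr1 invr1 scale1r -[1]/(1%:P) hornerC normr1.
set p := legendre R l; pose m := mu_ R l.
have m0 : 0 < m by rewrite ltr0n muln_gt0 l0.
pose q := p * p + m^-1 *: ((1 - 'X * 'X) * (p^`() * p^`())).
(* Legendre's equation removes the second derivative. *)
have Dq : q^`() = m^-1 *: ((2%:R *: 'X) * (p^`() * p^`())).
  have := legendre_ode l; rewrite -/p -/m derivnS derivn1 => /eqP.
  rewrite -subr_eq0 => /eqP ode.
  rewrite /q derivD derivZ !derivM derivB -[1]/(1%:P) derivC derivM derivX sub0r.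
  have mm : m^-1%:P * m%:P = 1 :> {poly R} by rewrite -polyCM mulVf ?gt_eqF.
  move: ode; rewrite -!mul_polyC !polyC_natr polyC1.
  set p2 := p^`()^`(); set p1 := p^`() => ode.
  transitivity (2%:R * p * p1 * (1 - m^-1%:P * m%:P) +
    m^-1%:P * (2%:R * 'X * (p1 * p1)) + m^-1%:P * 2%:R * p1 * 0).
    by rewrite -ode; ring.
  by rewrite mm; ring.
have dq y : derivable (horner q) y 1 by have [] := is_derive_poly q y.
have dqE y : (horner q)^`()%classic y = m^-1 * (2%:R * y * (p^`().[y] * p^`().[y])).
  rewrite derive1E; have [_ ->] := is_derive_poly q y.
  by rewrite Dq !hornerE.
have cq : continuous (horner q) by exact: continuous_horner.
have qE a : q.[a] = p.[a] ^+ 2 + m^-1 * ((1 - a ^+ 2) * p^`().[a] ^+ 2).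
  by rewrite !(hornerD, hornerN, hornerZ, hornerM, hornerX) -polyC1 hornerC !expr2.
have pq a : a ^+ 2 = 1 -> q.[a] = p.[a] ^+ 2.
  by move=> a1; rewrite qE a1 subrr mul0r mulr0 addr0.
have ple : p.[x] ^+ 2 <= q.[x].
  rewrite qE lerDl mulr_ge0 ?invr_ge0 ?(ltW m0)//.
  by rewrite mulr_ge0 ?sqr_ge0// subr_ge0 -[x ^+ 2]real_normK ?num_real// expr_le1// ler_norml xN1.
have m1 y : 0 <= m^-1 * (p^`().[y] * p^`().[y]).
  by rewrite mulr_ge0 ?invr_ge0 ?(ltW m0)// -expr2 sqr_ge0.
suff q1 : q.[x] <= 1 by rewrite -(@expr_le1 _ 2)// real_normK ?num_real ?(le_trans ple).
have [x0|x0] := leP 0 x.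
  have -> : 1 = q.[1] :> R by rewrite pq ?expr1n// legendre1 expr1n.
  apply: (@ger0_derive1_le_cc _ (horner q) x 1) => //.
  - move=> y; rewrite in_itv /= => /andP[xy _]; rewrite dqE mulrCA.
    by rewrite mulr_ge0// mulr_ge0// ltW// (le_lt_trans x0).
  - exact: continuous_subspaceT.
  - by rewrite in_itv /= lexx.
  - by rewrite in_itv /= lexx andbT.
have -> : 1 = q.[-1] :> R by rewrite pq ?sqrrN ?expr1n// legendreN1 -exprM mulnC exprM sqrrN !expr1n.
apply: (@ler0_derive1_le_cc _ (horner q) (-1) x) => //.
- move=> y; rewrite in_itv /= => /andP[_ yx]; rewrite dqE mulrCA.
  by rewrite mulr_le0_ge0// mulr_ge0_le0// ltW// (lt_trans yx).
- exact: continuous_subspaceT.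
- by rewrite in_itv /= lexx andbT.
- by rewrite in_itv /= lexx.
Qed.

End Legendre.

(** * Zonal functions and the Laplace-Beltrami operator *)

Section Zonal.
Variable R : realType.
Implicit Types (v e z : 'cV[R]_3) (g : {poly R}).

(** Directional derivatives are derivatives of a real function, which gives
    access to the one-variable chain rule. *)
Lemma is_derive_line (V : normedModType R) (f : V -> R) (v e : V) (df : R) :
  is_derive v e f df <-> is_derive (0 : R) 1 (fun h : R => f (h *: e + v)) df.
Proof.
have E : 'D_e f v = 'D_1 (fun h : R => f (h *: e + v)) 0.
  rewrite /derive; set g1 := fun h => h^-1 *: _; set g2 := fun h => h^-1 *: _.
  suff -> : g1 = g2 by [].
  by apply/funext => h; rewrite /g1 /g2 /= addr0 scale0r add0r [_%:A]mulr1.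
split=> -[d dE]; apply: DeriveDef.
- exact: (derivable1P f v e).1.
- by rewrite -E.
- exact: (derivable1P f v e).2.
- by rewrite E.
Qed.

Lemma is_derive_comp_real (V : normedModType R) (f : V -> R) (h : R -> R) (v e : V) (df dh : R) :
  is_derive v e f df -> is_derive (f v) 1 h dh ->
  is_derive v e (h \o f) (dh * df).
Proof.
move=> /is_derive_line Df Dh; apply/is_derive_line.
apply: (@is_derive1_comp _ h (fun t : R => f (t *: e + v))).
by rewrite scale0r add0r.
Qed.

Lemma is_derive_coord j v e : is_derive v e (fun w : 'cV[R]_3 => w j 0) (e j 0).
Proof.
apply/is_derive_line.
have -> : (fun h : R => (h *: e + v) j 0) = (fun h => h * e j 0) + cst (v j 0).
  by apply/funext => h; rewrite !mxE.
rewrite -[X in is_derive _ _ _ X]addr0; apply: is_deriveD.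
have -> : (fun h : R => h * e j 0) = e j 0 *: id.
  by apply/funext => h; rewrite mulrC.
by apply: is_derive_eq; rewrite [_%:A]mulr1.
Qed.

Lemma innerE z v : inner z v = \sum_i z i 0 * v i 0.
Proof. by rewrite /inner mxE; apply: eq_bigr => i _; rewrite mxE. Qed.

Lemma is_derive_inner z v e : is_derive v e (inner z) (inner z e).
Proof.
rewrite innerE.
have -> : inner z = \sum_i (z i 0 *: (fun w : 'cV[R]_3 => w i 0)).
  by apply/funext => w; rewrite innerE fct_sumE.
apply: is_derive_sum => i.
by apply: is_deriveZ; exact: is_derive_coord.
Qed.

Definition sqnorm v := \sum_i v i 0 ^+ 2.
Definition rnorm v := (enorm v)^-1.

Lemma sqnorm_gt0 v : v != 0 -> 0 < sqnorm v.
Proof.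
move=> v0; rewrite lt_neqAle sumr_ge0 ?andbT => [|i _]; last exact: sqr_ge0.
apply: contraNneq v0 => /esym/eqP; rewrite psumr_eq0 => [/allP h|i _]; last exact: sqr_ge0.
apply/eqP/matrixP => i j; rewrite (ord1 j) mxE.
by have := h i (mem_index_enum _); rewrite sqrf_eq0 => /eqP.
Qed.

Lemma enorm_gt0 v : v != 0 -> 0 < enorm v.
Proof. by move=> /sqnorm_gt0; rewrite -sqrtr_gt0. Qed.

Lemma is_derive_rnorm v i : v != 0 ->
  is_derive v (delta_mx i 0) rnorm (- (v i 0 * rnorm v ^+ 3)).
Proof.
move=> v0; have n0 := enorm_gt0 v0; have s0 := sqnorm_gt0 v0.
have D1 : is_derive v (delta_mx i 0) sqnorm (2 * v i 0).
  have -> : sqnorm = \sum_i ((fun w : 'cV[R]_3 => w i 0) ^+ 2).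
    by apply/funext => w; rewrite /sqnorm fct_sumE; apply: eq_bigr.
  have -> : 2 * v i 0 = \sum_j (2 * v j 0 ^+ 1) *: (delta_mx i 0 : 'cV[R]_3) j 0.
    rewrite (bigD1 i) //= big1 ?addr0 => [|j /negbTE ij].
      by rewrite mxE !eqxx expr1 [_%:A]mulr1.
    by rewrite mxE ij /= scaler0.
  apply: is_derive_sum => j; apply: is_deriveX; exact: is_derive_coord.
have D2 : is_derive v (delta_mx i 0) (Num.sqrt \o sqnorm) ((2 * enorm v)^-1 * (2 * v i 0)).
  by apply: is_derive_comp_real => //; exact: is_derive1_sqrt.
have [D3 D3E] := D2.
have e : - enorm v ^- 2 *: ((2 * enorm v)^-1 * (2 * v i 0)) = - (v i 0 * rnorm v ^+ 3).
  by rewrite /rnorm [LHS]mulNr; congr -%R; field; rewrite gt_eqF.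
rewrite -e; apply: DeriveDef; first by apply: derivableV; rewrite ?gt_eqF.
by rewrite -D3E; apply: deriveV; rewrite ?gt_eqF.
Qed.

Lemma is_derive_horner_comp g (V : normedModType R) (f : V -> R) (v e : V) (df : R) :
  is_derive v e f df ->
  is_derive v e (fun w => g.[f w]) (g^`().[f v] * df).
Proof. by move=> D; apply: (@is_derive_comp_real _ f (horner g)). Qed.

Variables (z : 'cV[R]_3).

(** For [v != 0], the extension of [g(<z,.>)] that is constant along rays; its
    first and second partial derivatives follow. *)
Definition zonal g v : R := g.[inner z v * rnorm v].
Definition zonal1 g (i : 'I_3) v : R :=
  g^`().[inner z v * rnorm v] * (z i 0 * rnorm v - inner z v * v i 0 * rnorm v ^+ 3).
Definition zonal2 g (i j : 'I_3) v : R :=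
  g^`()^`().[inner z v * rnorm v]
    * (z i 0 * rnorm v - inner z v * v i 0 * rnorm v ^+ 3)
    * (z j 0 * rnorm v - inner z v * v j 0 * rnorm v ^+ 3)
  + g^`().[inner z v * rnorm v] *
   (3 * inner z v * v i 0 * v j 0 * rnorm v ^+ 5
    - (z i 0 * v j 0 + z j 0 * v i 0 + (i == j)%:R * inner z v) * rnorm v ^+ 3).

Lemma inner_delta i : inner z (delta_mx i 0) = z i 0.
Proof.
rewrite innerE (bigD1 i) //= big1 ?addr0 => [|j /negbTE ij].
  by rewrite mxE !eqxx mulr1.
by rewrite mxE ij mulr0.
Qed.

Lemma is_derive_cosangle v i : v != 0 -> is_derive v (delta_mx i 0)
  (fun v => inner z v * rnorm v) (z i 0 * rnorm v - inner z v * v i 0 * rnorm v ^+ 3).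
Proof.
move=> v0.
have -> : z i 0 * rnorm v - inner z v * v i 0 * rnorm v ^+ 3 =
  inner z v *: - (v i 0 * rnorm v ^+ 3) + rnorm v *: inner z (delta_mx i 0).
  by rewrite inner_delta /GRing.scale/=; ring.
by apply: is_deriveM; [exact: is_derive_inner|exact: is_derive_rnorm].
Qed.

Lemma is_derive_zonal g v i : v != 0 ->
  is_derive v (delta_mx i 0) (zonal g) (zonal1 g i v).
Proof. by move=> v0; apply: is_derive_horner_comp; exact: is_derive_cosangle. Qed.

Lemma is_derive_zonal1 g v i j : v != 0 ->
  is_derive v (delta_mx j 0) (zonal1 g i) (zonal2 g i j v).
Proof.
move=> v0.
have Dr := is_derive_rnorm j v0.
have Di := is_derive_inner z v (delta_mx j 0).
have Dc := is_derive_coord i v (delta_mx j 0).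
have D1 := is_derive_horner_comp g^`() (is_derive_cosangle j v0).
have D2 := is_deriveB (is_deriveZ (z i 0) Dr)
   (is_deriveM (is_deriveM Di Dc) (is_deriveX 3 Dr)).
have := is_deriveM D1 D2.
congr (is_derive _ _ _ _).
rewrite inner_delta /zonal2 mxE eqxx andbT /GRing.scale/=.
have -> : (inner z * (fun w : 'cV[R]_3 => w i 0)) v = inner z v * v i 0 by [].
have -> : (rnorm ^+ 3) v = rnorm v ^+ 3 by [].
have -> : (z i 0 \*: rnorm - inner z * (fun w : 'cV[R]_3 => w i 0) * rnorm ^+ 3) v =
  z i 0 * rnorm v - inner z v * v i 0 * rnorm v ^+ 3 by [].
ring.
Qed.

Lemma cvg_sum_ord (T : Type) (F : set_system T) {FF : Filter F} n
    (f : 'I_n -> T -> R) (a : 'I_n -> R) :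
  (forall i, f i x @[x --> F] --> a i) ->
  \sum_i f i x @[x --> F] --> \sum_i a i.
Proof. by move=> fa; apply: cvg_big => //; exact: add_continuous. Qed.

Lemma continuous_inner : continuous (inner z).
Proof.
move=> v; rewrite /continuous_at innerE.
have -> : inner z = fun w => \sum_i z i 0 * w i 0 by apply/funext => w; exact: innerE.
by apply: (@cvg_sum_ord _ (nbhs v) (nbhs_filter v)) => i; apply: cvgM; [exact: cvg_cst|exact: coord_continuous].
Qed.

Lemma continuous_rnorm v : v != 0 -> {for v, continuous rnorm}.
Proof.
move=> v0; apply: (@cvgV _ _ (nbhs v) (nbhs_filter v)); first by rewrite gt_eqF// enorm_gt0.
apply: continuous_comp; last exact: sqrt_continuous.
apply: (@cvg_sum_ord _ (nbhs v) (nbhs_filter v)) => i.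
apply: (@continuous_comp _ _ _ (fun w : 'cV[R]_3 => w i 0) (fun y => y ^+ 2)).
  exact: coord_continuous.
exact: exprn_continuous.
Qed.

Lemma continuous_exprn n (f : 'cV[R]_3 -> R) v :
  {for v, continuous f} -> {for v, continuous (fun w => f w ^+ n)}.
Proof.
move=> fv; apply: (@continuous_comp _ _ _ f (fun y => y ^+ n)) => //.
exact: exprn_continuous.
Qed.

Lemma continuous_horner_cosangle g v : v != 0 ->
  {for v, continuous (fun v => g.[inner z v * rnorm v])}.
Proof.
move=> v0; apply: (@continuous_comp _ _ _ (fun v => inner z v * rnorm v) (horner g)).
  by apply: continuousM; [exact: continuous_inner|exact: continuous_rnorm].
exact: continuous_horner.
Qed.

Lemma continuous_zonal1 g i v : v != 0 -> {for v, continuous (zonal1 g i)}.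
Proof.
move=> v0; have cr := continuous_rnorm v0; have ci := @continuous_inner v.
have cc j : {for v, continuous (fun w : 'cV[R]_3 => w j 0)} by exact: coord_continuous.
apply: continuousM; first exact: continuous_horner_cosangle.
apply: continuousB; first by apply: continuousM; [exact: cst_continuous|].
by apply: continuousM; [exact: continuousM|exact: continuous_exprn].
Qed.

Lemma continuous_zonal2 g i j v : v != 0 -> {for v, continuous (zonal2 g i j)}.
Proof.
move=> v0; have cr := continuous_rnorm v0; have ci := @continuous_inner v.
have cc k : {for v, continuous (fun w : 'cV[R]_3 => w k 0)} by exact: coord_continuous.
have ck k : {for v, continuous (fun v => z k 0 * rnorm v - inner z v * v k 0 * rnorm v ^+ 3)}.
  apply: continuousB; first by apply: continuousM; [exact: cst_continuous|].
  by apply: continuousM; [exact: continuousM|exact: continuous_exprn].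
have cX n : {for v, continuous (fun v => rnorm v ^+ n)} by exact: continuous_exprn.
apply: continuousD.
  by apply: continuousM; [apply: continuousM|exact: ck]; [exact: continuous_horner_cosangle|exact: ck].
apply: continuousM; first exact: continuous_horner_cosangle.
apply: continuousB; apply: continuousM; try exact: cX.
  by apply: continuousM; [apply: continuousM; [apply: continuousM; [exact: cst_continuous|]|]|].
apply: continuousD; last by apply: continuousM; [exact: cst_continuous|].
by apply: continuousD; apply: continuousM => //; exact: cst_continuous.
Qed.

Lemma nonzero_near v : v != 0 -> \forall w \near v, w != 0.
Proof.
move=> v0; apply: (@open_nbhs_nbhs _ v [set w | w != 0]); split=> //.
have -> : [set w : 'cV[R]_3 | w != 0] = ~` [set 0].
  by apply/seteqP; split => w /eqP.
apply: closed_openC; apply: accessible_closed_set1; apply: hausdorff_accessible.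
exact: norm_hausdorff.
Qed.

Lemma radialE v : v != 0 -> sphere_val (radial v) = rnorm v *: v.
Proof.
move=> v0; rewrite /radial.
have h : \sum_i (rnorm v *: v) i 0 ^+ 2 == 1.
  have n0 := enorm_gt0 v0.
  under eq_bigr do rewrite mxE exprMn.
  rewrite -mulr_sumr /rnorm exprVn /enorm sqr_sqrtr ?ltW ?sqnorm_gt0//.
  by rewrite mulVf// gt_eqF// sqnorm_gt0.
by rewrite -[LHS]/(\val _) insubdK.
Qed.

Lemma radial_ext_zonal g v : v != 0 ->
  radial_ext (fun x : sphere R => g.[inner z x]) v = zonal g v.
Proof.
move=> v0; rewrite /radial_ext radialE// /zonal; congr (_.[_]).
by rewrite !innerE mulr_suml; apply: eq_bigr => i _; rewrite mxE; ring.
Qed.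

Lemma near_radial_ext_zonal g v : v != 0 ->
  \near v, zonal g v = radial_ext (fun x : sphere R => g.[inner z x]) v.
Proof.
by move=> /nonzero_near; apply: filterS => w w0; rewrite radial_ext_zonal.
Qed.

Lemma partial_zonal g i v : v != 0 ->
  partial i (radial_ext (fun x : sphere R => g.[inner z x])) v = zonal1 g i v.
Proof.
move=> v0; have [_ <-] := is_derive_zonal g i v0.
by apply/esym/near_eq_derive; exact: near_radial_ext_zonal.
Qed.

Lemma near_partial_zonal g i v : v != 0 ->
  \near v, zonal1 g i v = partial i (radial_ext (fun x : sphere R => g.[inner z x])) v.
Proof. by move=> /nonzero_near; apply: filterS => w w0; rewrite partial_zonal. Qed.

Lemma partial2_zonal g i j v : v != 0 ->
  partial j (partial i (radial_ext (fun x : sphere R => g.[inner z x]))) v = zonal2 g i j v.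
Proof.
move=> v0; have [_ <-] := is_derive_zonal1 g i j v0.
by apply/esym/near_eq_derive; exact: near_partial_zonal.
Qed.

Lemma near_eq_continuous (f h : 'cV[R]_3 -> R) v :
  (\near v, f v = h v) -> {for v, continuous f} -> {for v, continuous h}.
Proof.
move=> fh cf; rewrite /prop_for /continuous_at -(nbhs_singleton fh).
apply: (@cvg_trans _ (f @ v)); last exact: cf.
move=> A /= fA; have := @filterI _ (nbhs v) (nbhs_filter v) _ _ fh fA.
by apply: (@filterS _ (nbhs v) (nbhs_filter v)) => w [/= <-].
Qed.

Lemma C2_zonal g : C2_sphere (fun x : sphere R => g.[inner z x]).
Proof.
move=> v v0 i j; split.
- have [D _] := is_derive_zonal g i v0.
  exact: near_eq_derivable (near_radial_ext_zonal g v0) D.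
- have [D _] := is_derive_zonal1 g i j v0.
  exact: near_eq_derivable (near_partial_zonal g i v0) D.
- apply: (@near_eq_continuous (zonal1 g i)); first exact: near_partial_zonal.
  exact: continuous_zonal1.
- apply: (@near_eq_continuous (zonal2 g i j)); last exact: continuous_zonal2.
  by apply: filterS (nonzero_near v0) => w w0; rewrite partial2_zonal.
Qed.

(** The trace of the Hessian of [v |-> g(<z,v>/|v|)] at a point of the sphere:
    the tangential gradient of [<z,.>] has squared norm [1 - <z,x>^2], and its
    divergence is [- 2 <z,x>]. *)
Lemma laplace_beltrami_zonal g (x : sphere R) : sqnorm z = 1 ->
  laplace_beltrami (fun x : sphere R => g.[inner z x]) x =
  ((1 - 'X^2) * g^`(2) - 2%:R *: ('X * g^`())).[inner z x].
Proof.
move=> z1; have x1 : sqnorm x = 1 by apply/eqP; exact: sphere_valP.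
have x0 : sphere_val x != 0.
  apply/eqP => x0; move: x1; rewrite /sqnorm x0 big1 => [/esym/eqP|i _].
    by rewrite oner_eq0.
  by rewrite mxE expr0n.
have r1 : rnorm x = 1 by rewrite /rnorm /enorm -/(sqnorm x) x1 sqrtr1 invr1.
rewrite /laplace_beltrami.
under eq_bigr do rewrite partial2_zonal// /zonal2 r1 !expr1n !mulr1 eqxx mul1r.
rewrite hornerD hornerN hornerZ !hornerM hornerX hornerD hornerN hornerXn -polyC1 hornerC.
rewrite derivnS derivn1.
set g1 := g^`().[_]; set g2 := g^`()^`().[_]; set s := inner z x.
have s3 : s = \sum_i z i 0 * x i 0 by exact: innerE.
move: z1 x1 s3; rewrite /sqnorm !big_ord_recl !big_ord0 !addr0.
set z_0 := z _ _; set z_1 := z _ _; set z_2 := z _ _.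
set x_0 := (x : 'cV[R]_3) _ _; set x_1 := (x : 'cV[R]_3) _ _; set x_2 := (x : 'cV[R]_3) _ _.
clearbody g1 g2 s => z1 x1 s3.
(* The squared norms of [z] and [x] are kept symbolic, so that the identity
   becomes polynomial. *)
transitivity (g2 * ((z_0 ^+ 2 + (z_1 ^+ 2 + z_2 ^+ 2)) -
    2 * s * (z_0 * x_0 + (z_1 * x_1 + z_2 * x_2)) +
    s ^+ 2 * (x_0 ^+ 2 + (x_1 ^+ 2 + x_2 ^+ 2))) +
  g1 * (3 * s * (x_0 ^+ 2 + (x_1 ^+ 2 + x_2 ^+ 2)) -
    2 * (z_0 * x_0 + (z_1 * x_1 + z_2 * x_2)) - 3 * s)); first by ring.
by rewrite z1 x1 -s3; ring.
Qed.

End Zonal.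

Lemma laplace_beltrami_legendre (R : realType) l (z x : sphere R) :
  laplace_beltrami (fun x : sphere R => (legendre R l).[inner z x]) x =
  - mu_ R l * (legendre R l).[inner z x].
Proof.
rewrite laplace_beltrami_zonal; last by apply/eqP; exact: sphere_valP.
by rewrite legendre_ode hornerN hornerZ mulNr.
Qed.

(** * Expectations of functions of independent variables *)

Section IndependentPair.
Variables (R : realType) (d : measure_display) (Omega : measurableType d).
Variable P : probability Omega R.
Variables (d1 d2 : measure_display) (S1 : measurableType d1) (S2 : measurableType d2).
Variables (X : Omega -> S1) (Y : Omega -> S2).
Hypotheses (mX : measurable_fun setT X) (mY : measurable_fun setT Y).
Hypothesis XY : forall A B, measurable A -> measurable B ->
  P (X @^-1` A `&` Y @^-1` B) = (P (X @^-1` A) * P (Y @^-1` B))%E.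
Local Open Scope ereal_scope.

Let X' : {mfun Omega >-> S1} := mfun_Sub (mem_set mX).
Let Y' : {mfun Omega >-> S2} := mfun_Sub (mem_set mY).
Let mZ : measurable_fun setT (fun w => (X w, Y w)).
Proof. exact/measurable_fun_pair. Qed.

Let Z' : {mfun Omega >-> (S1 * S2)%type} := mfun_Sub (mem_set mZ).

Let lawE (A : set (S1 * S2)) : measurable A ->
  (distribution P X' \x distribution P Y') A = distribution P Z' A.
Proof.
by move=> mA; apply: product_measure_unique => // U V mU mV; exact: XY.
Qed.

(** Independence says that the law of the pair is the product of the two laws,
    so that this is Tonelli's theorem. *)
Lemma ge0_integral_indep (h : S1 * S2 -> \bar R) :
  measurable_fun setT h -> (forall p, 0 <= h p) ->
  \int[P]_w h (X w, Y w) = \int[P]_w' \int[P]_w h (X w', Y w).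
Proof.
move=> mh h0.
transitivity (\int[distribution P Z']_p h p).
  by rewrite ge0_integral_distribution.
rewrite (eq_measure_integral (distribution P X' \x distribution P Y')); last first.
  by move=> A mA _; apply/esym; exact: lawE.
rewrite fubini_tonelli1//= ge0_integral_distribution//.
- apply: eq_integral => w' _ /=; rewrite /fubini_F ge0_integral_distribution//.
  by apply: measurableT_comp => //; exact: measurable_pair1.
- exact: measurable_fun_fubini_tonelli_F.
- by move=> x; exact: integral_ge0.
Qed.

Lemma integral_indep (h : S1 * S2 -> R) :
  measurable_fun setT h ->
  \int[P]_w' \int[P]_w `|h (X w', Y w)|%:E < +oo ->
  \int[P]_w (h (X w, Y w))%:E = \int[P]_w' \int[P]_w (h (X w', Y w))%:E.
Proof.
move=> mh ih.
have mEh : measurable_fun setT (EFin \o h) by exact/measurable_EFinP.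
have ia : P.-integrable setT ((EFin \o h) \o Z').
  apply/integrableP; split; first exact: measurableT_comp.
  by rewrite [ltLHS](ge0_integral_indep (h := fun p => `|h p|%:E))//;
    apply/measurable_EFinP; exact: measurableT_comp.
have iz : (distribution P Z').-integrable setT (EFin \o h).
  apply/integrableP; split => //.
  rewrite ge0_integral_distribution//; last exact: measurableT_comp.
  by case/integrableP: ia.
have ip : (distribution P X' \x distribution P Y').-integrable setT (EFin \o h).
  apply/integrableP; split => //.
  rewrite (eq_measure_integral (distribution P Z')); last by move=> A mA _; exact: lawE.
  by case/integrableP: iz.
transitivity (\int[distribution P Z']_p (h p)%:E).
  by rewrite integral_distribution.
rewrite (eq_measure_integral (distribution P X' \x distribution P Y')); last first.
  by move=> A mA _; apply/esym; exact: lawE.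
rewrite -(integral12_prod_meas1 ip).
have iF := integrable_fubini_F ip.
have mF := measurable_int _ iF.
rewrite integral_distribution//.
- apply: eq_integral => w' _ /=; rewrite /fubini_F.
  have ms : measurable_fun setT (fun y => (h (X w', y))%:E).
    by apply: (measurableT_comp mEh); exact: measurable_pair1.
  rewrite [LHS]integralE [RHS]integralE; congr (_ - _).
  + apply: (etrans (ge0_integral_distribution _ (measurable_funepos ms) _)) => //.
    by apply: eq_integral => x _; rewrite /= !funeposE.
  + apply: (etrans (ge0_integral_distribution _ (measurable_funeneg ms) _)) => //.
    by apply: eq_integral => x _; rewrite /= !funenegE.
- apply/integrableP; split; first exact: measurableT_comp.
  case/integrableP: iF => _; rewrite ge0_integral_distribution//.
  exact: measurableT_comp.
Qed.

End IndependentPair.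

Section IndependentAlgebra.
Variables (R : realType) (d : measure_display) (Omega : measurableType d).
Variable P : probability Omega R.
Variable G : set (set Omega).
Hypotheses (sG : sigma_algebra setT G) (mG : G `<=` measurable).

(** Measurability on [S * Omega] for the product with [G]. The same sets are
    those of the measurable type [S * g_sigma_algebraType G], on which
    [integral_indep] applies. *)
Definition product_with (d1 : measure_display) (S : measurableType d1) : set (set (S * Omega)) :=
  <<s [set A `*` B | A in @measurable _ S & B in G] >>.

Lemma product_withE (d1 : measure_display) (S : measurableType d1) :
  @product_with _ S = @measurable _ (S * g_sigma_algebraType G)%type.
Proof.
rewrite measurable_prod_measurableType /product_with.
have -> // : @measurable _ (g_sigma_algebraType G) = G by exact: sigma_algebra_id.
Qed.

Lemma measurable_fun_product_with (d1 d2 : measure_display) (S : measurableType d1)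
    (S2 : measurableType d2) (h : S * Omega -> S2) :
  (forall U, measurable U -> product_with (h @^-1` U)) ->
  measurable_fun setT (h : S * g_sigma_algebraType G -> S2).
Proof. by move=> mh _ U mU; rewrite setTI -product_withE; exact: mh. Qed.

Lemma measurable_id_sub : measurable_fun setT (fun w : Omega => w : g_sigma_algebraType G).
Proof.
move=> _ U mU; rewrite setTI preimage_id; apply: mG.
by rewrite -(sigma_algebra_id sG).
Qed.

(** The case of [integral_indep] where the second variable is the identity of
    [Omega], the target carrying the sigma-algebra [G] only. *)
Lemma integral_indep_algebra (d1 : measure_display) (S : measurableType d1)
  (X : Omega -> S) (h : S * Omega -> R) : measurable_fun setT X ->
  (forall A U, G A -> measurable U -> P (A `&` X @^-1` U) = (P A * P (X @^-1` U))%E) ->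
  measurable_fun setT (h : S * g_sigma_algebraType G -> R) ->
  (\int[P]_w' \int[P]_w `|h (X w', w)|%:E < +oo ->
  \int[P]_w (h (X w, w))%:E = \int[P]_w' \int[P]_w (h (X w', w))%:E)%E.
Proof.
move=> mX XG mh; apply: (integral_indep mX measurable_id_sub _ mh) => A B mA mB.
rewrite preimage_id setIC muleC; apply: XG => //.
by rewrite -(sigma_algebra_id sG).
Qed.

End IndependentAlgebra.

(** * The Gamma integral and Laplace transforms of powers *)

Section GammaIntegral.
Variable R : realType.
Implicit Types (a s t : R).
Local Notation mu := (@lebesgue_measure R).

Lemma cvgy_expRN s : 0 < s -> expR (- s * t) @[t --> +oo] --> (0 : R).
Proof.
move=> s0; under eq_fun do rewrite mulNr.
apply: (@cvg_comp _ _ _ (fun t => s * t) (fun t => expR (- t)) _ +oo); last exact: cvgr_expR.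
by apply: gt0_cvgMry => //; exact: cvg_id.
Qed.

Lemma is_derive_expRM s t : is_derive t 1 (fun t : R => expR (s * t)) (s * expR (s * t)).
Proof.
rewrite mulrC; apply: is_derive1_comp.
rewrite -[( *%R s)]/(s *: (id : R -> R)).
by apply: is_derive_eq; rewrite [_%:A]mulr1.
Qed.

Lemma continuous_expRM s : continuous (fun t : R => expR (s * t)).
Proof.
move=> t; apply/differentiable_continuous/derivable1_diffP.
by have [] := is_derive_expRM s t.
Qed.

(** The exponential density, from an arbitrary left endpoint. All the Laplace
    transforms below are compared with this one. *)
Lemma integral_expR s a : 0 < s ->
  (\int[mu]_(t in `[a, +oo[) (s * expR (- s * t))%:E = (expR (- s * a))%:E)%E.
Proof.
move=> s0; pose F t : R := - expR (- s * t).
have dF t : is_derive t 1 F (s * expR (- s * t)).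
  have -> : s * expR (- s * t) = - (- s * expR (- s * t)) by ring.
  exact: is_deriveN (is_derive_expRM _ _).
have cf : continuous (fun t : R => s * expR (- s * t)).
  by move=> t; apply: cvgM; [exact: cvg_cst|exact: continuous_expRM].
rewrite (@ge0_continuous_FTC2y _ (fun t : R => s * expR (- s * t)) F a 0).
- by rewrite -EFinB /F sub0r opprK.
- by move=> x _; rewrite mulr_ge0 ?expR_ge0// ltW.
- exact: continuous_subspaceT.
- by rewrite -[X in _ --> X]oppr0; apply: cvgN; exact: cvgy_expRN.
- by move=> x _; have [] := dF x.
- apply: cvg_at_right_filter.
  by apply/differentiable_continuous/derivable1_diffP; have [] := dF a.
- by move=> x _; rewrite derive1E; have [_ ->] := dF x.
Qed.

Lemma powR_le_expR a : 0 <= a -> exists2 c : R, 0 <= c & forall t, 0 < t -> t `^ a <= c * expR (t / 2).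
Proof.
rewrite le_eqVlt => /predU1P[<-|a0].
  exists 1 => // t t0; rewrite powRr0 mul1r -expR0 ler_expR.
  by rewrite divr_ge0// ltW.
exists ((2 * a) `^ a) => [|t t0]; first exact: powR_ge0.
have a2 : 0 < 2 * a by rewrite mulr_gt0.
have -> : expR (t / 2) = expR (t / (2 * a)) `^ a.
  by rewrite -expRM; congr expR; field; rewrite gt_eqF.
rewrite -powRM ?expR_ge0 ?(ltW a2)//.
apply: ge0_ler_powR; rewrite ?nnegrE ?mulr_ge0 ?(ltW a2) ?expR_ge0 ?(ltW a0) ?(ltW t0)//.
rewrite mulrC -ler_pdivrMr//.
by apply: le_trans (expR_ge1Dx _); rewrite lerDr.
Qed.

Lemma measurable_powRM a (D : set R) : measurable_fun D (fun t => t `^ a * expR (- t)).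
Proof.
apply: measurable_funTS; apply: measurable_funM; first exact: measurable_powR.
apply: measurableT_comp => //; exact: oppr_measurable.
Qed.

Lemma integrable_powR_expR a : 0 <= a ->
  mu.-integrable `]0, +oo[ (fun t => (t `^ a * expR (- t))%:E).
Proof.
move=> a0; apply/integrableP; split.
  by apply/measurable_EFinP; exact: measurable_powRM.
have [c c0 H] := powR_le_expR a0.
apply: (@le_lt_trans _ _ (\int[mu]_(t in `]0%R, +oo[) ((2 * c)%:E * (2^-1 * expR (- 2^-1 * t))%:E))%E).
  apply: ge0_le_integral => //=.
  - apply/measurable_EFinP; apply: measurableT_comp => //; exact: measurable_powRM.
  - apply: measurable_funeM; apply/measurable_EFinP; apply: measurable_funTS.
    apply: measurable_funM => //; apply: continuous_measurable_fun.
    exact: continuous_expRM.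
  - move=> t; rewrite in_itv/= andbT => t0.
    rewrite -EFinM lee_fin ger0_norm ?mulr_ge0 ?powR_ge0 ?expR_ge0//.
    have -> : 2 * c * (2^-1 * expR (- 2^-1 * t)) = c * expR (t / 2) * expR (- t).
      rewrite -[RHS]mulrA -expRD [t/2 - t](_ : _ = - 2^-1 * t); last by field.
      by field.
    by rewrite ler_wpM2r ?expR_ge0// H.
rewrite integral_itv_obnd_cbnd; last first.
  apply: measurable_funeM; apply/measurable_EFinP; apply: measurable_funTS.
  apply: measurable_funM => //; apply: continuous_measurable_fun.
  exact: continuous_expRM.
rewrite ge0_integralZl//=.
- by rewrite integral_expR ?invr_gt0// -EFinM ltry.
- apply/measurable_EFinP; apply: measurable_funTS.
  apply: measurable_funM => //; apply: continuous_measurable_fun.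
  exact: continuous_expRM.
- by rewrite lee_fin mulr_ge0.
Qed.

Lemma GammaE a : 0 <= a ->
  (\int[mu]_(t in `]0%R, +oo[) (t `^ a * expR (- t))%:E = (Gamma (1 + a))%:E)%E.
Proof.
move=> a0; rewrite /Gamma /Rintegral addrAC subrr add0r fineK//.
by apply: integrable_fin_num => //; exact: integrable_powR_expR.
Qed.

Lemma Gamma_gt0 a : 0 <= a -> 0 < Gamma (1 + a).
Proof.
move=> a0; rewrite -lte_fin -GammaE//.
apply: (@lt_le_trans _ _ (\int[mu]_(t in `[1%R, 2%R]) (expR (- 2))%:E)%E).
  rewrite integral_cst//= lebesgue_measure_itv/= lte_fin ltr1n -EFinB -EFinM lte_fin.
  by rewrite mulr_gt0 ?expR_gt0// subr_gt0 ltr1n.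
apply: (@le_trans _ _ (\int[mu]_(t in `[1%R, 2%R]) (t `^ a * expR (- t))%:E)%E).
  apply: ge0_le_integral => //=.
  - by apply/measurable_EFinP; exact: measurable_powRM.
  - move=> t; rewrite in_itv/= => /andP[t1 t2]; rewrite lee_fin.
    rewrite -[leLHS]mul1r ler_pM ?expR_ge0//.
      by rewrite -(powRr0 t) ler_powR.
    by rewrite ler_expR lerN2.
apply: ge0_subset_integral => //=.
- by apply/measurable_EFinP; exact: measurable_powRM.
- by move=> t _; rewrite lee_fin mulr_ge0 ?powR_ge0 ?expR_ge0.
- by move=> t /=; rewrite !in_itv/= andbT => /andP[t1 _]; rewrite (lt_le_trans _ t1).
Qed.

(** The substitution [u = s t] in the Gamma integral. *)
Lemma laplace_powR a s : 0 <= a -> 0 < s ->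
  (\int[mu]_(t in `]0%R, +oo[) (expR (- s * t) * t `^ a)%:E =
   (Gamma (1 + a) * s `^ (- (1 + a)))%:E)%E.
Proof.
move=> a0 s0; pose G t : R := t `^ a * expR (- t).
have mG : measurable_fun setT (fun t => expR (- s * t) * t `^ a).
  apply: measurable_funM; last exact: measurable_powR.
  by apply: continuous_measurable_fun; exact: continuous_expRM.
have := GammaE a0; rewrite integral_itv_obnd_cbnd; last first.
  by apply/measurable_EFinP; exact: measurable_powRM.
have dF t : is_derive t 1 (fun t : R => s * t) s.
  rewrite -[( *%R s)]/(s *: (id : R -> R)).
  by apply: is_derive_eq; rewrite [_%:A]mulr1.
have dFE : (fun t : R => s * t)^`()%classic = cst s.
  by apply/funext => t; rewrite derive1E; have [_ ->] := dF t.
have cF : continuous (fun t : R => s * t).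
  by move=> t; apply/differentiable_continuous/derivable1_diffP; have [] := dF t.
have := @increasing_ge0_integration_by_substitutiony _ (fun t => s * t) G 0.
rewrite dFE mulr0 => ->.
- rewrite integral_itv_obnd_cbnd; last by apply/measurable_EFinP; exact: measurable_funTS.
  have sa : 0 < s `^ (1 + a) by exact: powR_gt0.
  have -> : (\int[mu]_(x in `[0%R, +oo[) (((G \o [eta *%R s]) * cst s) x)%:E =
    \int[mu]_(x in `[0%R, +oo[) ((s `^ (1 + a))%:E * (expR (- s * x) * x `^ a)%:E))%E.
    apply: eq_integral => t; rewrite inE/= in_itv/= andbT => t0; rewrite -EFinM; congr EFin.
    rewrite -[LHS]/((s * t) `^ a * expR (- (s * t)) * s).
    rewrite powRM// ?(ltW s0)// powRD ?(gt_eqF s0) ?implybT// powRr1 ?(ltW s0)//.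
    by rewrite -mulNr; ring.
  rewrite ge0_integralZl//=; last 3 first.
  - by apply/measurable_EFinP; exact: measurable_funTS.
  - by move=> t _; rewrite lee_fin mulr_ge0 ?powR_ge0 ?expR_ge0.
  - by rewrite lee_fin ltW.
  move=> e; rewrite EFinM -e powRN muleC muleA -EFinM.
  by rewrite mulVf ?gt_eqF// mul1e.
- by move=> x y _ _ xy; rewrite ltr_pM2l.
- by move=> x _; exact: cvg_cst.
- exact: is_cvg_cst.
- exact: is_cvg_cst.
- split; first by move=> x _; have [] := dF x.
  by apply: cvg_at_right_filter; exact: cF.
- by apply: gt0_cvgMry => //; exact: cvg_id.
- have cE : continuous (fun y : R => expR (- y)).
    by move=> y; apply: continuous_comp; [exact: opp_continuous|exact: continuous_expR].
  apply/continuous_within_itvcyP; split.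
    move=> x; rewrite in_itv/= andbT => x0.
    have cP : {for x, continuous (fun y : R => y `^ a)}.
      apply/differentiable_continuous/derivable1_diffP; apply: derivable_powR.
      by rewrite in_itv/= x0.
    by apply: (cvgM cP); exact: cE.
  move: a0; rewrite /G le_eqVlt => /predU1P[<-|a0].
    rewrite powRr0; under eq_fun do rewrite powRr0.
    by apply: cvgM; [exact: cvg_cst|apply: cvg_at_right_filter; exact: cE].
  apply: cvgM; first by rewrite powR0 ?gt_eqF//; exact: powR_cvg0.
  by apply: cvg_at_right_filter; exact: cE.
- by move=> x _; rewrite mulr_ge0 ?powR_ge0 ?expR_ge0.
Qed.

End GammaIntegral.

(** * Uniqueness of the Laplace transform *)

Section LaplaceUniqueness.
Variable R : realType.
Local Notation mu := (@lebesgue_measure R).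

Lemma bernoulli_onem (y : R) m : 0 <= y <= 1 -> 1 - m%:R * y <= (1 - y) ^+ m.
Proof.
move=> /andP[y0 y1]; elim: m => [|m IH]; first by rewrite mul0r subr0.
rewrite exprS; apply: (@le_trans _ _ ((1 - y) * (1 - m%:R * y))).
  rewrite -natr1 -subr_ge0.
  by rewrite (_ : _ - _ = m%:R * y ^+ 2); [rewrite mulr_ge0// sqr_ge0|ring].
by rewrite ler_wpM2l// subr_ge0.
Qed.

(** This limit and the next one make [(1 - x^n)^(2^n)] a polynomial
    approximation of the indicator of [x < 1/2]: the transition occurs where
    [2^n x^n] crosses [1]. *)
Lemma cvg_selector1 (x : R) : 0 <= x -> 2 * x < 1 ->
  (1 - x ^+ n) ^+ (2 ^ n) @[n --> \oo] --> (1 : R).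
Proof.
move=> x0 x1; have x1' : x <= 1 by lra.
have xn n : 0 <= x ^+ n <= 1 by rewrite exprn_ge0//= exprn_ile1.
apply: (@squeeze_cvgr _ _ _ _ (fun n => 1 - (2 * x) ^+ n) (fun=> 1)).
- near=> n; apply/andP; split.
    by have := bernoulli_onem (2 ^ n) (xn n); rewrite natrX exprMn.
  have /andP[a b] := xn n.
  by rewrite exprn_ile1 ?subr_ge0// gerBl.
- rewrite -[X in _ --> X]subr0; apply: cvgB; first exact: cvg_cst.
  by apply: cvg_expr; rewrite ger0_norm// mulr_ge0.
- exact: cvg_cst.
Unshelve. all: by end_near. Qed.

Lemma cvg_selector0 (x : R) : x <= 1 -> 1 < 2 * x ->
  (1 - x ^+ n) ^+ (2 ^ n) @[n --> \oo] --> (0 : R).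
Proof.
move=> x1 x2; have x0 : 0 < x by lra.
have xn n : 0 <= x ^+ n <= 1 by rewrite exprn_ge0 ?(ltW x0)//= exprn_ile1 ?(ltW x0).
have x20 : 0 < 2 * x by rewrite mulr_gt0.
apply: (@squeeze_cvgr _ _ _ _ (fun=> 0) (fun n => ((2 * x)^-1) ^+ n)).
- near=> n; have /andP[a b] := xn n.
  rewrite exprn_ge0 ?subr_ge0//=.
  apply: (@le_trans _ _ (expR (- x ^+ n) ^+ (2 ^ n))).
    by rewrite lerXn2r ?nnegrE ?subr_ge0 ?expR_ge0//; exact: expR_ge1Dx.
  rewrite -expRM_natl natrX mulrN -exprMn expRN exprVn lef_pV2 ?posrE ?expR_gt0 ?exprn_gt0//.
  by apply: le_trans (expR_ge1Dx _); rewrite lerDr.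
- exact: cvg_cst.
- by apply: cvg_expr; rewrite ger0_norm ?invr_ge0 ?ltW// invf_lt1.
Unshelve. all: by end_near. Qed.

Variables (f : R -> R) (c : R).
Hypotheses (c0 : 0 < c) (fi : mu.-integrable `]0, +oo[ (EFin \o f)).
Hypothesis fL : forall r, 0 <= r ->
  (\int[mu]_(t in `]0%R, +oo[) (expR (- r * t) * f t)%:E = 0)%E.

Let mf : measurable_fun (`]0, +oo[ : set R) f.
Proof. by apply/measurable_EFinP; exact: measurable_int fi. Qed.

Let mexp r : measurable_fun (`]0, +oo[ : set R) (fun t : R => expR (- r * t)).
Proof. by apply: measurable_funTS; apply: continuous_measurable_fun; exact: continuous_expRM. Qed.

Let ei r : 0 <= r -> mu.-integrable `]0, +oo[ (fun t => (expR (- r * t) * f t)%:E).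
Proof.
move=> r0; apply: le_integrable fi => //.
  by apply/measurable_EFinP; exact: (measurable_funM (mexp r) mf).
move=> t /=; rewrite in_itv/= andbT => t0; rewrite lee_fin normrM ger0_norm ?expR_ge0//.
by rewrite ler_piMl// -[leRHS]expR0 ler_expR mulNr oppr_le0 mulr_ge0// ltW.
Qed.

Let poly_weight (p : {poly R}) s : 0 <= s ->
  (\int[mu]_(t in `]0%R, +oo[) (p.[expR (- s * t)] * f t)%:E = 0)%E.
Proof.
move=> s0.
transitivity (\int[mu]_(t in `]0%R, +oo[)
    \sum_(i < size p) ((p`_i)%:E * (expR (- (i%:R * s) * t) * f t)%:E))%E.
  apply: eq_integral => t _; rewrite horner_coef mulr_suml -sumEFin.
  apply: eq_bigr => i _; rewrite -EFinM mulrA -expRM_natl.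
  by rewrite !mulNr mulrN mulrA.
rewrite integral_sum//; last by move=> i; apply: integrableZl => //; apply: ei; rewrite mulr_ge0.
rewrite big1// => i _; rewrite integralZl//; last by apply: ei; rewrite mulr_ge0.
by rewrite fL ?mule0// mulr_ge0.
Qed.

(** The weights [(1 - e^(- s n t))^(2^n)], with [s] chosen so that [e^(- s c) =
    1/2], are polynomials in [e^(- s t)] and converge to the indicator of [c <
    t]. Each of them integrates to [0] against [f], and they stay in [[0, 1]],
    so that the limit may be taken under the integral sign. *)
Lemma laplace_zero_tail : (\int[mu]_(t in `]c, +oo[) (f t)%:E = 0)%E.
Proof.
pose s := ln 2 / c; have s0 : 0 < s by rewrite divr_gt0// ln_gt0// ltr1n.
pose w (n : nat) (t : R) : R := (1 - expR (- s * t) ^+ n) ^+ (2 ^ n).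
pose fn (n : nat) (t : R) := (w n t * f t)%:E.
pose g := ((EFin \o f) \_ `]c, +oo[).
have wE n (t : R) : w n t = ((1 - 'X^n) ^+ (2 ^ n) : {poly R}).[expR (- s * t)].
  by rewrite horner_exp hornerD hornerN hornerXn -polyC1 hornerC.
have fn0 n : (\int[mu]_(t in `]0%R, +oo[) fn n t = 0)%E.
  by rewrite -[RHS](poly_weight ((1 - 'X^n) ^+ (2 ^ n)) (ltW s0)); apply: eq_integral => t _; rewrite /fn wE.
have mw n : measurable_fun (`]0, +oo[ : set R) (w n).
  by apply: measurable_funX; apply: measurable_funB => //; apply: measurable_funX; exact: mexp.
have mg : measurable_fun (`]0, +oo[ : set R) g.
  apply/(measurable_restrict _ (measurable_itv _) (measurable_itv _)).
  by apply: measurable_funS (measurable_int _ fi) => //; exact: subIsetl.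
have fi' : mu.-integrable `]0, +oo[ (fun t => `|f t|%:E) by exact: integrable_norm fi.
have [|||||_ _] := @dominated_convergence _ _ _ mu `]0, +oo[ (measurable_itv _) fn g (fun t => `|f t|%:E).
- by move=> n; apply/measurable_EFinP; exact: (measurable_funM (mw n) mf).
- exact: mg.
(* The selectors say nothing at [t = c], which is a null set. *)
- exists [set c]; split => //; first exact: lebesgue_measure_set1.
  move=> t /= h; apply: contrapT => /eqP tc; apply: h; rewrite in_itv/= andbT => t0.
  have x0 : 0 <= expR (- s * t) by exact: expR_ge0.
  (* The choice of [s] places the threshold [2 x = 1] of the selectors at [t =
     c]. *)
  have x2 : 2 * expR (- s * t) = expR (ln 2 * (1 - t / c)).
    rewrite mulrDr mulr1 expRD lnK ?posrE//; congr (_ * expR _).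
    by rewrite /s; ring.
  rewrite /fn /g patchE; case: ifPn => [|tc'].
    rewrite inE/= in_itv/= andbT => ct.
    apply: cvg_EFin; first exact: nearW.
    rewrite -[X in _ --> X]mul1r; apply: cvgM; last exact: cvg_cst.
    apply: cvg_selector1 => //; rewrite x2 -[ltRHS]expR0 ltr_expR pmulr_rlt0 ?ln_gt0 ?ltr1n//.
    by rewrite subr_lt0 ltr_pdivlMr// mul1r.
  have ct : t < c.
    by move: tc'; rewrite notin_setE/= in_itv/= andbT => /negP; rewrite -leNgt le_eqVlt (negbTE tc).
  rewrite -[point]/(0%R%:E); apply: cvg_EFin; first exact: nearW.
  rewrite -[X in _ --> X](mul0r (f t)); apply: cvgM; last exact: cvg_cst.
  apply: cvg_selector0.
    by rewrite -[leRHS]expR0 ler_expR mulNr oppr_le0 mulr_ge0// ltW.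
  rewrite x2 -[ltLHS]expR0 ltr_expR pmulr_rgt0 ?ln_gt0 ?ltr1n//.
  by rewrite subr_gt0 ltr_pdivrMr// mul1r.
- exact: fi'.
- apply: aeW => t n; rewrite /= in_itv/= andbT => t0.
  have /andP[x0 x1] : 0 <= expR (- s * t) <= 1.
    by rewrite expR_ge0 -[leRHS]expR0 ler_expR mulNr oppr_le0 mulr_ge0// ltW.
  have /andP[y0 y1] : 0 <= 1 - expR (- s * t) ^+ n <= 1.
    by rewrite subr_ge0 exprn_ile1//= gerBl exprn_ge0.
  by rewrite lee_fin normrM ler_piMl// ger0_norm ?exprn_ge0// exprn_ile1.
- rewrite /= => h; have -> : (\int[mu]_(t in `]c, +oo[) (f t)%:E = \int[mu]_(t in `]0%R, +oo[) g t)%E.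
    rewrite /g -integral_mkcondr; congr (integral _ _ _); apply/seteqP; split => t /=.
      by rewrite !in_itv/= !andbT => ct; split => //; exact: lt_trans ct.
    by move=> [].
  apply: (cvg_unique _ h) => //.
  rewrite /= (_ : (fun n => _) = fun=> 0%E); first exact: cvg_cst.
  by apply/funext => n; exact: fn0.
Qed.

End LaplaceUniqueness.

(** * The Mittag-Leffler function through its Laplace transform *)

Section MittagLeffler.
Variables (R : realType) (nu m : R).
Hypotheses (nu0 : 0 < nu) (m0 : 0 <= m).
Local Notation mu := (@lebesgue_measure R).
Implicit Types (s t : R) (n : nat).

(** The absolute value of the general term of the Mittag-Leffler series at [- m
    t^nu]. *)
Definition ml_term n t : R := m ^+ n / Gamma (1 + n%:R * nu) * t `^ (n%:R * nu).
(** The Laplace transforms of the terms form a geometric sequence with this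
    ratio. *)
Definition ml_ratio s : R := m * s `^ (- nu).

Let nnu n : 0 <= n%:R * nu. Proof. by rewrite mulr_ge0// ltW. Qed.

Lemma ml_term_ge0 n t : 0 <= ml_term n t.
Proof.
by rewrite mulr_ge0 ?powR_ge0// divr_ge0 ?exprn_ge0// ltW// Gamma_gt0.
Qed.

Lemma le_ml_term n s t : 0 <= s -> s <= t -> ml_term n s <= ml_term n t.
Proof.
move=> s0 st; rewrite ler_wpM2l ?divr_ge0 ?exprn_ge0//; first by rewrite ltW// Gamma_gt0.
by rewrite ge0_ler_powR// nnegrE// (le_trans s0).
Qed.

Lemma ml_signed n t : (- m * t `^ nu) ^+ n / Gamma (1 + n%:R * nu) = (-1) ^+ n * ml_term n t.
Proof.
by rewrite /ml_term mulNr exprNn exprMn -(powR_mulrn n (powR_ge0 _ _)) -powRrM [nu * _]mulrC; ring.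
Qed.

Lemma ml_ratio_ge0 s : 0 <= ml_ratio s.
Proof. by rewrite mulr_ge0// powR_ge0. Qed.

Lemma measurable_ml_term n (D : set R) : measurable_fun D (ml_term n).
Proof.
apply: measurable_funTS; apply: measurable_funM => //; exact: measurable_powR.
Qed.

Lemma measurable_expRM s (D : set R) : measurable_fun D (fun t : R => expR (s * t)).
Proof. by apply: measurable_funTS; apply: continuous_measurable_fun; exact: continuous_expRM. Qed.

Lemma laplace_ml_term n s : 0 < s ->
  (\int[mu]_(t in `]0%R, +oo[) (expR (- s * t) * ml_term n t)%:E =
   (s^-1 * ml_ratio s ^+ n)%:E)%E.
Proof.
move=> s0; have g0 := Gamma_gt0 (nnu n).
transitivity (\int[mu]_(t in `]0%R, +oo[) ((m ^+ n / Gamma (1 + n%:R * nu))%:E *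
    (expR (- s * t) * t `^ (n%:R * nu))%:E))%E.
  by apply: eq_integral => t _; rewrite -EFinM; congr EFin; rewrite /ml_term; ring.
rewrite ge0_integralZl//=.
- rewrite laplace_powR// -EFinM; congr EFin.
  rewrite opprD powRD ?(gt_eqF s0) ?implybT// powRN powRr1 ?(ltW s0)//.
  rewrite /ml_ratio exprMn -(powR_mulrn n (powR_ge0 _ _)) -powRrM mulNr [nu * _]mulrC.
  by field; rewrite !gt_eqF.
- apply/measurable_EFinP; apply: measurable_funM; first exact: measurable_expRM.
  by apply: measurable_funTS; exact: measurable_powR.
- by move=> t _; rewrite lee_fin mulr_ge0 ?powR_ge0 ?expR_ge0.
- by rewrite lee_fin divr_ge0 ?exprn_ge0// ltW.
Qed.

Lemma integrable_ml_term n s : 0 < s ->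
  mu.-integrable `]0, +oo[ (fun t => (expR (- s * t) * ml_term n t)%:E).
Proof.
move=> s0; apply/integrableP; split.
  apply/measurable_EFinP; apply: measurable_funM; first exact: measurable_expRM.
  exact: measurable_ml_term.
rewrite [ltLHS](_ : _ = (s^-1 * ml_ratio s ^+ n)%:E) ?ltry// -laplace_ml_term//.
by apply: eq_integral => t _; rewrite gee0_abs// lee_fin mulr_ge0 ?expR_ge0 ?ml_term_ge0.
Qed.

Let S N t := \sum_(n < N) ml_term n t.

Let integral_S N s : 0 < s ->
  (\int[mu]_(t in `]0%R, +oo[) (expR (- s * t) * S N t)%:E =
   (s^-1 * \sum_(n < N) ml_ratio s ^+ n)%:E)%E.
Proof.
move=> s0.
transitivity (\int[mu]_(t in `]0%R, +oo[) \sum_(n < N) (expR (- s * t) * ml_term n t)%:E)%E.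
  by apply: eq_integral => t _; rewrite sumEFin -mulr_sumr.
rewrite integral_sum//; last by move=> n; exact: integrable_ml_term.
by rewrite mulr_sumr -sumEFin; apply: eq_bigr => n _; exact: laplace_ml_term.
Qed.

Lemma geometric_le (q : R) N : 0 <= q < 1 -> \sum_(n < N) q ^+ n <= (1 - q)^-1.
Proof.
move=> /andP[q0 q1]; have q1' : 0 < 1 - q by rewrite subr_gt0.
have -> : \sum_(n < N) q ^+ n = (1 - q ^+ N) / (1 - q).
  apply: (canRL (mulfK _)); first by rewrite gt_eqF.
  by rewrite -opprB mulrN mulrC -subrX1 opprB.
by rewrite -[leRHS]mul1r ler_pM2r ?invr_gt0// gerBl exprn_ge0.
Qed.

(** The partial sums [S] are nondecreasing in time, so that [e^(- s t) S t] is
    at most the integral over [[t, +oo[] of [s e^(- s u) S u], hence at most the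
    whole Laplace transform, a geometric sum. This bound proves the convergence
    of the Mittag-Leffler series and provides the dominating function for
    [laplace_mittag_leffler]. *)
Lemma sum_ml_term_le N s t : 0 < s -> ml_ratio s < 1 -> 0 <= t ->
  \sum_(n < N) ml_term n t <= expR (s * t) / (1 - ml_ratio s).
Proof.
move=> s0 q1 t0; rewrite -/(S N t).
have S0 u : 0 <= S N u by apply: sumr_ge0 => n _; exact: ml_term_ge0.
suff : ((expR (- s * t) * S N t)%:E <= (s * (s^-1 * \sum_(n < N) ml_ratio s ^+ n))%:E)%E.
  rewrite lee_fin mulVKf ?gt_eqF// => h.
  have := le_trans h (geometric_le N _); rewrite ml_ratio_ge0 q1 => /(_ isT) {}h.
  by rewrite -ler_pdivrMl ?expR_gt0// -expRN -mulNr.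
have mS (D : set R) : measurable_fun D (S N).
  by apply: measurable_sum => n; exact: measurable_ml_term.
have mE (D : set R) : measurable_fun D (fun u => (expR (- s * u) * S N u)%:E).
  by apply/measurable_EFinP; apply: measurable_funM => //; exact: measurable_expRM.
have mF (D : set R) : measurable_fun D (fun u => (s * expR (- s * u))%:E).
  by apply/measurable_EFinP; apply: measurable_funM => //; exact: measurable_expRM.
have E0 u : (0 <= (expR (- s * u) * S N u)%:E)%E by rewrite lee_fin mulr_ge0 ?expR_ge0.
rewrite [leRHS]EFinM -integral_S// -ge0_integralZl//=; last 2 first.
- exact: mE.
- by rewrite lee_fin ltW.
rewrite mulrC [leLHS]EFinM -integral_expR// -ge0_integralZl//=; last 3 first.
- exact: mF.
- by move=> u _; rewrite lee_fin mulr_ge0 ?expR_ge0// ltW.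
- by rewrite lee_fin.
rewrite integral_itv_obnd_cbnd; last by apply: measurable_funeM; exact: mE.
apply: (@le_trans _ _ (\int[mu]_(u in `[t, +oo[) (s%:E * (expR (- s * u) * S N u)%:E))%E).
  apply: ge0_le_integral => //=.
  - by move=> u _; rewrite -EFinM lee_fin mulr_ge0// mulr_ge0 ?expR_ge0// ltW.
  - by apply: measurable_funeM; exact: mF.
  - by apply: measurable_funeM; exact: mE.
  - move=> u; rewrite in_itv/= andbT => tu; rewrite -!EFinM lee_fin.
    rewrite mulrC -mulrA; apply: ler_wpM2l; first exact: ltW.
    apply: ler_wpM2l; first exact: expR_ge0.
    by apply: ler_sum => n _; exact: le_ml_term.
apply: ge0_subset_integral => //=.
- by apply: measurable_funeM; exact: mE.
- by move=> u _; rewrite mule_ge0// lee_fin ltW.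
- by move=> u /=; rewrite !in_itv/= !andbT; exact: le_trans.
Qed.

Lemma cvg_ml_term s t : 0 < s -> ml_ratio s < 1 -> 0 <= t -> cvgn (series (ml_term^~ t)).
Proof.
move=> s0 q1 t0; apply: nondecreasing_is_cvgn.
  by apply: nondecreasing_series => n _ _; exact: ml_term_ge0.
exists (expR (s * t) / (1 - ml_ratio s)) => _ [N _ <-].
by rewrite /series/= big_mkord; exact: sum_ml_term_le.
Qed.

Lemma ml_ratio_lt1 : exists2 s, 0 < s & forall u, s <= u -> ml_ratio u < 1.
Proof.
exists ((m + 1) `^ nu^-1) => [|u su]; first by rewrite powR_gt0// ltr_wpDl.
have u0 : 0 < u by rewrite (lt_le_trans _ su)// powR_gt0// ltr_wpDl.
rewrite /ml_ratio powRN ltr_pdivrMr ?powR_gt0// mul1r (@lt_le_trans _ _ (m + 1)) ?ltrDl//.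
have -> : m + 1 = ((m + 1) `^ nu^-1) `^ nu.
  by rewrite -powRrM mulVf ?gt_eqF// powRr1// addr_ge0.
by rewrite ge0_ler_powR ?(ltW nu0)// nnegrE ?powR_ge0// ltW.
Qed.

End MittagLeffler.

Lemma integrable_expR (R : realType) (s : R) : 0 < s ->
  (@lebesgue_measure R).-integrable `]0, +oo[ (fun t => (s * expR (- s * t))%:E).
Proof.
move=> s0; have mE : measurable_fun (`]0, +oo[ : set R) (fun t => (s * expR (- s * t))%:E).
  by apply/measurable_EFinP; apply: measurable_funM => //; exact: measurable_expRM.
apply/integrableP; split; first exact: mE.
rewrite [ltLHS](_ : _ = (expR (- s * 0))%:E) ?ltry// -integral_expR//.
rewrite -integral_itv_obnd_cbnd; last exact: mE.
by apply: eq_integral => t _; rewrite gee0_abs// lee_fin mulr_ge0 ?expR_ge0 ?(ltW s0).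
Qed.

Section MittagLefflerLaplace.
Variables (R : realType) (nu m : R).
Hypotheses (nu0 : 0 < nu) (m0 : 0 <= m).
Local Notation mu := (@lebesgue_measure R).
Local Notation g t := (mittag_leffler nu (- m * t `^ nu)).
Local Notation mlt := (ml_term nu m).
Implicit Types (s t : R) (n : nat).

Let Sg N t := \sum_(n < N) (-1) ^+ n * mlt n t.
Let SgE N t : Sg N t = series (fun n => (- m * t `^ nu) ^+ n / Gamma (1 + n%:R * nu)) N.
Proof. by rewrite /series/= big_mkord; apply: eq_bigr => n _; rewrite ml_signed. Qed.

Let cvg_abs t : 0 <= t -> cvgn (series (mlt^~ t)).
Proof.
move=> t0; have [s s0 /(_ s (lexx s)) q1] := ml_ratio_lt1 nu0 m0.
exact: cvg_ml_term s0 q1 t0.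
Qed.

Let abs_term n t : `|(-1) ^+ n * mlt n t| = mlt n t.
Proof. by rewrite normrM normrX normrN1 expr1n mul1r ger0_norm// ml_term_ge0. Qed.

Let cvg_Sg t : 0 <= t -> Sg N t @[N --> \oo] --> g t.
Proof.
move=> t0; rewrite (_ : (fun N => Sg N t) =
    series (fun n => (- m * t `^ nu) ^+ n / Gamma (1 + n%:R * nu))); last first.
  by apply/funext => N; exact: SgE.
apply: normed_cvg; rewrite (_ : [normed _] = series (mlt^~ t)); first exact: cvg_abs.
by apply/funext => N; apply: eq_bigr => n _ /=; rewrite ml_signed// abs_term.
Qed.

Let Sg_tail N K s t : 0 <= s -> s <= t -> (N <= K)%N ->
  `|Sg K s - Sg N s| <= series (mlt^~ t) K - series (mlt^~ t) N.
Proof.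
move=> s0 st NK; rewrite sub_series_geq// /Sg.
rewrite -!(big_mkord xpredT (fun n => (-1) ^+ n * mlt n s)).
rewrite (big_cat_nat _ NK)//= addrAC subrr add0r.
apply: (le_trans (ler_norm_sum _ _ _)); apply: ler_sum => n _.
by rewrite abs_term le_ml_term.
Qed.

Let g_tail N s t : 0 <= s -> s <= t ->
  `|g s - Sg N s| <= limn (series (mlt^~ t)) - series (mlt^~ t) N.
Proof.
move=> s0 st.
have h : `|Sg K s - Sg N s| @[K --> \oo] --> `|g s - Sg N s|.
  by apply: cvg_norm; apply: cvgB; [exact: cvg_Sg|exact: cvg_cst].
rewrite -(cvg_lim _ h)//; apply: limr_le; first by apply/cvg_ex; exists (`|g s - Sg N s|).
near=> K; apply: (le_trans (Sg_tail s0 st _)); first by near: K; exact: nbhs_infty_ge.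
rewrite lerB// nondecreasing_cvgn_le//; last by apply: cvg_abs; exact: le_trans st.
by apply: nondecreasing_series => n _ _; exact: ml_term_ge0.
Unshelve. all: by end_near. Qed.

Lemma mittag_leffler_continuous t : 0 < t -> {for t, continuous (fun t => g t)}.
Proof.
move=> t0; apply/cvgrPdist_lt => e e0.
have h : series (mlt^~ (t + 1)) N @[N --> \oo] --> limn (series (mlt^~ (t + 1))).
  by apply: cvg_abs; rewrite addr_ge0// ltW.
have e3 : 0 < e / 3 by rewrite divr_gt0.
have /cvgrPdist_lt/(_ _ e3)[N _ /(_ N (leqnn N))/= hN] := h.
have cS : {for t, continuous (Sg N)}.
  have cP n : {for t, continuous (fun y : R => y `^ (n%:R * nu))}.
    apply/differentiable_continuous/derivable1_diffP; apply: derivable_powR.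
    by rewrite in_itv/= t0.
  apply: (@cvg_sum_ord R _ (nbhs t) (nbhs_filter t) N) => n.
  apply: cvgM; first exact: cvg_cst.
  by apply: cvgM; [exact: cvg_cst|exact: cP].
have tail s : 0 <= s -> s <= t + 1 -> `|g s - Sg N s| < e / 3.
  move=> s0 s1; apply: le_lt_trans hN.
  by apply: (le_trans (g_tail N s0 s1)); rewrite ler_norm.
have /cvgrPdist_lt/(_ _ e3) cSe := cS.
suff : \forall s \near t, `|g t - g s| < e by [].
near=> s; have s0 : 0 < s by near: s; exact: lt_nbhsr.
have s1 : s <= t + 1 by apply: ltW; near: s; apply: lt_nbhsl; rewrite ltrDl.
have h3 : `|Sg N t - Sg N s| < e / 3 by near: s.
have := tail t (ltW t0); rewrite lerDl ler01 => /(_ isT) h1.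
have h2 := tail s (ltW s0) s1.
rewrite (_ : g t - g s = (g t - Sg N t) + (Sg N t - Sg N s) - (g s - Sg N s)); last by ring.
apply: (le_lt_trans (ler_normB _ _)); apply: (le_lt_trans (lerD (ler_normD _ _) (lexx _))).
lra.
Unshelve. all: by end_near. Qed.

(** The alternating geometric series of the Laplace transforms of the terms. The
    partial sums are dominated by means of [sum_ml_term_le] at the smaller
    parameter [s0]. *)
Lemma laplace_mittag_leffler s0 s : 0 < s0 -> ml_ratio nu m s0 < 1 -> s0 < s ->
  ml_ratio nu m s < 1 ->
  mu.-integrable `]0, +oo[ (fun t => (expR (- s * t) * g t)%:E) /\
  (\int[mu]_(t in `]0%R, +oo[) (expR (- s * t) * g t)%:E =
   (s^-1 / (1 + ml_ratio nu m s))%:E)%E.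
Proof.
move=> s00 q0 s0s q1; have sp : 0 < s by exact: lt_trans s0s.
have ms : 0 <= ml_ratio nu m s by exact: ml_ratio_ge0.
pose f N t := (expR (- s * t) * Sg N t)%:E.
pose B t := ((1 - ml_ratio nu m s0)^-1 / (s - s0) * ((s - s0) * expR (- (s - s0) * t)))%:E.
have mSg N (D : set R) : measurable_fun D (Sg N).
  by apply: measurable_sum => n; apply: measurable_funM => //; exact: measurable_ml_term.
have mf N : measurable_fun (`]0, +oo[ : set R) (f N).
  by apply/measurable_EFinP; apply: measurable_funM => //; exact: measurable_expRM.
have fg t : 0 < t -> f N t @[N --> \oo] --> (expR (- s * t) * g t)%:E.
  move=> t0; apply: cvg_EFin; first exact: nearW.
  by apply: cvgM; [exact: cvg_cst|apply: cvg_Sg; exact: ltW].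
have mg : measurable_fun (`]0, +oo[ : set R) (fun t => (expR (- s * t) * g t)%:E).
  apply: (emeasurable_fun_cvg f) => // t /=.
  by rewrite in_itv/= andbT; exact: fg.
have ss0 : 0 < s - s0 by rewrite subr_gt0.
have iB : mu.-integrable `]0, +oo[ B.
  apply: eq_integrable (integrableZl _ ((1 - ml_ratio nu m s0)^-1 / (s - s0)) (integrable_expR ss0)) => //.
have [|||||I _ C] := @dominated_convergence _ _ _ mu `]0, +oo[ (measurable_itv _) f
   (fun t => (expR (- s * t) * g t)%:E) B.
- exact: mf.
- exact: mg.
- by apply: aeW => t /=; rewrite in_itv/= andbT; exact: fg.
- exact: iB.
- apply: aeW => t N /=; rewrite in_itv/= andbT => t0.
  rewrite lee_fin normrM ger0_norm ?expR_ge0// mulrA mulfVK ?gt_eqF//.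
  have -> : expR (- (s - s0) * t) = expR (- s * t) * expR (s0 * t).
    by rewrite -expRD; congr expR; ring.
  rewrite mulrCA; apply: ler_wpM2l; first exact: expR_ge0.
  rewrite mulrC.
  apply: le_trans (sum_ml_term_le nu0 m0 N s00 q0 (ltW t0)).
  apply: (le_trans (ler_norm_sum _ _ _)); apply: ler_sum => n _.
  by rewrite abs_term.
- split=> //; apply: (cvg_unique _ C) => //.
  rewrite [X in X @ _](_ : _ = fun N => (series (geometric s^-1 (- ml_ratio nu m s)) N)%:E).
    apply: cvg_EFin; first exact: nearW.
    rewrite -[1 + _]/(1 + _) -[X in 1 + X]opprK; apply: cvg_geometric_series.
    by rewrite normrN ger0_norm.
  apply/funext => N /=.
  transitivity (\int[mu]_(t in `]0%R, +oo[)
      \sum_(n < N) ((-1) ^+ n)%:E * (expR (- s * t) * mlt n t)%:E)%E.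
    apply: eq_integral => t _; rewrite /f/= mulr_sumr -sumEFin; apply: eq_bigr => n _.
    by rewrite -EFinM mulrCA.
  rewrite integral_sum//; last first.
    by move=> n; apply: integrableZl => //; exact: integrable_ml_term.
  rewrite /series/= big_mkord -sumEFin; apply: eq_bigr => n _.
  rewrite integralZl//; last exact: integrable_ml_term.
  by rewrite laplace_ml_term// -EFinM /geometric/= [in RHS]exprNn mulrCA.
Qed.

(** By [laplace_zero_tail], [e^(- s1 u) (F u - g u)] integrates to [0] over
    every segment of the half-line. Were [F t] and [g t] different at some [t],
    then, [g] being continuous and [F] monotone, the difference would keep its
    sign and stay away from [0] on an interval with endpoint [t]: on the right
    of [t] if [F t < g t], on the left if [F t > g t]. *)
Theorem mittag_leffler_of_laplace (F : R -> R) :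
  measurable_fun (`]0, +oo[ : set R) F ->
  (forall s t, 0 < s -> s <= t -> F t <= F s) ->
  (forall t, 0 < t -> 0 <= F t <= 1) ->
  (forall s, 0 < s -> ml_ratio nu m s < 1 ->
    (\int[mu]_(t in `]0%R, +oo[) (expR (- s * t) * F t)%:E =
     (s^-1 / (1 + ml_ratio nu m s))%:E)%E) ->
  forall t, 0 < t -> F t = g t.
Proof.
move=> mF Fle F01 FL t t0.
have [s0 s00 q] := ml_ratio_lt1 nu0 m0.
pose s1 := s0 + 1; have s01 : s0 < s1 by rewrite ltrDl.
have s10 : 0 < s1 by exact: lt_trans s01.
(* The factor makes the difference integrable: the Laplace transform of the
   series is available beyond [s0] only. *)
pose f u := expR (- s1 * u) * (F u - g u).
have iF s : 0 < s -> mu.-integrable `]0, +oo[ (fun t => (expR (- s * t) * F t)%:E).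
  move=> sp; apply: le_integrable (integrableZl _ s^-1 (integrable_expR sp)) => //.
    by apply/measurable_EFinP; apply: measurable_funM => //; exact: measurable_expRM.
  move=> u /=; rewrite in_itv/= andbT => u0; have /andP[a b] := F01 _ u0.
  rewrite lee_fin mulKf ?gt_eqF// ger0_norm ?mulr_ge0 ?expR_ge0// ger0_norm ?expR_ge0//.
  by rewrite ler_piMr ?expR_ge0.
have ig s : s1 <= s -> mu.-integrable `]0, +oo[ (fun t => (expR (- s * t) * g t)%:E).
  move=> ss; have s0s := lt_le_trans s01 ss.
  by have [] := laplace_mittag_leffler s00 (q _ (lexx _)) s0s (q _ (ltW s0s)).
have ifB r : 0 <= r -> mu.-integrable `]0, +oo[
    (fun u => (expR (- (s1 + r) * u) * F u)%:E - (expR (- (s1 + r) * u) * g u)%:E)%E.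
  move=> r0; apply: integrableB => //; first by apply: iF; rewrite ltr_wpDr.
  by apply: ig; rewrite lerDl.
have fE r u : ((expR (- (s1 + r) * u) * F u)%:E - (expR (- (s1 + r) * u) * g u)%:E)%E =
    (expR (- r * u) * f u)%:E.
  rewrite -EFinB /f; congr EFin; rewrite mulrA -expRD -mulrBr; congr (expR _ * _); ring.
have ifi : mu.-integrable `]0, +oo[ (EFin \o f).
  apply: eq_integrable (ifB 0 (lexx _)) => // u _.
  by rewrite fE oppr0 mul0r expR0 mul1r.
have fL r : 0 <= r -> (\int[mu]_(t in `]0%R, +oo[) (expR (- r * t) * f t)%:E = 0)%E.
  move=> r0; under eq_integral do rewrite -fE.
  have rs : s1 <= s1 + r by rewrite lerDl.
  have rs0 := lt_le_trans s01 rs.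
  rewrite integralB//; [|by apply: iF; rewrite ltr_wpDr|exact: ig].
  rewrite FL ?ltr_wpDr//; last by apply: q; exact: ltW.
  have [_ ->] := laplace_mittag_leffler s00 (q _ (lexx _)) rs0 (q _ (ltW rs0)).
  by rewrite subee.
have tail c : 0 < c -> (\int[mu]_(u in `]c, +oo[) (f u)%:E = 0)%E.
  by move=> c0; exact: (@laplace_zero_tail R f c c0 ifi fL).
have seg a b : 0 < a -> a < b -> (\int[mu]_(u in `]a, b]) (f u)%:E = 0)%E.
  move=> a0 ab; have b0 := lt_trans a0 ab.
  have abE : `]a, +oo[%classic = `]a, b] `|` `]b, +oo[ :> set R.
    apply/seteqP; split => u /=; rewrite !in_itv/= !andbT.
      by move=> ->; case: (leP u b); [left|right].
    by move=> [/andP[]//|]; exact: lt_trans.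
  have := tail a a0; rewrite abE integral_setU//; last 2 first.
  - rewrite -abE; apply: measurable_funS (measurable_int _ ifi) => //.
    by move=> u /=; rewrite !in_itv/= !andbT; exact: lt_trans.
  - apply/disj_setPS => u [] /=; rewrite !in_itv/= andbT => /andP[_ ub] bu.
    by have := le_lt_trans ub bu; rewrite ltxx.
  by rewrite tail// adde0.
(* The real [z] stands for a sign. *)
have no_sign a b k z : 0 < a -> a < b -> 0 < k -> (forall u, a < u -> u <= b -> k <= z * f u) -> False.
  move=> a0 ab k0 kf.
  have fab : mu.-integrable `]a, b] (EFin \o f).
    apply: integrableS ifi => // u /=; rewrite !in_itv/= andbT => /andP[au _].
    exact: lt_trans au.
  have : ((k * (b - a))%:E <= 0)%E.
    rewrite -(mule0 z%:E) -(seg a b a0 ab) -integralZl//.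
    apply: (@le_trans _ _ (\int[mu]_(u in `]a, b]) k%:E)%E).
      by rewrite integral_cst//= lebesgue_measure_itv/= lte_fin ab -EFinB -EFinM.
    apply: ge0_le_integral => //=.
    - by move=> u _; rewrite lee_fin ltW.
    - by apply: measurable_funeM; exact: measurable_int fab.
    - by move=> u; rewrite in_itv/= => /andP[au ub]; rewrite -EFinM lee_fin kf.
  by rewrite lee_fin leNgt mulr_gt0// subr_gt0.
have gc := mittag_leffler_continuous t0.
apply/eqP/negPn/negP => Fg.
have d0 : 0 < `|F t - g t| / 2 by rewrite divr_gt0// normr_gt0 subr_eq0.
have /cvgrPdist_lt/(_ _ d0)[r /= r0 gr] := gc.
have [e [e0 et er]] : exists e, [/\ 0 < e, e < t & e < r].
  have [m1 m2 m3] : [/\ 0 < Num.min t r, Num.min t r <= t & Num.min t r <= r].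
    by rewrite lt_min t0 !ge_min !lexx orbT.
  by exists (Num.min t r / 2); split; lra.
have k0 : 0 < expR (- s1 * (t + e)) * (`|F t - g t| / 2) by rewrite mulr_gt0 ?expR_gt0.
have bound u w : 0 < u -> u <= t + e -> `|F t - g t| / 2 <= w ->
    expR (- s1 * (t + e)) * (`|F t - g t| / 2) <= expR (- s1 * u) * w.
  move=> u0 ue h; rewrite ler_pM ?expR_ge0 ?(ltW d0)// ler_expR !mulNr lerN2.
  by rewrite ler_wpM2l// ltW.
have [Flt|Fgt] := ltP (F t) (g t).
  apply: (no_sign t (t + e) _ (-1) t0 _ k0); first by rewrite ltrDl.
  move=> u tu ue; have -> : -1 * f u = expR (- s1 * u) * (g u - F u) by rewrite /f; ring.
  apply: bound => //; first exact: lt_trans tu.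
  have h1 := Fle _ _ t0 (ltW tu).
  have : `|t - u| < r by rewrite distrC gtr0_norm ?subr_gt0//; apply: le_lt_trans er; lra.
  move=> /gr; rewrite ltr_norml ltr0_norm ?subr_lt0// => /andP[]; lra.
apply: (no_sign (t - e) t _ 1 _ _ k0); rewrite ?subr_gt0 ?gtrBl//.
move=> u eu ut; have u0 : 0 < u by apply: lt_trans eu; rewrite subr_gt0.
rewrite mul1r /f; apply: bound => //; first by rewrite (le_trans ut)// lerDl ltW.
have h1 := Fle _ _ u0 ut.
have : `|t - u| < r by rewrite ger0_norm ?subr_ge0//; apply: lt_trans er; lra.
by move=> /gr; rewrite ltr_norml ger0_norm ?subr_ge0// => /andP[]; lra.
Qed.

End MittagLefflerLaplace.

(** * The inverse stable subordinator *)

Section InverseSubordinator.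
Variables (R : realType) (d : measure_display) (Omega : measurableType d).
Variables (P : probability Omega R) (nu : R) (H : R -> Omega -> R).
Hypotheses (nu0 : 0 < nu) (nu1 : nu < 1) (HS : stable_subordinator P nu H).
Local Notation L := (inverse_subordinator nu H).
Implicit Types (t tau q s : R) (w : Omega).

Let LE t w : L t w = inf [set tau | 0 < tau /\ t < H tau w].
Proof. by rewrite /inverse_subordinator lt_eqF. Qed.

Let lbS t w : has_lbound [set tau | 0 < tau /\ t < H tau w].
Proof. by exists 0 => tau [/ltW]. Qed.

Lemma inverse_subordinator_ge0 t w : 0 <= L t w.
Proof.
rewrite LE; have [S0|/set0P/negP/negPn/eqP ->] := pselect ([set tau | 0 < tau /\ t < H tau w] !=set0).
  by apply: lb_le_inf => // tau [/ltW].
by rewrite inf0.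
Qed.

(** One half of the duality between a subordinator and its inverse; the other
    half is [le_inverse_of_subordinator_le]. The strict inequality matters: [H]
    may jump over the level [t] at the time [L t]. *)
Lemma subordinator_le_of_lt_inverse t q w : 0 < q -> q < L t w -> H q w <= t.
Proof.
move=> q0; rewrite LE => qL; rewrite leNgt; apply/negP => Hq.
by have := lt_le_trans qL (ge_inf (lbS t w) (conj q0 Hq)); rewrite ltxx.
Qed.

(** On such paths the infimum that defines the inverse is taken over a nonempty
    set. *)
Definition unbounded_path w := forall t, exists2 tau, 0 < tau & t < H tau w.

Lemma le_inverse_of_subordinator_le t tau w : unbounded_path w -> 0 <= tau ->
  H tau w <= t -> tau <= L t w.
Proof.
move=> uw tau0 Ht; rewrite LE; apply: lb_le_inf.
  by have [u u0 tu] := uw t; exists u.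
move=> u [u0 tu]; rewrite leNgt; apply/negP => utau.
by have := lt_le_trans tu (le_trans (sub_nondecreasing HS w (ltW u0) (ltW utau)) Ht); rewrite ltxx.
Qed.

Lemma inverse_subordinator_le s t w : unbounded_path w -> s <= t -> L s w <= L t w.
Proof.
move=> uw st; rewrite (LE t); apply: lb_le_inf.
  by have [u u0 tu] := uw t; exists u.
by move=> u [u0 tu]; rewrite LE; apply: ge_inf => //; split => //; exact: le_lt_trans tu.
Qed.

Let mH t : 0 <= t -> measurable_fun setT (H t).
Proof. by move=> t0; exact: (sub_measurable HS t0). Qed.

Lemma subordinator_laplace s t : 0 <= s -> 0 <= t ->
  (\int[P]_w (expR (- s * H t w))%:E = (expR (- t * s `^ nu))%:E)%E.
Proof.
by move=> s0 t0; have := sub_laplace HS s0 t0; rewrite unlock.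
Qed.

Lemma measurable_exp_subordinator s t : 0 <= t -> measurable_fun setT (fun w => expR (- s * H t w)).
Proof. by move=> t0; apply: measurableT_comp => //; apply: measurable_funM => //; exact: mH. Qed.

(** Markov's inequality for [exp (- H n)], whose mean is [exp (- n)]. *)
Lemma subordinator_le_small t n : 0 <= t -> (P [set w | (H n%:R w <= t)%R] <= (expR (t - n%:R))%:E)%E.
Proof.
move=> t0; have mA : measurable [set w | H n%:R w <= t].
  rewrite -[X in measurable X]setTI.
  by apply: (measurable_fun_ler (mH _) (measurable_cst t)) => //.
have -> : P [set w | H n%:R w <= t] = (\int[P]_(w in [set w | (H n%:R w <= t)%R]) 1%:E)%E.
  by rewrite integral_cst// mul1e.
have h := subordinator_laplace ler01 (ler0n R n).
rewrite expRD EFinM [X in (_ * X)%E](_ : _ = (expR (- n%:R * 1 `^ nu))%:E); last first.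
  by rewrite powR1 mulr1.
rewrite -h -ge0_integralZl//; last by apply/measurable_EFinP; exact: measurable_exp_subordinator.
apply: (@le_trans _ _ (\int[P]_(w in [set w | (H n%:R w <= t)%R]) ((expR t)%:E * (expR (-1 * H n%:R w))%:E))%E).
  apply: ge0_le_integral => //.
  - by apply: measurable_funeM; apply/measurable_EFinP; apply: measurable_funTS; exact: measurable_exp_subordinator.
  - by move=> w /= Hw; rewrite -EFinM -expRD lee_fin -[leLHS]expR0 ler_expR; lra.
apply: ge0_subset_integral => //.
- by apply: measurable_funeM; apply/measurable_EFinP; exact: measurable_exp_subordinator.
Qed.

Lemma ae_unbounded_path : {ae P, forall w, unbounded_path w}.
Proof.
have mA (k n : nat) : measurable [set w | H n%:R w <= k%:R].
  rewrite -[X in measurable X]setTI.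
  by apply: (measurable_fun_ler (mH _) (measurable_cst _)) => //.
have mI k : measurable (\bigcap_n [set w | H n%:R w <= k%:R]) by exact: bigcapT_measurable.
apply: (@negligibleS _ _ _ _ (\bigcup_k \bigcap_n [set w | H n%:R w <= k%:R])).
  move=> w /= /existsNP[t]/forall2NP Ht; exists (Num.truncn `|t|).+1 => // n _ /=.
  have tk : t <= (Num.truncn `|t|).+1%:R.
    by rewrite (le_trans (ler_norm _))// ltW// truncnS_gt.
  apply: le_trans tk; rewrite leNgt; apply/negP => tn.
  have [//|] := Ht n.+1%:R; rewrite ?ltr0n//.
  apply; apply: (lt_le_trans tn); apply: (sub_nondecreasing HS) => //.
  by rewrite ler_nat.
apply: negligible_bigcup => k; apply/negligibleP => //; apply/eqP.
rewrite eq_le measure_ge0 andbT; apply/lee_addgt0Pr => e e0; rewrite add0e.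
have : expR (- n%:R) @[n --> \oo] --> (0 : R) by exact: cvgn_expR.
have e1 : 0 < e / expR k%:R by rewrite divr_gt0 ?expR_gt0.
move=> /cvgrPdist_lt/(_ _ e1)[n _ /(_ n (leqnn n))] /=.
rewrite sub0r normrN gtr0_norm ?expR_gt0// ltr_pdivlMr ?expR_gt0// => en.
apply: (@le_trans _ _ (P [set w | (H n%:R w <= k%:R)%R])).
  by apply: le_measure; rewrite ?inE//; apply: bigcap_inf.
apply: le_trans (subordinator_le_small _ (ler0n _ _)) _.
by rewrite lee_fin addrC expRD ltW.
Qed.

(** For [x > 0], the set [L < x] is the union of the sets [t < H r] over the
    rational [r] in []0, x[], together with the paths bounded by [t], on which
    the infimum of the empty set is [0]. *)
Lemma jointly_measurable_inverse_subordinator :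
  measurable_fun setT (fun p : R * Omega => L p.1 p.2).
Proof.
apply: (measurability _ (RGenInftyO.measurableE R)) => //.
move=> _ [_ [x ->] <-]; rewrite setTI.
have mHp u : 0 <= u -> measurable_fun setT (fun p : R * Omega => H u p.2).
  by move=> u0; apply: (measurableT_comp (mH u0)); exact: measurable_snd.
have [x0|x0] := leP x 0.
  rewrite (_ : _ @^-1` _ = set0) ?measurable0//; apply/seteqP; split => // p /=.
  by rewrite in_itv/= => /(le_lt_trans (inverse_subordinator_ge0 _ _)); rewrite ltNge x0.
rewrite (_ : _ @^-1` _ = (\bigcap_n [set p : R * Omega | H n.+1%:R p.2 <= p.1]) `|`
   \bigcup_(r : rat) [set p | 0 < ratr r :> R /\ ratr r < x :> R /\ p.1 < H (ratr r) p.2]).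
  apply: measurableU.
    apply: bigcapT_measurable => n; rewrite -[X in measurable X]setTI.
    by apply: (measurable_fun_ler (mHp _ _) measurable_fst).
  apply: bigcupT_measurable_rat => r.
  have [r0|r0] := ltP 0 (ratr r : R); last first.
    by rewrite (_ : mkset _ = set0) ?measurable0//; apply/seteqP; split => // p /= [].
  have [rx|rx] := ltP (ratr r : R) x; last first.
    by rewrite (_ : mkset _ = set0) ?measurable0//; apply/seteqP; split => // p /= [_ []].
  rewrite (_ : mkset _ = setT `&` [set p | p.1 < H (ratr r) p.2]).
    by apply: (measurable_fun_ltr measurable_fst (mHp _ (ltW r0))).
  by rewrite setTI; apply/seteqP; split => p /=; [case=> _ []|].
apply/seteqP; split => -[t w] /=; rewrite in_itv/= LE.
  have [S0|/set0P/negP/negPn/eqP S0] := pselect ([set tau | 0 < tau /\ t < H tau w] !=set0); last first.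
    move=> _; left => n _ /=; rewrite leNgt; apply/negP => tn.
    by have : [set tau | 0 < tau /\ t < H tau w] n.+1%:R by []; rewrite S0.
  move=> /(inf_lt S0)[u [u0 tu] ux]; right.
  have [r] := rat_in_itvoo ux; rewrite in_itv/= => /andP[ur rx].
  exists r => //=; split; [exact: lt_trans ur|split => //].
  exact: lt_le_trans (sub_nondecreasing HS w (ltW u0) (ltW ur)).
case=> [h|[r _ [r0 [rx tr]]]]; last first.
  by apply: le_lt_trans rx; apply: ge_inf.
rewrite (_ : mkset _ = set0) ?inf0//; apply/seteqP; split => // u /= [u0 tu].
have := h (Num.truncn u) Logic.I => /=; rewrite leNgt => /negP; apply.
apply: (lt_le_trans tu); apply: (sub_nondecreasing HS); rewrite ?ltW//.
exact: truncnS_gt.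
Qed.

Lemma measurable_inverse_subordinator t : measurable_fun setT (L t).
Proof.
by apply: (@measurableT_comp _ _ _ _ _ _ (fun p : R * Omega => L p.1 p.2) _ (fun w => (t, w)));
  [exact: jointly_measurable_inverse_subordinator|exact: measurable_pair1].
Qed.

(** Almost surely [H] is positive at the times [1/n], by Markov's inequality for
    [exp (- s (H (1/n)))] as [s] tends to infinity. *)
Lemma ae_inverse_subordinator0 : {ae P, forall w, L 0 w = 0}.
Proof.
have hn (n : nat) : P.-negligible [set w | (H n.+1%:R^-1 w <= 0)%R].
  have i0 : 0 <= (n.+1%:R)^-1 :> R by rewrite invr_ge0.
  have mA : measurable [set w | (H n.+1%:R^-1 w <= 0)%R].
    rewrite -[X in measurable X]setTI.
    by apply: (measurable_fun_ler (mH i0) (measurable_cst (0 : R))).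
  apply/negligibleP => //; apply/eqP; rewrite eq_le measure_ge0 andbT.
  apply/lee_addgt0Pr => e e0; rewrite add0e.
  have [s s0 hs] : exists2 s, 0 <= s & expR (- (n.+1%:R)^-1 * s `^ nu) <= e.
    pose k := Num.max 0 (- (n.+1%:R * ln e)); have k0 : 0 <= k by rewrite le_max lexx.
    exists (k `^ nu^-1); first exact: powR_ge0.
    rewrite -powRrM mulVf ?gt_eqF// powRr1// -[leRHS]lnK ?posrE// ler_expR.
    rewrite mulNr lerNl mulrC ler_pdivlMr ?ltr0n//.
    by rewrite mulNr mulrC le_max lexx orbT.
  apply: (@le_trans _ _ (expR (- (n.+1%:R)^-1 * s `^ nu))%:E); last by rewrite lee_fin.
  rewrite -subordinator_laplace//.
  rewrite [leLHS](_ : _ = (\int[P]_(w in [set w | (H n.+1%:R^-1 w <= 0)%R]) 1%:E)%E); last first.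
    by rewrite integral_cst// mul1e.
  apply: (@le_trans _ _ (\int[P]_(w in [set w | (H n.+1%:R^-1 w <= 0)%R]) (expR (- s * H n.+1%:R^-1 w))%:E)%E).
    apply: ge0_le_integral => //.
    - by apply/measurable_EFinP; apply: measurable_funTS; exact: measurable_exp_subordinator.
    - move=> w /= Hw; rewrite lee_fin -[leLHS]expR0 ler_expR mulNr oppr_ge0.
      exact: mulr_ge0_le0.
  apply: ge0_subset_integral => //.
  by apply/measurable_EFinP; exact: measurable_exp_subordinator.
apply: (negligibleS _ (negligible_bigcup hn)) => w /= L0.
apply: contrapT => h; apply: L0; apply/eqP; rewrite eq_le inverse_subordinator_ge0 andbT.
apply/ler_addgt0Pr => e e0; rewrite add0r.
have [n ne] : exists n, (n.+1%:R)^-1 <= e.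
  exists (Num.truncn e^-1); rewrite invf_ple ?posrE ?ltr0n//; apply: ltW; exact: truncnS_gt.
apply: le_trans ne; rewrite LE; apply: ge_inf => //; split; first by rewrite invr_gt0.
by rewrite ltNge; apply/negP => hh; apply: h; exists n.
Qed.

End InverseSubordinator.

(** * The Laplace transform of the inverse subordinator *)

Section ExponentialKernel.
Variable R : realType.
Local Notation mu := (@lebesgue_measure R).
Implicit Types (s t h l : R).

(** The density of the exponential law of parameter [s]. Expectations against it
    are Laplace transforms, and it is defined on the whole line in order that
    Tonelli's theorem apply to it. *)
Definition exp_kernel s t : R := if 0 < t then s * expR (- s * t) else 0.

Lemma exp_kernel_ge0 s t : 0 <= s -> 0 <= exp_kernel s t.
Proof. by move=> s0; rewrite /exp_kernel; case: ifPn => // _; rewrite mulr_ge0 ?expR_ge0. Qed.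

Lemma measurable_exp_kernel s : measurable_fun setT (exp_kernel s).
Proof.
apply: measurable_fun_ifT => //.
- exact: measurable_fun_ltr.
- by apply: measurable_funM => //; exact: measurable_expRM.
Qed.

Lemma integral_exp_kernel s (f : R -> \bar R) :
  (\int[mu]_t ((exp_kernel s t)%:E * f t) =
   \int[mu]_(t in `]0%R, +oo[) ((s * expR (- s * t))%:E * f t))%E.
Proof.
rewrite [RHS]integral_mkcond; apply: eq_integral => t _.
rewrite patchE /exp_kernel; case: ifPn => t0; case: ifPn => //.
- by rewrite notin_setE/= in_itv/= t0.
- by rewrite inE/= in_itv/= (negbTE t0).
- by rewrite mul0e.
Qed.

Lemma measurable_boolr (d : measure_display) (T : measurableType d) (b : T -> bool) :
  measurable_fun setT b -> measurable_fun setT (fun x => (b x)%:R : R).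
Proof.
move=> mb; rewrite (_ : (fun x => _) = fun x => if b x then 1 else 0 : R).
  exact: measurable_fun_ifT.
by apply/funext => x; case: (b x).
Qed.

Let mE s (D : set R) : measurable_fun D (fun u => (s * expR (- s * u))%:E).
Proof. by apply/measurable_EFinP; apply: measurable_funM => //; exact: measurable_expRM. Qed.

Lemma integral_exp_kernel_ge s h : 0 < s -> 0 <= h ->
  (\int[mu]_t (exp_kernel s t * (h <= t)%R%:R)%:E = (expR (- s * h))%:E)%E.
Proof.
move=> s0 h0; under eq_integral do rewrite EFinM.
rewrite integral_exp_kernel integral_itv_obnd_cbnd; last first.
  apply: emeasurable_funM; first exact: mE.
  by apply/measurable_EFinP; apply: measurable_funTS; apply: measurable_boolr; exact: measurable_fun_ler.
rewrite -integral_expR// (_ : `[h, +oo[%classic = `[0, +oo[ `&` `[h, +oo[); last first.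
  apply/seteqP; split => t /=; rewrite !in_itv/= !andbT; last by case.
  by move=> ht; split=> //; exact: le_trans ht.
rewrite integral_mkcondr; apply: eq_integral => t _; rewrite patchE.
case: ifPn; first by rewrite inE/= in_itv/= andbT => ->; rewrite mule1.
by rewrite notin_setE/= in_itv/= andbT => /negP/negbTE ->; rewrite mule0.
Qed.

Lemma integral_exp_kernel_gt s h : 0 < s -> 0 <= h ->
  (\int[mu]_t (exp_kernel s t * (h < t)%R%:R)%:E = (expR (- s * h))%:E)%E.
Proof.
move=> s0 h0; under eq_integral do rewrite EFinM.
rewrite integral_exp_kernel -integral_expR// -integral_itv_obnd_cbnd; last exact: mE.
rewrite (_ : `]h, +oo[%classic = `]0, +oo[ `&` `]h, +oo[); last first.
  apply/seteqP; split => t /=; rewrite !in_itv/= !andbT; last by case.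
  by move=> ht; split=> //; exact: le_lt_trans ht.
rewrite integral_mkcondr; apply: eq_integral => t _; rewrite patchE.
case: ifPn; first by rewrite inE/= in_itv/= andbT => ->; rewrite mule1.
by rewrite notin_setE/= in_itv/= andbT => /negP/negbTE ->; rewrite mule0.
Qed.

Lemma integral_exp_kernel_le s l : 0 <= s -> 0 <= l ->
  (\int[mu]_t (exp_kernel s t * (t <= l)%R%:R)%:E = (1 - expR (- s * l))%:E)%E.
Proof.
rewrite le_eqVlt => /predU1P[<- l0|s0 l0].
  rewrite oppr0 mul0r expR0 subrr; apply: integral0_eq => t _.
  by rewrite /exp_kernel mul0r if_same mul0r.
have k0 t : 0 <= exp_kernel s t by rewrite exp_kernel_ge0// ltW.
have := integral_exp_kernel_gt s0 (lexx 0); rewrite mulr0 expR0 => h1.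
have : (1%:E = \int[mu]_t (exp_kernel s t * (t <= l)%R%:R)%:E +
             \int[mu]_t (exp_kernel s t * (l < t)%R%:R)%:E)%E.
  rewrite -h1 -ge0_integralD//=.
  - apply: eq_integral => t _; rewrite -EFinD; congr EFin.
    rewrite -mulrDr; case: (leP t l) => tl /=; last first.
      by rewrite add0r (le_lt_trans l0 tl).
    rewrite addr0 mulr1 /exp_kernel; case: ifPn; last by rewrite mul0r.
    by rewrite mulr1.
  - by move=> t _; rewrite lee_fin mulr_ge0.
  - apply/measurable_EFinP; apply: measurable_funM; first exact: measurable_exp_kernel.
    by apply: measurable_boolr; exact: measurable_fun_ler.
  - by move=> t _; rewrite lee_fin mulr_ge0.
  - apply/measurable_EFinP; apply: measurable_funM; first exact: measurable_exp_kernel.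
    by apply: measurable_boolr; exact: measurable_fun_ltr.
rewrite integral_exp_kernel_gt//.
case: (integral _ _ _) => [r| |] //; rewrite -EFinD => -[->].
by rewrite addrK.
Qed.

Lemma integral_exp_kernel_expR s l : 0 <= s -> 0 < l ->
  (\int[mu]_t (exp_kernel s t * expR (- t * l))%:E = (s / (s + l))%:E)%E.
Proof.
move=> s0 l0; have sl : 0 < s + l by rewrite ltr_wpDl.
under eq_integral do rewrite EFinM.
rewrite integral_exp_kernel.
transitivity (\int[mu]_(t in `]0%R, +oo[) ((s / (s + l))%:E * ((s + l) * expR (- (s + l) * t))%:E))%E.
  apply: eq_integral => t _; rewrite -!EFinM; congr EFin.
  rewrite [RHS]mulrA mulfVK ?gt_eqF// -mulrA -expRD; congr (_ * expR _); ring.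
rewrite ge0_integralZl//=.
- by rewrite integral_itv_obnd_cbnd ?integral_expR// mulr0 expR0 mule1.
- exact: mE.
- by move=> t _; rewrite lee_fin mulr_ge0 ?expR_ge0// ltW.
- by rewrite lee_fin divr_ge0// ltW.
Qed.

End ExponentialKernel.

Lemma measurable_fun_fixl (d1 d2 d3 : measure_display) (T1 : measurableType d1)
    (T2 : measurableType d2) (T3 : measurableType d3) (h : T1 * T2 -> T3) (x : T1) :
  measurable_fun setT h -> measurable_fun setT (fun y => h (x, y)).
Proof. by move=> mh; apply: (measurableT_comp mh); exact: measurable_pair1. Qed.

Section InverseSubordinatorLaplace.
Variables (R : realType) (d : measure_display) (Omega : measurableType d).
Variables (P : probability Omega R) (nu m : R) (H : R -> Omega -> R).
Hypotheses (nu0 : 0 < nu) (nu1 : nu < 1) (HS : stable_subordinator P nu H) (m0 : 0 <= m).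
Local Notation L := (inverse_subordinator nu H).
Local Notation mu := (@lebesgue_measure R).
Implicit Types (t tau q s : R) (w : Omega).
Local Open Scope ereal_scope.

Let mL2 := jointly_measurable_inverse_subordinator nu1 HS.

(** For an exponential time [t] of parameter [s], the probability of [H q <= t]
    is the Laplace transform of [H q] at [s]. *)
Let inner_hitting s q : (0 < s)%R -> (0 <= q)%R ->
  \int[mu]_t \int[P]_w (exp_kernel s t * (H q w <= t)%R%:R)%:E = (expR (- q * s `^ nu))%:E.
Proof.
move=> s0 q0; apply: (etrans (@fubini_tonelli _ _ _ _ _ mu P
  (fun p : R * Omega => (exp_kernel s p.1 * (H q p.2 <= p.1)%R%:R)%:E) _ _)).
- apply/measurable_EFinP; apply: measurable_funM.
    by apply: (measurableT_comp (measurable_exp_kernel s)); exact: measurable_fst.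
  apply: measurable_boolr; apply: measurable_fun_ler; last exact: measurable_fst.
  by apply: (measurableT_comp (sub_measurable HS q0)); exact: measurable_snd.
- by move=> p; rewrite lee_fin mulr_ge0// exp_kernel_ge0// ltW.
- rewrite -(subordinator_laplace HS (ltW s0) q0); apply: eq_integral => w _ /=.
  apply: integral_exp_kernel_ge => //.
  by rewrite -(sub_start HS w); exact: (sub_nondecreasing HS).
Qed.

Let mkL s : measurable_fun setT (fun p : R * R * Omega =>
  (exp_kernel s p.1.1 * (p.1.2 <= L p.1.1 p.2)%R%:R)%R).
Proof.
have m1 : measurable_fun setT (fun p : R * R * Omega => p.1.1).
  by apply: measurableT_comp; [exact: measurable_fst|exact: measurable_fst].
have m2 : measurable_fun setT (fun p : R * R * Omega => p.1.2).
  by apply: measurableT_comp; [exact: measurable_snd|exact: measurable_fst].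
apply: measurable_funM; first exact: (measurableT_comp (measurable_exp_kernel s)).
apply: measurable_boolr; apply: measurable_fun_ler => //.
apply: (@measurableT_comp _ _ _ _ _ _ (fun p : R * Omega => L p.1 p.2) _ (fun p : R * R * Omega => (p.1.1, p.2))) => //.
by apply/measurable_fun_pair => //; exact: measurable_snd.
Qed.

(** The events [tau <= L t] and [H tau <= t] have the same probability after
    averaging over [t]: by duality the former contains the latter almost surely,
    and it is contained in [H q <= t] for every [q < tau]; let [q] tend to
    [tau]. *)
Let inner_passage s tau : (0 < s)%R -> (0 < tau)%R ->
  \int[mu]_t \int[P]_w (exp_kernel s t * (tau <= L t w)%R%:R)%:E = (expR (- tau * s `^ nu))%:E.
Proof.
move=> s0 tau0.
have k0 t : (0 <= exp_kernel s t)%R by rewrite exp_kernel_ge0// ltW.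
have mh q : (0 <= q)%R -> measurable_fun setT (fun p : R * Omega => (exp_kernel s p.1 * (H q p.2 <= p.1)%R%:R)%:E).
  move=> q0; apply/measurable_EFinP; apply: measurable_funM.
    by apply: (measurableT_comp (measurable_exp_kernel s)); exact: measurable_fst.
  apply: measurable_boolr; apply: measurable_fun_ler; last exact: measurable_fst.
  by apply: (measurableT_comp (sub_measurable HS q0)); exact: measurable_snd.
have ml : measurable_fun setT (fun p : R * Omega => (exp_kernel s p.1 * (tau <= L p.1 p.2)%R%:R)%:E).
  apply/measurable_EFinP; apply: measurable_funM.
    by apply: (measurableT_comp (measurable_exp_kernel s)); exact: measurable_fst.
  by apply: measurable_boolr; apply: measurable_fun_ler.
have nn (b : bool) t : 0 <= (exp_kernel s t * b%:R)%:E by rewrite lee_fin mulr_ge0.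
apply/eqP; rewrite eq_le; apply/andP; split; last first.
  rewrite -(inner_hitting s0 (ltW tau0)); apply: ge0_le_integral => //.
  - by move=> t _; exact: integral_ge0.
  - exact: (measurable_fun_fubini_tonelli_F _ (mh _ (ltW tau0))).
  - exact: (measurable_fun_fubini_tonelli_F _ ml).
  - move=> t _; apply: ae_ge0_le_integral => //.
    + exact: (measurable_fun_fixl t (mh _ (ltW tau0))).
    + exact: (measurable_fun_fixl t ml).
    + apply: filterS (ae_unbounded_path HS) => w uw _.
      rewrite lee_fin ler_wpM2l// ler_nat; case: (leP (H tau w) t) => // Ht.
      by rewrite (le_inverse_of_subordinator_le nu1 HS uw (ltW tau0) Ht).
apply/lee_addgt0Pr => e e0.
have [q /andP[q0 qt] hq] : exists2 q : R, (0 < q < tau)%R & (expR (- q * s `^ nu) <= expR (- tau * s `^ nu) + e)%R.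
  have : {for tau, continuous (fun q : R => expR (- s `^ nu * q))} by exact: continuous_expRM.
  move=> /cvgrPdist_lt/(_ _ e0)[r /= r0 hr].
  exists (tau - Num.min tau r / 2)%R.
    by rewrite subr_gt0 ltr_pdivrMr// gtrBl divr_gt0 ?lt_min ?tau0//= gt_min ltr_pMr ?ltr1n.
  have /= := hr (tau - Num.min tau r / 2)%R.
  have mr : (0 < Num.min tau r)%R by rewrite lt_min tau0.
  rewrite subKr gtr0_norm ?divr_gt0// ltr_pdivrMr// gt_min [(r < _)%R]ltr_pMr// ltr1n orbT => /(_ isT).
  by rewrite !mulNr ![(_ * s `^ nu)%R]mulrC ltr_norml => /andP[]; lra.
rewrite -EFinD; apply: (@le_trans _ _ (expR (- q * s `^ nu))%:E); last by rewrite lee_fin.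
rewrite -(inner_hitting s0 (ltW q0)); apply: ge0_le_integral => //.
- by move=> t _; exact: integral_ge0.
- exact: (measurable_fun_fubini_tonelli_F _ ml).
- exact: (measurable_fun_fubini_tonelli_F _ (mh _ (ltW q0))).
- move=> t _; apply: ge0_le_integral => //.
  + exact: (measurable_fun_fixl t ml).
  + exact: (measurable_fun_fixl t (mh _ (ltW q0))).
  + move=> w _; rewrite lee_fin ler_wpM2l// ler_nat; case: (leP tau (L t w)) => // tL.
    by rewrite (subordinator_le_of_lt_inverse nu1 q0 (lt_le_trans qt tL)).
Qed.

Let mexpL (c : R) : measurable_fun setT (fun p : R * Omega => (expR (- c * L p.1 p.2))%:E).
Proof.
by apply/measurable_EFinP; apply: measurableT_comp => //; exact: measurable_funM.
Qed.

Let F t := fine (\int[P]_w (expR (- m * L t w))%:E).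

Let F01 t : (0 <= F t <= 1)%R /\ \int[P]_w (expR (- m * L t w))%:E = (F t)%:E.
Proof.
have mw : measurable_fun setT (fun w => (expR (- m * L t w))%:E).
  exact: (measurable_fun_fixl t (mexpL m)).
have h0 : 0 <= \int[P]_w (expR (- m * L t w))%:E.
  by apply: integral_ge0 => w _; rewrite lee_fin expR_ge0.
have h1 : \int[P]_w (expR (- m * L t w))%:E <= 1.
  rewrite -(@probability_setT _ _ _ P) -[leRHS]mul1e -integral_cst//.
  apply: ge0_le_integral => //.
  move=> w _; rewrite lee_fin -[leRHS]expR0 ler_expR mulNr oppr_le0 mulr_ge0//.
  exact: (inverse_subordinator_ge0 H nu1).
have E : \int[P]_w (expR (- m * L t w))%:E = (F t)%:E.
  by rewrite /F fineK// ge0_fin_numE// (le_lt_trans h1)// ltry.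
by split => //; rewrite -!lee_fin -E h0 h1.
Qed.

Let mF : measurable_fun setT F.
Proof.
apply: measurableT_comp => //.
apply: (@measurable_fun_fubini_tonelli_F _ _ _ _ _ P (fun p : R * Omega => (expR (- m * L p.1 p.2))%:E)) => //.
Qed.

Let Fle s t : (s <= t)%R -> (F t <= F s)%R.
Proof.
move=> st; have [_ es] := F01 s; have [_ et] := F01 t.
suff : \int[P]_w (expR (- m * L t w))%:E <= \int[P]_w (expR (- m * L s w))%:E by rewrite es et lee_fin.
apply: ae_ge0_le_integral.
- exact: measurableT.
- by move=> w _; rewrite lee_fin expR_ge0.
- exact: (measurable_fun_fixl t (mexpL m)).
- by move=> w _; rewrite lee_fin expR_ge0.
- exact: (measurable_fun_fixl s (mexpL m)).
- apply: filterS (ae_unbounded_path HS) => w uw _.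
  by rewrite lee_fin ler_expR !mulNr lerN2 ler_wpM2l// (inverse_subordinator_le nu1).
Qed.

(** Writing [1 - exp (- m L)] as the integral of the density [exp_kernel m] over
    [[0, L]] and exchanging the integrals reduces this to [inner_passage], that
    is, to the integral of [m e^(- m tau) e^(- tau s^nu)]. *)
Let laplace_1F s : (0 < s)%R ->
  \int[mu]_t (exp_kernel s t * (1 - F t))%:E = (m / (m + s `^ nu))%:E.
Proof.
move=> s0; have sn : (0 < s `^ nu)%R by exact: powR_gt0.
have ks t : (0 <= exp_kernel s t)%R by rewrite exp_kernel_ge0// ltW.
have km t : (0 <= exp_kernel m t)%R by rewrite exp_kernel_ge0.
have mk : measurable_fun setT (fun p : R * R * Omega =>
    (exp_kernel s p.1.1 * (p.1.2 <= L p.1.1 p.2)%R%:R * exp_kernel m p.1.2)%:E).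
  apply/measurable_EFinP; apply: measurable_funM; first exact: mkL.
  apply: (measurableT_comp (measurable_exp_kernel m)).
  by apply: measurableT_comp; [exact: measurable_snd|exact: measurable_fst].
have k0 (p : R * R * Omega) : 0 <= (exp_kernel s p.1.1 * (p.1.2 <= L p.1.1 p.2)%R%:R * exp_kernel m p.1.2)%:E.
  by rewrite lee_fin !mulr_ge0.
rewrite -(integral_exp_kernel_expR m0 sn).
transitivity (\int[mu]_t \int[mu]_tau \int[P]_w
    (exp_kernel s t * (tau <= L t w)%R%:R * exp_kernel m tau)%:E).
  apply: eq_integral => t _.
  apply: esym; apply: (etrans (@fubini_tonelli _ _ _ _ _ mu P
    (fun p : R * Omega => (exp_kernel s t * (p.1 <= L t p.2)%R%:R * exp_kernel m p.1)%:E) _ _)).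
  - apply: (measurableT_comp mk (g := fun p : R * Omega => ((t, p.1), p.2))).
    apply/measurable_fun_pair; last exact: measurable_snd.
    by apply/measurable_fun_pair; [exact: measurable_cst|exact: measurable_fst].
  - by move=> p; rewrite lee_fin !mulr_ge0.
  transitivity (\int[P]_w ((exp_kernel s t)%:E * (1 - expR (- m * L t w))%:E)).
    apply: eq_integral => w _; rewrite -integral_exp_kernel_le//; last first.
      exact: (inverse_subordinator_ge0 H nu1).
    rewrite -ge0_integralZl//=; last 3 first.
    - apply/measurable_EFinP; apply: measurable_funM; first exact: measurable_exp_kernel.
      by apply: measurable_boolr; exact: measurable_fun_ler.
    - by move=> u _; rewrite lee_fin mulr_ge0.
    - by rewrite lee_fin.
    by apply: eq_integral => u _; rewrite -EFinM mulrAC mulrA.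
  have [_ et] := F01 t.
  have mw : measurable_fun setT (fun w => (expR (- m * L t w))%:E) by exact: (measurable_fun_fixl t (mexpL m)).
  have e1 w : (expR (- m * L t w) <= 1)%R.
    by rewrite -[leRHS]expR0 ler_expR mulNr oppr_le0 mulr_ge0// (inverse_subordinator_ge0 H nu1).
  rewrite ge0_integralZl//; last 3 first.
  - apply/measurable_EFinP; apply: measurable_funB => //; exact/measurable_EFinP.
  - by move=> w _; rewrite lee_fin subr_ge0.
  - by rewrite lee_fin.
  rewrite EFinM; congr (_ * _).
  under eq_integral do rewrite EFinB.
  rewrite integralB//=; last 2 first.
  - exact: finite_measure_integrable_cst.
  - apply/integrableP; split => //.
    under eq_integral do rewrite gee0_abs ?lee_fin ?expR_ge0//.
    by rewrite et ltry.
  rewrite et [X in X - _](_ : _ = 1) ?EFinB//.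
  by rewrite integral_cst// mul1e; exact: probability_setT.
have mphi : measurable_fun setT (fun p : R * R => \int[P]_w
    (exp_kernel s p.1 * (p.2 <= L p.1 w)%R%:R * exp_kernel m p.2)%:E).
  exact: (@measurable_fun_fubini_tonelli_F _ _ _ _ _ P _ mk k0).
apply: (etrans (@fubini_tonelli _ _ _ _ _ mu mu (fun p : R * R => \int[P]_w
    (exp_kernel s p.1 * (p.2 <= L p.1 w)%R%:R * exp_kernel m p.2)%:E) mphi _)).
  by move=> p; apply: integral_ge0 => w _; exact: (k0 (p, w)).
apply: eq_integral => tau _.
have [tau0|tau0] := ltP 0%R tau; last first.
  have -> : exp_kernel m tau = 0%R by rewrite /exp_kernel ltNge tau0.
  rewrite mul0r; apply: integral0_eq => t _; apply: integral0_eq => w _.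
  by rewrite mulr0.
rewrite EFinM -inner_passage// -ge0_integralZl//=; last 3 first.
- have := @measurable_fun_fubini_tonelli_F _ _ _ _ _ P (fun p : R * Omega => (exp_kernel s p.1 * (tau <= L p.1 p.2)%R%:R)%:E).
  apply => [|p]; last by rewrite lee_fin mulr_ge0.
  apply/measurable_EFinP; apply: measurable_funM.
    by apply: (measurableT_comp (measurable_exp_kernel s)); exact: measurable_fst.
  by apply: measurable_boolr; apply: measurable_fun_ler.
- by move=> t _; apply: integral_ge0 => w _; rewrite lee_fin mulr_ge0.
- by rewrite lee_fin.
apply: eq_integral => t _; rewrite -ge0_integralZl//=; last 3 first.
- apply/measurable_EFinP; apply: measurable_funM => //.
  apply: measurable_boolr; apply: measurable_fun_ler => //.
  exact: (measurable_inverse_subordinator nu1 HS).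
- by move=> w _; rewrite lee_fin mulr_ge0.
- by rewrite lee_fin.
by apply: eq_integral => w _; rewrite -EFinM mulrC.
Qed.

(** From [laplace_1F], the Laplace transform of the left-hand side is [s^(nu-1)
    / (m + s^nu)], which determines it by [mittag_leffler_of_laplace]. *)
Lemma inverse_subordinator_laplace t : (0 < t)%R ->
  \int[P]_w (expR (- m * L t w))%:E = (mittag_leffler nu (- m * t `^ nu))%:E.
Proof.
move=> t0; have [_ ->] := F01 t; congr EFin.
apply: (mittag_leffler_of_laplace nu0 m0 _ _ _ _ t0).
- exact: measurable_funTS.
- by move=> s u _; exact: Fle.
- by move=> u _; have [] := F01 u.
move=> s s0 q1; have sn : (0 < s `^ nu)%R by exact: powR_gt0.
have F0 u : (0 <= F u)%R by have [/andP[]] := F01 u.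
have F1 u : (0 <= 1 - F u)%R by rewrite subr_ge0; have [/andP[]] := F01 u.
have mE : measurable_fun (`]0%R, +oo[%classic : set R) (fun u => (s * expR (- s * u))%R).
  by apply: measurable_funM => //; exact: measurable_expRM.
have h1 := laplace_1F s0.
have {}h1 : \int[mu]_(u in `]0%R, +oo[) (s * expR (- s * u) * (1 - F u))%:E = (m / (m + s `^ nu))%:E.
  rewrite -h1; under [RHS]eq_integral do rewrite EFinM.
  by rewrite integral_exp_kernel; apply: eq_integral => u _; rewrite EFinM.
have : \int[mu]_(u in `]0%R, +oo[) (s * expR (- s * u) * F u)%:E +
    \int[mu]_(u in `]0%R, +oo[) (s * expR (- s * u) * (1 - F u))%:E = 1%:E.
  rewrite -ge0_integralD//=; last 4 first.
  - by move=> u _; rewrite lee_fin !mulr_ge0 ?expR_ge0// ltW.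
  - apply/measurable_EFinP; apply: measurable_funM => //; exact: measurable_funTS.
  - by move=> u _; rewrite lee_fin !mulr_ge0 ?expR_ge0// ltW.
  - apply/measurable_EFinP; apply: measurable_funM => //.
    by apply: measurable_funB => //; exact: measurable_funTS.
  rewrite [RHS](_ : _ = (expR (- s * 0))%:E); last by rewrite mulr0 expR0.
  rewrite -integral_expR//.
  rewrite -integral_itv_obnd_cbnd; last exact/measurable_EFinP.
  by apply: eq_integral => u _; rewrite -EFinD; congr EFin; ring.
rewrite h1.
have -> : \int[mu]_(u in `]0%R, +oo[) (s * expR (- s * u) * F u)%:E =
    s%:E * \int[mu]_(u in `]0%R, +oo[) (expR (- s * u) * F u)%:E.
  rewrite -ge0_integralZl//=; last 3 first.
  - apply/measurable_EFinP; apply: measurable_funM; last exact: measurable_funTS.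
    exact: measurable_expRM.
  - by move=> u _; rewrite lee_fin !mulr_ge0 ?expR_ge0.
  - by rewrite lee_fin ltW.
  by apply: eq_integral => u _; rewrite -EFinM mulrA.
have : 0 <= \int[mu]_(u in `]0%R, +oo[) (expR (- s * u) * F u)%:E.
  by apply: integral_ge0 => u _; rewrite lee_fin mulr_ge0 ?expR_ge0.
case: (integral _ _ _) => [X| |] // _; last by rewrite gt0_muley ?lte_fin.
rewrite -EFinM -EFinD => -[e]; congr EFin; rewrite /ml_ratio powRN.
have mn : (m + s `^ nu)%R != 0%R by rewrite gt_eqF// ltr_wpDl.
apply: (mulfI (lt0r_neq0 s0)); rewrite mulrA divff ?gt_eqF// mul1r.
rewrite (_ : s * X = 1 - m / (m + s `^ nu))%R; last by rewrite -e addrK.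
rewrite (_ : 1 + m / s `^ nu = (m + s `^ nu) / s `^ nu)%R; last by field; rewrite gt_eqF.
by rewrite invf_div; field.
Qed.

End InverseSubordinatorLaplace.

(** * Transition semigroups on the sphere *)

Section BoundedIntegral.
Context d (T : measurableType d) (R : realType) (m : {measure set T -> \bar R}).
Hypothesis m1 : m setT = 1%E.
Implicit Type f : T -> R.

Lemma integrable_bounded f c : measurable_fun setT f ->
  (forall y, `|f y| <= c) -> m.-integrable setT (EFin \o f).
Proof.
move=> mf fc; apply: (measurable_bounded_integrable (mu := m)) => //.
  by rewrite m1 ltry.
by exists c; split; rewrite ?num_real// => M cM y _; exact: le_trans (fc y) (ltW cM).
Qed.

Let integrable_constant c : m.-integrable setT (EFin \o cst c).
Proof. by apply: (@integrable_bounded _ `|c|). Qed.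

Lemma EFin_Rintegral f c : measurable_fun setT f -> (forall y, `|f y| <= c) ->
  (\int[m]_y (f y))%:E = (\int[m]_y (f y)%:E)%E.
Proof.
move=> mf fc; rewrite /Rintegral fineK//; apply: integrable_fin_num => //.
exact: integrable_bounded mf fc.
Qed.

Lemma Rintegral_probability_cst c : \int[m]_y c = c.
Proof. by rewrite /Rintegral integral_cst//= m1 mule1. Qed.

Lemma Rintegral_bounded f c : measurable_fun setT f -> (forall y, `|f y| <= c) ->
  `|\int[m]_y f y| <= c.
Proof.
move=> mf fc; have fi := integrable_bounded mf fc.
apply: (le_trans (le_normr_Rintegral _ fi)) => //.
rewrite -[leRHS]Rintegral_probability_cst; apply: le_Rintegral => //.
  exact: (integrable_norm fi).
exact: integrable_constant.
Qed.

Lemma Rintegral_shift f c : measurable_fun setT f -> (forall y, `|f y| <= c) ->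
  ((\int[m]_y f y) + c)%:E = (\int[m]_y (f y + c)%:E)%E.
Proof.
move=> mf fc; rewrite EFinD (EFin_Rintegral mf fc).
rewrite -[in LHS](Rintegral_probability_cst c).
rewrite (@EFin_Rintegral (cst c) `|c|)//.
rewrite -(@integralD _ _ _ m setT measurableT (EFin \o f) (EFin \o cst c))//.
exact: integrable_bounded mf fc.
Qed.

End BoundedIntegral.

Section Semigroup.
Variables (R : realType) (p : R -> R.-pker (sphere R) ~> (sphere R)).
Hypothesis tp : transition_function p.
Implicit Types (s t : R) (x : sphere R).

Let p1 t x : p t x setT = 1%E. Proof. exact: prob_kernel. Qed.

(** The Chapman-Kolmogorov equation, extended from sets to functions. *)
Lemma ge0_integral_transition s t x (f : sphere R -> \bar R) : 0 <= s -> 0 <= t ->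
  (forall z, 0 <= f z)%E -> measurable_fun setT f ->
  (\int[p (s + t) x]_z f z = \int[p s x]_y \int[p t y]_z f z)%E.
Proof.
move=> s0 t0 f0 mf.
rewrite -(@integral_kcomp _ _ _ _ _ _ _ (p s) (kernel.kernel_snd (p t)) x f f0 mf).
by apply: eq_measure_integral => A mA _; rewrite tp.2.
Qed.

Section bounded.
Variables (f : sphere R -> R) (c : R).
Hypotheses (mf : measurable_fun setT f) (fc : forall y, `|f y| <= c).

Let fc0 z : (0 <= (f z + c)%:E)%E.
Proof. by rewrite lee_fin -lerBlDr sub0r; have := fc z; rewrite ler_norml => /andP[]. Qed.

Lemma measurable_transition t : measurable_fun setT (fun x => \int[p t x]_z f z).
Proof.
have mfc : measurable_fun setT (fun z => (f z + c)%:E).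
  by apply/measurable_EFinP; exact: measurable_funD.
have := measurable_fun_integral_kernel (fun U mU => measurable_kernel (p t) U mU) fc0 mfc.
under eq_fun do rewrite -(Rintegral_shift (p1 _ _) mf fc).
move/measurable_EFinP => mfI.
rewrite (_ : (fun x => _) = (fun x => ((\int[p t x]_z f z) + c) - c)); last first.
  by apply/funext => x; rewrite addrK.
exact: measurable_funB.
Qed.

Lemma Rintegral_transition s t x : 0 <= s -> 0 <= t ->
  \int[p (s + t) x]_z f z = \int[p s x]_y \int[p t y]_z f z.
Proof.
move=> s0 t0; apply: (addIr c); apply: EFin_inj.
have mfc : measurable_fun setT (fun z => (f z + c)%:E).
  by apply/measurable_EFinP; exact: measurable_funD.
rewrite (Rintegral_shift (p1 _ _) mf fc) ge0_integral_transition//.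
rewrite (Rintegral_shift (p1 _ _) (measurable_transition t)); last first.
  by move=> y; exact: Rintegral_bounded.
by apply: eq_integral => y _; rewrite (Rintegral_shift (p1 _ _) mf fc).
Qed.

End bounded.

End Semigroup.
Section SphereMeasurability.
Variable R : realType.
Implicit Types (x z : sphere R).

Lemma measurable_coord (i : 'I_3) : measurable_fun setT (fun x : sphere R => x i 0).
Proof.
move=> _ U mU; rewrite setTI; apply: sub_sigma_algebra.
by exists i => //; exists U.
Qed.

(** The sigma-algebra of the sphere is generated by the coordinates. *)
Lemma measurable_fun_sphere d (T : measurableType d) (f : T -> sphere R) :
  (forall i, measurable_fun setT (fun t => f t i 0)) -> measurable_fun setT f.
Proof.
move=> mf; pose G := [set A : set (sphere R) | exists2 i : 'I_3, setT i &
  exists2 U : set R, measurable U & A = (fun x : sphere R => x i 0) @^-1` U].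
apply: (@measurability _ _ T (sphere R) setT f G); first by [].
by move=> _ [_ [i _ [U mU ->]] <-]; exact: mf.
Qed.

Lemma innerC (u v : 'cV[R]_3) : inner u v = inner v u.
Proof. by rewrite !innerE; apply: eq_bigr => i _; rewrite mulrC. Qed.

Lemma inner_sphere1 x : inner x x = 1.
Proof. by rewrite -sum_sqr_inner; exact/eqP/(sphere_valP x). Qed.

Lemma inner_sphere_le1 x z : -1 <= inner z x <= 1.
Proof.
have sq (v : 'cV[R]_3) : 0 <= \sum_i v i 0 ^+ 2 by apply: sumr_ge0 => i _; exact: sqr_ge0.
have E (s : R) : \sum_i (sphere_val z + s *: sphere_val x) i 0 ^+ 2
    = 1 + s * inner z x *+ 2 + s ^+ 2.
  rewrite -[in RHS](inner_sphere1 z) -[s ^+ 2]mulr1 -(inner_sphere1 x) !innerE.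
  rewrite mulr_sumr -sumrMnl mulr_sumr -!big_split /=; apply: eq_bigr => i _.
  by rewrite !mxE; ring.
have := sq (sphere_val z + 1 *: sphere_val x); have := sq (sphere_val z + (-1) *: sphere_val x).
by rewrite !E => h1 h2; apply/andP; split; lra.
Qed.

Lemma legendre_inner_le1 l x z : `|(legendre R l).[inner z x]| <= 1.
Proof. exact/legendre_le1/inner_sphere_le1. Qed.

Lemma measurable_inner2 :
  measurable_fun setT (fun q : sphere R * sphere R => inner q.1 q.2).
Proof.
rewrite (_ : (fun q => _) = fun q : sphere R * sphere R => \sum_i q.1 i 0 * q.2 i 0).
  by apply: measurable_sum => i; apply: measurable_funM;
    [apply: (measurableT_comp (measurable_coord i))|apply: (measurableT_comp (measurable_coord i))].
by apply/funext => q; rewrite innerE.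
Qed.

Lemma measurable_horner_fun (g : {poly R}) : measurable_fun setT (fun t : R => g.[t]).
Proof. by apply: continuous_measurable_fun; exact: continuous_horner. Qed.

Lemma measurable_zonal (g : {poly R}) z :
  measurable_fun setT (fun x : sphere R => g.[inner z x]).
Proof.
apply: (measurableT_comp (measurable_horner_fun g)).
exact: (measurableT_comp measurable_inner2 (pair1_measurable z)).
Qed.

End SphereMeasurability.

Section Eigenfunction.
Variables (R : realType) (p : R -> R.-pker (sphere R) ~> (sphere R)).
Hypotheses (tp : transition_function p) (gp : generated_by_laplace_beltrami p).
Variables (f : sphere R -> R) (m : R).
Hypotheses (mf : measurable_fun setT f) (f1 : forall y, `|f y| <= 1).
Hypotheses (C2f : C2_sphere f) (m0 : 0 <= m).
Hypothesis eigenf : forall x, laplace_beltrami f x = - m * f x.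
Let u t x := \int[p t x]_y f y.

Let p1 t x : p t x setT = 1%E. Proof. exact: prob_kernel. Qed.

Lemma expRN_taylor1 (a : R) : 0 <= a -> `|expR (- a) - (1 - a)| <= a ^+ 2.
Proof.
move=> a0; have h1 : 1 - a <= expR (- a) by exact: expR_ge1Dx.
have h2 : 1 + a <= expR a by exact: expR_ge1Dx.
have e0 : 0 < expR (- a) by exact: expR_gt0.
have : expR (- a) * (1 + a) <= 1.
  by rewrite -[leRHS](expR0 R) -(addNr a) expRD ler_pM2l.
rewrite ger0_norm ?subr_ge0// => h3; nra.
Qed.

(** The generator is only known to be a derivative at time [0]; the expansion is
    replaced by [exp (- m h)], which is exact along many steps. *)
Let one_step e : 0 < e -> exists2 D, 0 < D & forall h x, 0 < h < D ->
  `|u h x - expR (- m * h) * f x| <= e * h.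
Proof.
move=> e0; have e20 : 0 < e / 2 by rewrite divr_gt0.
have [D /= D0 hD] := gp C2f e20.
(* Below this bound the quadratic error [(m h)^2] is at most [e h / 2]; adding
   [1] to the denominator covers [m = 0]. *)
have D1 : 0 < e / 2 / (m ^+ 2 + 1) by rewrite divr_gt0// ltr_wpDl ?sqr_ge0.
exists (Num.min D (e / 2 / (m ^+ 2 + 1))); first by rewrite lt_min D0.
move=> h x /andP[h0]; rewrite lt_min => /andP[hD0 hD1].
have hb : ball_ [eta Num.Def.normr] 0 D h by rewrite /= sub0r normrN gtr0_norm.
have := hD h hb h0 x; rewrite eigenf -/(u h x) => k1.
have k2 := expRN_taylor1 (mulr_ge0 m0 (ltW h0)).
have k3 : (m * h) ^+ 2 <= e / 2 * h.
  rewrite exprMn [h ^+ 2]expr2 mulrA ler_wpM2r ?(ltW h0)//.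
  by rewrite ltr_pdivlMr ?ltr_wpDl ?sqr_ge0// in hD1; nra.
have -> : u h x - expR (- m * h) * f x =
   h * (h^-1 * (u h x - f x) - - m * f x) - (expR (- (m * h)) - (1 - m * h)) * f x.
  by rewrite mulNr; field; rewrite gt_eqF.
apply: (le_trans (ler_normB _ _)); rewrite !normrM (gtr0_norm h0).
have -> : e * h = h * (e / 2) + e / 2 * h by field.
apply: lerD; first by rewrite ler_wpM2l ?(ltW h0).
rewrite -[leRHS]mulr1; apply: ler_pM => //; exact: le_trans k2 k3.
Qed.

Let u0 x : u 0 x = f x.
Proof.
rewrite /u /Rintegral (eq_measure_integral (dirac x)); last first.
  by move=> A mA _; exact: tp.1.
rewrite integral_dirac//; first by rewrite diracT mul1e.
exact/measurable_EFinP.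
Qed.

Let mu' t : measurable_fun setT (u t).
Proof. exact: (measurable_transition _ mf f1). Qed.

Let u1 t y : `|u t y| <= 1.
Proof. by apply: (Rintegral_bounded (p1 _ _)). Qed.

(** Errors add up over the [n] steps because transition operators are
    contractions and the factor [exp (- m h)] is at most [1]. *)
Let many_steps e D : (forall h x, 0 < h < D -> `|u h x - expR (- m * h) * f x| <= e * h) ->
  forall h x n, 0 < h < D -> `|u (n%:R * h) x - expR (- m * (n%:R * h)) * f x| <= e * (n%:R * h).
Proof.
move=> step h x n hD; have /andP[h0 _] := hD; elim: n => [|n IH].
  by rewrite mul0r u0 !mulr0 expR0 mul1r subrr normr0.
have -> : u (n.+1%:R * h) x = \int[p (n%:R * h) x]_y u h y.
  rewrite -natr1 mulrDl mul1r; apply: (Rintegral_transition tp mf f1).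
    by rewrite mulr_ge0 ?(ltW h0).
  exact: ltW.
pose a := expR (- m * h).
have a0 : 0 < a by exact: expR_gt0.
have a1 : a <= 1 by rewrite /a mulNr expR_le1 oppr_le0 mulr_ge0// ltW.
have E : \int[p (n%:R * h) x]_y u h y - a * u (n%:R * h) x =
    \int[p (n%:R * h) x]_y (u h y - a * f y).
  rewrite RintegralB//; last 2 first.
  - exact: (integrable_bounded (p1 _ _) _ (u1 h)).
  - apply: (integrable_bounded (c := a * 1) (p1 _ _)).
      exact: measurable_funM.
    by move=> y; rewrite normrM (gtr0_norm a0) ler_wpM2l ?(ltW a0).
  by rewrite RintegralZl//; exact: (integrable_bounded (p1 _ _) _ f1).
have k1 : `|\int[p (n%:R * h) x]_y u h y - a * u (n%:R * h) x| <= e * h.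
  rewrite E; apply: (Rintegral_bounded (p1 _ _)).
    by apply: measurable_funB => //; exact: measurable_funM.
  by move=> y; exact: step.
have -> : expR (- m * (n.+1%:R * h)) = a * expR (- m * (n%:R * h)).
  by rewrite /a -expRD; congr expR; rewrite -natr1; ring.
set I := \int[_]_y u h y in k1 *.
have -> : I - a * expR (- m * (n%:R * h)) * f x =
   (I - a * u (n%:R * h) x) + a * (u (n%:R * h) x - expR (- m * (n%:R * h)) * f x) by ring.
apply: (le_trans (ler_normD _ _)).
have -> : e * (n.+1%:R * h) = e * h + e * (n%:R * h) by rewrite -natr1; ring.
apply: lerD => //; rewrite normrM (gtr0_norm a0).
by apply: le_trans IH; rewrite ler_piMl.
Qed.

(** The difference of the two sides is at most [e t] in absolute value for every
    [e > 0], by [many_steps] with step [t/n]. *)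
Lemma Rintegral_eigenfunction t x : 0 <= t -> \int[p t x]_y f y = expR (- m * t) * f x.
Proof.
rewrite le_eqVlt => /predU1P[<-|t0]; first by rewrite -/(u 0 x) u0 mulr0 expR0 mul1r.
apply/eqP; rewrite -subr_eq0 -normr_eq0 eq_le normr_ge0 andbT.
apply/ler_addgt0Pl => e e0; rewrite addr0.
have [D D0 step] := one_step (divr_gt0 e0 t0).
pose n := (Num.truncn (t / D)).+1.
have n0 : (0 : R) < n%:R by rewrite ltr0n.
have hn : 0 < t / n%:R < D.
  rewrite divr_gt0//= ltr_pdivrMr// mulrC -ltr_pdivrMr//.
  exact: truncnS_gt.
have := many_steps step x n hn.
by rewrite mulrC divfK ?gt_eqF// divfK ?gt_eqF.
Qed.

End Eigenfunction.

(** * Time-changed Brownian motion *)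

Section JointMeasurability.
Variables (R : realType) (d : measure_display) (Omega : measurableType d).
Variable B : R -> Omega -> sphere R.
Hypothesis contB : forall w,
  {within `[0, +oo[, continuous (fun t => B t w : 'cV[R]_3)}.

Definition path_sigma_algebra := sigma_generated [set t : R | 0 <= t] B.

Lemma sigma_algebra_path : sigma_algebra setT path_sigma_algebra.
Proof. exact: smallest_sigma_algebra. Qed.

(** The greatest multiple of [1/(n+1)] below the positive part of [s]. *)
Let grid n (s : R) : R := (Num.truncn (Num.max s 0 * n.+1%:R))%:R / n.+1%:R.

Let max0 (s : R) : 0 <= Num.max s 0.
Proof. by rewrite le_max lexx orbT. Qed.

Let grid_bound n s : `|grid n s - Num.max s 0| <= n.+1%:R^-1.
Proof.
have n0 : (0 : R) < n.+1%:R by rewrite ltr0n.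
have s0 : 0 <= Num.max s 0 * n.+1%:R by rewrite mulr_ge0// max0.
rewrite -(ler_pM2r n0) mulVf ?gt_eqF// -{1}(gtr0_norm n0) -normrM mulrBl divfK ?gt_eqF//.
have /andP[h1 h2] := truncn_itv s0.
by rewrite distrC ger0_norm ?subr_ge0// lerBlDr addrC natr1 ltW.
Qed.

Let cvg_grid w i s : B (grid n s) w i 0 @[n --> \oo] --> B (Num.max s 0) w i 0.
Proof.
have cg : grid ^~ s @ \oo --> within `[0, +oo[ (nbhs (Num.max s 0)).
  have cg : grid ^~ s @ \oo --> Num.max s 0.
    apply/cvgrPdist_le => e e0; near=> n; rewrite distrC.
    apply: (le_trans (grid_bound n s)).
    by apply: ltW; near: n; exact: (near_infty_natSinv_lt (PosNum e0)).
  move=> U /cg cU; have {}cU : \forall n \near \oo, (grid n s \in `[0, +oo[ -> U (grid n s)) by exact: cU.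
  apply: (filterS _ cU) => n /=; apply.
  by rewrite in_itv/= andbT divr_ge0.
have s0 : `[0, +oo[%classic (Num.max s 0) by rewrite /= in_itv/= andbT max0.
have /subspace_continuousP/(_ _ s0) h := contB (w := w).
exact: (cvg_comp _ _ (cvg_comp _ _ cg h) (@coord_continuous _ _ _ i 0 _)).
Unshelve. all: by end_near. Qed.

Let measurable_grid n i :
  measurable_fun setT ((fun q => B (grid n q.1) q.2 i 0) : R * g_sigma_algebraType path_sigma_algebra -> R).
Proof.
move=> _ U mU; rewrite setTI.
pose A k : set R := (fun s => Num.max s 0 * n.+1%:R) @^-1` `[k%:R, k.+1%:R[.
pose V k : set (g_sigma_algebraType path_sigma_algebra) := [set w | U (B (k%:R / n.+1%:R) w i 0)].
rewrite (_ : _ @^-1` U = \bigcup_k (A k `*` V k)); last first.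
  apply/seteqP; split => [[s w] /= h|[s w] [k _ [/=]]].
    exists (Num.truncn (Num.max s 0 * n.+1%:R)) => //; split => //=.
    by rewrite /A /= in_itv/= truncn_itv// mulr_ge0// max0.
  by rewrite /A /= in_itv/= => /truncn_def E; rewrite /V /= /grid E.
apply: bigcup_measurable => k _; apply: measurableX.
  rewrite -[A k]setTI; apply: (_ : measurable_fun setT _) => //.
  by apply: measurable_funM => //; exact: measurable_maxr.
apply: sub_sigma_algebra; apply: sub_sigma_algebra.
exists (k%:R / n.+1%:R) => /=; first by rewrite divr_ge0.
exists [set x : sphere R | U (x i 0)] => //.
by rewrite -[X in measurable X]setTI; exact: measurable_coord.
Qed.

(** By continuity of the paths the process is the limit of its discretizations
    in time, which are countable unions of products. The positive part of the
    time makes the process total, since nothing is assumed about [B] at negative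
    times. Joint measurability with respect to the sigma-algebra of the process
    is what independence of the clock requires. *)
Lemma measurable_path : measurable_fun setT
  ((fun q => B (Num.max q.1 0) q.2) : R * g_sigma_algebraType path_sigma_algebra -> sphere R).
Proof.
apply: measurable_fun_sphere => i.
apply: (measurable_fun_cvg (fun n => @measurable_grid n i)) => -[s w] _ /=.
exact: cvg_grid.
Qed.

End JointMeasurability.

Section ProbabilityBound.
Context d (T : measurableType d) (R : realType) (m : probability T R).
Local Open Scope ereal_scope.

(** The integral of a nonnegative function is a supremum over the simple
    functions below it, and more simple functions lie below [g]. *)
Lemma ge0_le_integralT (f g : T -> \bar R) : (forall x, 0 <= f x) ->
  (forall x, f x <= g x) -> \int[m]_x f x <= \int[m]_x g x.
Proof.
move=> f0 fg; rewrite !ge0_integralTE//; last by move=> x; exact: le_trans (f0 x) (fg x).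
apply: le_ereal_sup => _ [h hf <-]; exists h => // x; exact: le_trans (hf x) (fg x).
Qed.

Lemma integral_le_cst (f : T -> \bar R) (c : R) : (forall x, 0 <= f x) ->
  (forall x, f x <= c%:E) -> \int[m]_x f x <= c%:E.
Proof.
move=> f0 fc; apply: (le_trans (ge0_le_integralT f0 fc)).
by rewrite integral_cst//= probability_setT mule1.
Qed.

End ProbabilityBound.

Section BrownianLaw.
Variables (R : realType) (d : measure_display) (Omega : measurableType d).
Variables (P : probability Omega R) (x : sphere R) (B : R -> Omega -> sphere R).
Hypothesis rbm : rotational_brownian_motion P x B.
Variables (l : nat) (z : sphere R).
Local Notation f := (fun y : sphere R => (legendre R l).[inner z y]).

(** The Markov property from time [0] identifies the law of [B t] with the
    transition probability from [x]. *)
Lemma integral_rbm_legendre t : 0 <= t ->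
  (\int[P]_w (f (B t w))%:E = (expR (- mu_ R l * t) * f x)%:E)%E.
Proof.
move=> t0; have [p [tp gp mp]] := rbm_diffusion rbm.
have mB := rbm_measurable rbm t0.
have mf : measurable_fun setT f by exact: measurable_zonal.
have f1 y : `|f y| <= 1 by exact: legendre_inner_le1.
have law U : measurable U -> P (B t @^-1` U) = p t x U.
  move=> mU; rewrite -[X in P X]setTI (mp 0 t) ?lexx//; last by have [h0 hC _] := smallest_sigma_algebra setT
      [set A | exists2 i, [set u | 0 <= u <= 0] i & exists2 V, measurable V & A = B i @^-1` V];
    have := hC _ h0; rewrite setD0.
  under eq_integral do rewrite (rbm_start rbm) subr0.
  apply: (etrans (integral_cst P measurableT (p t x U))).
  by rewrite [X in (_ * X)%E](@probability_setT _ _ _ P) mule1.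
pose B' : {mfun Omega >-> sphere R} := mfun_Sub (mem_set mB).
have mEf : measurable_fun setT (EFin \o f) by exact/measurable_EFinP.
transitivity (\int[distribution P B']_y (f y)%:E)%E.
  rewrite integral_distribution//; apply: (@integrable_bounded _ _ _ P _ (f \o B t) 1) => //.
    exact: probability_setT.
    exact: measurableT_comp.
  by move=> w; exact: f1.
rewrite (eq_measure_integral (p t x)); last by move=> U mU _; exact: law.
rewrite -(EFin_Rintegral _ mf f1); last exact: prob_kernel.
congr EFin; apply: (Rintegral_eigenfunction tp gp mf f1) => //.
- exact: C2_zonal.
- by move=> y; exact: laplace_beltrami_legendre.
Qed.

End BrownianLaw.

(** Both sides have the Laplace transform [1/(s + m)]. *)
Lemma mittag_leffler1 (R : realType) (m t : R) : 0 <= m -> 0 < t ->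
  mittag_leffler 1 (- m * t `^ 1) = expR (- m * t).
Proof.
move=> m0 t0; apply/esym.
apply: (mittag_leffler_of_laplace (F := fun t => expR (- m * t)) ltr01 m0) => //.
- exact: measurable_expRM.
- by move=> s u s0 su; rewrite ler_expR !mulNr lerN2 ler_wpM2l.
- by move=> u u0; rewrite expR_ge0 mulNr expR_le1 oppr_le0 mulr_ge0// ltW.
move=> s s0 _; have sm0 : 0 < s + m by rewrite ltr_wpDr.
rewrite /ml_ratio powRN powRr1 ?(ltW s0)//.
transitivity (\int[@lebesgue_measure R]_(u in `]0%R, +oo[)
    ((s + m)^-1%:E * ((s + m) * expR (- (s + m) * u))%:E))%E.
  apply: eq_integral => u _; rewrite -EFinM mulrA mulVf ?gt_eqF// mul1r -expRD.
  by congr (expR _)%:E; ring.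
have mE : measurable_fun (`]0, +oo[ : set R) (fun u => ((s + m) * expR (- (s + m) * u))%:E).
  by apply/measurable_EFinP; apply: measurable_funM => //; exact: measurable_expRM.
rewrite ge0_integralZl//=; last 2 first.
- by move=> u _; rewrite lee_fin mulr_ge0 ?expR_ge0// ltW.
- by rewrite lee_fin invr_ge0 ltW.
rewrite integral_itv_obnd_cbnd// integral_expR// mulr0 expR0 mule1; congr EFin.
by field; rewrite !gt_eqF.
Qed.

Section TimeChange.
Variables (R : realType) (d : measure_display) (Omega : measurableType d).
Variables (P : probability Omega R) (nu t0 : R) (x : sphere R).
Variables (B : R -> Omega -> sphere R) (H : R -> Omega -> R).
Hypothesis nu01 : 0 < nu <= 1.
Hypothesis rbm : rotational_brownian_motion P x B.
Hypothesis HS : nu < 1 -> stable_subordinator P nu H.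
Hypothesis clock : independent P (sigma_generated [set t | 0 <= t] B)
  (sigma_generated [set t | 0 <= t] (inverse_subordinator nu H)).
Local Notation L := (inverse_subordinator nu H).

Let nu0 : 0 < nu. Proof. by case/andP: nu01. Qed.

Let nuE : nu = 1 \/ nu < 1.
Proof. by case/andP: nu01 => _; rewrite le_eqVlt => /predU1P. Qed.

Lemma clock_ge0 t w : 0 <= t -> 0 <= L t w.
Proof.
move=> tp; have [n1|n1] := nuE; last exact: inverse_subordinator_ge0.
by rewrite /inverse_subordinator n1 eqxx.
Qed.

Lemma measurable_clock t : measurable_fun setT (L t).
Proof.
have [n1|n1] := nuE; last exact: measurable_inverse_subordinator (HS n1) _.
by rewrite (_ : L t = cst t)//; apply/funext => w; rewrite /inverse_subordinator n1 eqxx.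
Qed.

Lemma ae_clock0 : {ae P, forall w, L 0 w = 0}.
Proof.
have [n1|n1] := nuE; last exact: ae_inverse_subordinator0 (HS n1).
by apply: aeW => w; rewrite /inverse_subordinator n1 eqxx.
Qed.

Lemma clock_laplace m t : 0 <= m -> 0 < t ->
  (\int[P]_w (expR (- m * L t w))%:E = (mittag_leffler nu (- m * t `^ nu))%:E)%E.
Proof.
move=> m0 tp; have [n1|n1] := nuE; last exact: inverse_subordinator_laplace (HS n1) _ _ _.
rewrite n1 mittag_leffler1//; under eq_integral do rewrite /inverse_subordinator eqxx.
by rewrite integral_cst//= probability_setT mule1.
Qed.

Let mpath := measurable_path (rbm_continuous rbm).

Let path_measurable : path_sigma_algebra B `<=` measurable.
Proof.
apply: smallest_sub; first exact: sigma_algebra_measurable.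
by move=> _ [t tp [U mU ->]]; rewrite -[X in measurable X]setTI; exact: (rbm_measurable rbm).
Qed.

Lemma measurable_time_changed t : t0 <= t -> measurable_fun setT (time_changed nu t0 B H t).
Proof.
move=> tt; rewrite (_ : time_changed _ _ _ _ _ =
  (fun q => B (Num.max q.1 0) q.2) \o (fun w => (L (t - t0) w, w))); last first.
  by apply/funext => w /=; rewrite /time_changed max_l// clock_ge0// subr_ge0.
apply: measurableT_comp mpath _.
apply/measurable_fun_pairP; split; first exact: measurable_clock.
exact: (measurable_id_sub (sigma_algebra_path _) path_measurable).
Qed.

Lemma measurable_clock_exp m t : measurable_fun setT (fun w => expR (- m * L t w)).
Proof.
apply: measurableT_comp; first exact: measurable_expR.
by apply: measurable_funM => //; exact: measurable_clock.
Qed.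

Lemma clock_exp_le1 m t w : 0 <= m -> 0 <= t -> `|expR (- m * L t w)| <= 1.
Proof.
move=> m0 tp; rewrite ger0_norm ?expR_ge0// expR_le1 mulNr oppr_le0.
by rewrite mulr_ge0// clock_ge0.
Qed.

(** Conditionally on the clock, the mean at the random time [L] is [exp (- mu_l
    L) P_l(<z,x>)]; its expectation is given by [clock_laplace]. *)
Lemma integral_time_changed_legendre l (z : sphere R) t : t0 < t ->
  (\int[P]_w ((legendre R l).[inner z (time_changed nu t0 B H t w)])%:E =
   (mittag_leffler nu (- mu_ R l * (t - t0) `^ nu) * (legendre R l).[inner z x])%:E)%E.
Proof.
move=> tt; have dt : 0 < t - t0 by rewrite subr_gt0.
pose f (y : sphere R) := (legendre R l).[inner z y].
pose h (q : R * Omega) := f (B (Num.max q.1 0) q.2).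
have mh : measurable_fun setT (h : R * g_sigma_algebraType (path_sigma_algebra B) -> R).
  exact: measurableT_comp (measurable_zonal _ _) mpath.
have Lmax w : Num.max (L (t - t0) w) 0 = L (t - t0) w by rewrite max_l// clock_ge0// ltW.
transitivity (\int[P]_w (h (L (t - t0) w, w))%:E)%E.
  by apply: eq_integral => w _; rewrite /h /= Lmax.
rewrite (integral_indep_algebra (sigma_algebra_path B) path_measurable _ _ mh); last 3 first.
- exact: measurable_clock.
- move=> A U GA mU; apply: clock => //; apply: sub_sigma_algebra.
  by exists (t - t0) => /=; [exact: ltW|exists U].
- apply: (@le_lt_trans _ _ 1%:E); last by rewrite ltry.
  apply: integral_le_cst => w'; first exact: integral_ge0.
  by apply: integral_le_cst => w //; rewrite lee_fin legendre_inner_le1.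
transitivity (\int[P]_w' ((f x)%:E * (expR (- mu_ R l * L (t - t0) w'))%:E))%E.
  apply: eq_integral => w' _; rewrite /h /= Lmax (integral_rbm_legendre rbm).
    by rewrite -EFinM mulrC.
  by rewrite clock_ge0// ltW.
have m0 : 0 <= mu_ R l by exact: ler0n.
rewrite integralZl//; last first.
  apply: (@integrable_bounded _ _ _ P _ (fun w => expR (- mu_ R l * L (t - t0) w)) 1).
  - exact: probability_setT.
  - exact: measurable_clock_exp.
  - by move=> w; apply: clock_exp_le1 => //; exact: ltW.
by rewrite (clock_laplace m0 dt) -EFinM mulrC.
Qed.

End TimeChange.

(** * Square-integrable variables *)

Section SquareIntegrable.
Variables (R : realType) (d : measure_display) (Omega : measurableType d).
Variable P : probability Omega R.
Implicit Types f g : Omega -> R.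

Definition square_integrable f :=
  measurable_fun setT f /\ P.-integrable setT (fun w => (f w ^+ 2)%:E).

Lemma square_integrableP f : measurable_fun setT f ->
  (\int[P]_w (f w ^+ 2)%:E < +oo)%E -> square_integrable f.
Proof.
move=> mf fy; split => //; apply/integrableP; split.
  by apply/measurable_EFinP; exact: measurable_funX.
by under eq_integral do rewrite gee0_abs ?lee_fin ?sqr_ge0//.
Qed.

Lemma integrable_mul f g : square_integrable f -> square_integrable g ->
  P.-integrable setT (EFin \o (fun w => f w * g w)).
Proof.
move=> [mf f2] [mg g2].
apply: (le_integrable _ _ _ (integrableD _ f2 g2)) => //.
  by apply/measurable_EFinP; exact: measurable_funM.
move=> w _; rewrite /= lee_fin [leRHS]ger0_norm ?addr_ge0 ?sqr_ge0// ler_norml.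
have := sqr_ge0 (f w + g w); have := sqr_ge0 (f w - g w).
by have := sqr_ge0 (f w); have := sqr_ge0 (g w); move=> *; apply/andP; split; nra.
Qed.

Lemma square_integrableZ (c : R) f : square_integrable f ->
  square_integrable (fun w => c * f w).
Proof.
move=> [mf f2]; split; first exact: measurable_funM.
apply: eq_integrable (integrableZl measurableT (c ^+ 2) f2) => //.
by move=> w _; rewrite /= exprMn.
Qed.

Lemma square_integrableD f g : square_integrable f -> square_integrable g ->
  square_integrable (fun w => f w + g w).
Proof.
move=> sf sg; have fg := integrable_mul sf sg; have [mf f2] := sf; have [mg g2] := sg.
split; first exact: measurable_funD.
have fg2 := integrableZl measurableT 2 fg.
apply: eq_integrable (integrableD _ (integrableD _ f2 g2) fg2) => //.
by move=> w _; rewrite /= -EFinD; congr EFin; ring.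
Qed.

Lemma square_integrable0 : square_integrable (fun=> 0).
Proof.
split; first exact: measurable_cst.
by apply: (eq_integrable _ (cst 0%E)) => [//|w _|]; [rewrite /= expr0n|exact: integrable0].
Qed.

Lemma square_integrable_sum (I : Type) (r : seq I) (F : I -> Omega -> R) :
  (forall i, square_integrable (F i)) ->
  square_integrable (fun w => \sum_(i <- r) F i w).
Proof.
move=> sF; elim: r => [|i r IH].
  by under [fun w => _]eq_fun do rewrite big_nil; exact: square_integrable0.
by under [fun w => _]eq_fun do rewrite big_cons; exact: square_integrableD.
Qed.

Lemma square_integrableB f g : square_integrable f -> square_integrable g ->
  square_integrable (fun w => f w - g w).
Proof.
move=> sf sg; have := square_integrableD sf (square_integrableZ (-1) sg).
by congr square_integrable; apply/funext => w; rewrite mulN1r.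
Qed.

Lemma nonneg_quadratic_discriminant (a b c : R) : 0 <= c ->
  (forall t, 0 <= a + t * b *+ 2 + t ^+ 2 * c) -> b ^+ 2 <= a * c.
Proof.
move=> cp h; have [b0|b0] := eqVneq b 0.
  have a0 : 0 <= a by have := h 0; rewrite mul0r mul0rn expr0n/= mul0r !addr0.
  by rewrite b0 expr0n/= mulr_ge0.
have [c0|c0] := eqVneq c 0.
  have := h (- (a + 1) / (b *+ 2)).
  rewrite c0 mulr0 addr0 -mulrnAr divfK ?mulrn_eq0//; lra.
have := h (- b / c).
have -> : a + (- b / c) * b *+ 2 + (- b / c) ^+ 2 * c = (a * c - b ^+ 2) / c by field.
by rewrite pmulr_lge0 ?invr_gt0 ?lt_neqAle ?(eq_sym 0) ?c0// subr_ge0.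
Qed.

Lemma Rintegral_sqr_ge0 f : 0 <= \int[P]_w f w ^+ 2.
Proof. by apply: Rintegral_ge0 => w _; exact: sqr_ge0. Qed.

Lemma cauchy_schwarz f g : square_integrable f -> square_integrable g ->
  (\int[P]_w (f w * g w)) ^+ 2 <= (\int[P]_w f w ^+ 2) * \int[P]_w g w ^+ 2.
Proof.
move=> sf sg; apply: nonneg_quadratic_discriminant => [|t]; first exact: Rintegral_sqr_ge0.
have fg := integrable_mul sf sg; have [_ f2] := sf; have [_ g2] := sg.
have := Rintegral_sqr_ge0 (fun w => f w + t * g w).
congr (_ <= _).
transitivity (\int[P]_w ((f w ^+ 2 + (t *+ 2) * (f w * g w)) + t ^+ 2 * g w ^+ 2)).
  by congr Rintegral; apply/funext => w; ring.
have ifg := integrableZl measurableT (t *+ 2) fg.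
have ig2 := integrableZl measurableT (t ^+ 2) g2.
rewrite RintegralD//; last exact: (integrableD _ f2 ifg).
rewrite RintegralD// !RintegralZl//; ring.
Qed.

(** Continuity of the inner product of the space of square-integrable variables:
    the difference is a sum of three products with a factor tending to [0],
    controlled by [cauchy_schwarz]. *)
Lemma cvg_Rintegral_mul f g (F G : nat -> Omega -> R) :
  square_integrable f -> square_integrable g ->
  (forall n, square_integrable (F n)) -> (forall n, square_integrable (G n)) ->
  \int[P]_w (f w - F n w) ^+ 2 @[n --> \oo] --> 0 ->
  \int[P]_w (g w - G n w) ^+ 2 @[n --> \oo] --> 0 ->
  \int[P]_w (F n w * G n w) @[n --> \oo] --> \int[P]_w (f w * g w).
Proof.
move=> sf sg sF sG cF cG.
have sFf n : square_integrable (fun w => f w - F n w) by exact: square_integrableB.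
have sGg n : square_integrable (fun w => g w - G n w) by exact: square_integrableB.
(* A product tends to [0] in mean as soon as one factor does in mean square and
   the other has convergent mean square. *)
have vanish (U V : nat -> Omega -> R) (v : R) : (forall n, square_integrable (U n)) ->
    (forall n, square_integrable (V n)) -> \int[P]_w U n w ^+ 2 @[n --> \oo] --> 0 ->
    \int[P]_w V n w ^+ 2 @[n --> \oo] --> v ->
    \int[P]_w (U n w * V n w) @[n --> \oo] --> 0.
  move=> sU sV cU cV; apply/norm_cvg0P.
  have c0 : Num.sqrt ((\int[P]_w U n w ^+ 2) * \int[P]_w V n w ^+ 2) @[n --> \oo] --> 0.
    rewrite -(sqrtr0 R) -(mul0r v).
    apply: (cvg_comp _ _ (cvgM cU cV)); exact: sqrt_continuous.
  apply: (squeeze_cvgr _ (cvg_cst 0) c0); near=> n.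
  rewrite normr_ge0/= -sqrtr_sqr ler_sqrt ?cauchy_schwarz//.
  by rewrite mulr_ge0// Rintegral_sqr_ge0.
have -> : (fun n => \int[P]_w (F n w * G n w)) = (fun n => \int[P]_w (f w * g w)
   - (\int[P]_w ((f w - F n w) * g w)) - \int[P]_w ((g w - G n w) * f w)
   + \int[P]_w ((f w - F n w) * (g w - G n w))).
  apply/funext => n.
  have i1 := integrable_mul sf sg; have i2 := integrable_mul (sFf n) sg.
  have i3 := integrable_mul (sGg n) sf; have i4 := integrable_mul (sFf n) (sGg n).
  rewrite -RintegralB// -RintegralB//; last exact: (integrableB _ i1 i2).
  rewrite -RintegralD//; last exact: (integrableB _ (integrableB _ i1 i2) i3).
  by congr Rintegral; apply/funext => w; ring.
rewrite -[X in _ --> X]subr0 -[X in _ --> X - _]subr0 -[X in _ --> X]addr0.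
apply: cvgD; [apply: cvgB; [apply: cvgB; first exact: cvg_cst|]|].
- by apply: (vanish _ (fun=> g) _ sFf (fun=> sg) cF); exact: cvg_cst.
- by apply: (vanish _ (fun=> f) _ sGg (fun=> sf) cG); exact: cvg_cst.
- exact: (vanish _ _ _ sFf sGg cF cG).
Unshelve. all: by end_near. Qed.

End SquareIntegrable.

(** * Rotations to the north pole *)

Section RotateToNorth.
Variable R : realType.
Implicit Types x y : sphere R.

Lemma inner_so3_act (g : SO3 R) x y : inner (so3_act g x) (so3_act g y) = inner x y.
Proof. by rewrite /inner /= trmx_mul -mulmxA (mulmxA (SO3_val g)^T) SO3_orth mul1mx. Qed.

Lemma det3 (a : nat -> nat -> R) : \det (\matrix_(i < 3, j < 3) a i j) =
  a 0 0 * (a 1 1 * a 2 2 - a 1 2 * a 2 1) - a 0 1 * (a 1 0 * a 2 2 - a 1 2 * a 2 0)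
  + a 0 2 * (a 1 0 * a 2 1 - a 1 1 * a 2 0).
Proof.
rewrite (expand_det_row _ 0) !big_ord_recl big_ord0 /cofactor.
(* The entries are indexed by natural numbers in order that the expansion
   compute. *)
rewrite !(expand_det_row _ 0) !big_ord_recl !big_ord0 /cofactor !det_mx11 !mxE /=.
by rewrite /bump /= !addn0 !add0n !addn1 ?addn0; ring.
Qed.

Lemma inner3 (u v : 'cV[R]_3) : inner u v =
  u (inord 0) 0 * v (inord 0) 0 + u (inord 1) 0 * v (inord 1) 0 + u (inord 2) 0 * v (inord 2) 0.
Proof.
rewrite innerE !big_ord_recl big_ord0 addr0 addrA.
by congr (_ * _ + _ * _ + _ * _); congr (_ _ 0); apply/val_inj; rewrite /= inordK.
Qed.

Variable v : 'cV[R]_3.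
Hypothesis v0 : inner v v != 0.

Let half_turn_mx : 'M[R]_3 := (2 / inner v v) *: (v *m v^T) - 1%:M.

Let half_turn_mxE (w : 'cV[R]_3) : half_turn_mx *m w = (2 / inner v v * inner v w) *: v - w.
Proof.
rewrite /half_turn_mx mulmxBl mul1mx -scalemxAl -mulmxA; congr (_ - _).
rewrite -scalerA; congr (_ *: _); apply/matrixP => i j.
by rewrite !mxE big_ord1 !ord1 mulrC /inner.
Qed.

Let half_turn_mxT : half_turn_mx^T = half_turn_mx.
Proof. by rewrite /half_turn_mx linearB /= trmx1 linearZ /= trmx_mul trmxK. Qed.

Let half_turn_mx_orth : half_turn_mx^T *m half_turn_mx = 1%:M.
Proof.
rewrite half_turn_mxT {2}/half_turn_mx mulmxBr mulmx1 -scalemxAr mulmxA half_turn_mxE.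
have -> : (2 / inner v v * inner v v) *: v - v = v.
  by rewrite divfK// -[X in _ - X]scale1r -scalerBl addrK scale1r.
by rewrite /half_turn_mx opprB addrC subrK.
Qed.

Let half_turn_mx_det : \det half_turn_mx = 1.
Proof.
pose c (i : nat) : R := v (inord i) 0.
have -> : half_turn_mx = \matrix_(i < 3, j < 3) (2 / inner v v * (c i * c j) - (i == j :> nat)%:R).
  by apply/matrixP => i j; rewrite !mxE big_ord1 !mxE /c !inord_val.
rewrite (det3 (fun i j => 2 / inner v v * (c i * c j) - (i == j)%:R)) /= inner3 -/(c 0%N) -/(c 1%N) -/(c 2%N).
have := v0; rewrite inner3 -/(c 0%N) -/(c 1%N) -/(c 2%N) => n0.
by field.
Qed.

Definition half_turn : SO3 R := MkSO3 half_turn_mx_orth half_turn_mx_det.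

Lemma half_turnE x : sphere_val (so3_act half_turn x) = (2 / inner v v * inner v x) *: v - sphere_val x.
Proof. exact: half_turn_mxE. Qed.

End RotateToNorth.

(** The half-turn about the bisector of [x] and the north pole exchanges them.
    When [x] is the south pole the bisector vanishes, and any horizontal axis
    will do. *)
Lemma rotate_to_north (R : realType) (x : sphere R) :
  exists g : SO3 R, so3_act g x = north R.
Proof.
have nx := inner_sphere1 x; have nn := inner_sphere1 (north R).
pose v : 'cV[R]_3 := sphere_val x + sphere_val (north R).
have vx : inner v x = 1 + inner x (north R).
  by rewrite -[in RHS]nx !innerE -big_split; apply: eq_bigr => i _; rewrite !mxE /=; ring.
have vv : inner v v = 2 * (1 + inner x (north R)).
  have -> : 2 * (1 + inner x (north R)) = inner x x + inner (north R) (north R) + 2 * inner x (north R).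
    by rewrite nx nn; ring.
  by rewrite !innerE mulr_sumr -!big_split; apply: eq_bigr => i _; rewrite !mxE /=; ring.
have [v0|v0] := eqVneq (1 + inner x (north R)) 0.
  pose e : 'cV[R]_3 := delta_mx 0 0.
  have ee : inner e e = 1 by rewrite inner_delta mxE !eqxx.
  have xE : sphere_val x = - sphere_val (north R).
    have : inner v v = 0 by rewrite vv v0 mulr0.
    rewrite innerE => /eqP; rewrite psumr_eq0; last by move=> i _; rewrite -expr2 sqr_ge0.
    move=> /allP h; apply/matrixP => i j; rewrite ord1.
    have := h i (mem_index_enum _); rewrite -expr2 sqrf_eq0 !mxE addr_eq0 => /eqP ->; reflexivity.
  have e0 : inner e e != 0 by rewrite ee oner_eq0.
  exists (half_turn e0); apply: val_inj; apply: (etrans (half_turnE e0 x)).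
  rewrite -[RHS]/(sphere_val (north R)).
  have -> : inner e x = 0 by rewrite innerC inner_delta xE !mxE /= mulr0n oppr0.
  by rewrite mulr0 scale0r sub0r xE opprK.
have vv0 : inner v v != 0 by rewrite vv mulf_neq0.
exists (half_turn vv0); apply: val_inj; apply: (etrans (half_turnE vv0 x)).
rewrite -[RHS]/(sphere_val (north R)).
have -> : 2 / inner v v * inner v x = 1 by rewrite vv vx; field.
by rewrite scale1r /v addrAC subrr add0r.
Qed.

(** * Spherical harmonics *)

Section ComplexParts.
Variable R : realType.
Implicit Types a b : R[i].

Lemma ReD a b : complex.Re (a + b) = complex.Re a + complex.Re b.
Proof. by case: a b => [? ?] [? ?]. Qed.

Lemma ReM a b : complex.Re (a * b) =
  complex.Re a * complex.Re b - complex.Im a * complex.Im b.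
Proof. by case: a b => [? ?] [? ?]. Qed.

Lemma ImM a b : complex.Im (a * b) =
  complex.Re a * complex.Im b + complex.Im a * complex.Re b.
Proof. by case: a b => [? ?] [? ?]. Qed.

Lemma ReN a : complex.Re (- a) = - complex.Re a. Proof. by case: a. Qed.

Lemma ReJ a : complex.Re (conjc a) = complex.Re a. Proof. by case: a. Qed.

Lemma ImJ a : complex.Im (conjc a) = - complex.Im a. Proof. by case: a. Qed.

Lemma Re_sum (I : Type) (r : seq I) (F : I -> R[i]) :
  complex.Re (\sum_(i <- r) F i) = \sum_(i <- r) complex.Re (F i).
Proof. exact: (big_morph _ ReD). Qed.

Definition cmeasurable d (T : measurableType d) (f : T -> R[i]) :=
  measurable_fun setT (fun x => complex.Re (f x)) /\
  measurable_fun setT (fun x => complex.Im (f x)).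

Lemma cmeasurableM d (T : measurableType d) (f g : T -> R[i]) :
  cmeasurable f -> cmeasurable g -> cmeasurable (fun x => f x * g x).
Proof.
move=> [f1 f2] [g1 g2]; split.
  by under eq_fun do rewrite ReM; apply: measurable_funB; exact: measurable_funM.
by under eq_fun do rewrite ImM; apply: measurable_funD; exact: measurable_funM.
Qed.

Lemma cmeasurableJ d (T : measurableType d) (f : T -> R[i]) :
  cmeasurable f -> cmeasurable (fun x => conjc (f x)).
Proof.
move=> [f1 f2]; split; first by under eq_fun do rewrite ReJ.
under eq_fun do rewrite ImJ.
exact: measurable_funN.
Qed.

Lemma cmeasurable_real d (T : measurableType d) (f : T -> R) :
  measurable_fun setT f -> cmeasurable (fun x => (f x)%:C%C).
Proof. by []. Qed.

Lemma cmeasurableX d (T : measurableType d) (f : T -> R[i]) n :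
  cmeasurable f -> cmeasurable (fun x => f x ^+ n).
Proof.
move=> mf; elim: n => [|n IH]; first by split; exact: measurable_cst.
have := cmeasurableM mf IH; congr cmeasurable.
by apply/funext => x; rewrite exprS.
Qed.

Lemma cmeasurable_cst d (T : measurableType d) (z : R[i]) : cmeasurable (fun _ : T => z).
Proof. by []. Qed.

End ComplexParts.

Section Harmonics.
Variable R : realType.
Implicit Types x y : sphere R.

(** The value of [Y_l0] at the north pole. *)
Definition zonal_norm l : R := Num.sqrt ((2 * l + 1)%:R / (4 * pi)).

Lemma cmeasurable_Ylm l m : cmeasurable (@Ylm R l m).
Proof.
have mnn k : cmeasurable (@Ylm_nneg R l k).
  apply: cmeasurableM.
    apply: cmeasurable_real; apply: measurable_funM => //.
    by apply: (measurableT_comp (measurable_horner_fun _)); exact: measurable_coord.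
  by apply: cmeasurableX; split; exact: measurable_coord.
case: m => k; first exact: mnn.
by apply: cmeasurableM; [exact: cmeasurable_cst|apply: cmeasurableJ; exact: mnn].
Qed.

Lemma ord_max_inord : ord_max = inord 2 :> 'I_3.
Proof. by apply/val_inj; rewrite /= inordK. Qed.

Lemma inner_north y : inner (north R) y = y (inord 2) 0.
Proof. by rewrite innerC inner_delta ord_max_inord. Qed.

Lemma Ylm0 l y : Ylm l 0 y = (zonal_norm l * (legendre R l).[inner (north R) y])%:C%C.
Proof.
rewrite -[LHS]/(Ylm_nneg l 0 y) /Ylm_nneg !expr0 mulr1 mul1r subn0 addn0 divff ?mulr1 ?derivn0 ?inner_north//.
Qed.

Lemma Ylm_north l m : m != 0 -> Ylm l m (north R) = 0.
Proof.
have z k : Ylm_nneg l k.+1 (north R) = 0.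
  rewrite /Ylm_nneg !mxE (_ : Complex _ _ = 0) ?expr0n ?mulr0//.
  by rewrite ord_max_inord -!(inj_eq val_inj) /= !inordK.
case: m => [[//|k]|k] _; first exact: z.
by rewrite /= z; apply/eqP; rewrite eq_complex /= !(mulr0,mul0r,oppr0,subr0,addr0) eqxx.
Qed.

Lemma zonal_norm_sqr l : zonal_norm l ^+ 2 = (2 * l + 1)%:R / (4 * pi).
Proof. by rewrite sqr_sqrtr// divr_ge0// mulr_ge0// pi_ge0. Qed.

End Harmonics.

(** * The covariance of an isotropic field *)

Lemma Rintegral_mul_sum (R : realType) d (Omega : measurableType d)
    (P : probability Omega R) (I : Type) (r : seq I) (f : Omega -> R) (F : I -> Omega -> R) :
  square_integrable P f -> (forall i, square_integrable P (F i)) ->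
  \int[P]_w (f w * \sum_(i <- r) F i w) = \sum_(i <- r) \int[P]_w (f w * F i w).
Proof.
move=> sf sF; elim: r => [|i r IH].
  rewrite big_nil; under eq_Rintegral do rewrite big_nil mulr0.
  exact: (Rintegral_probability_cst (probability_setT P)).
rewrite big_cons -IH -RintegralD//; last 2 first.
- exact: integrable_mul.
- by apply: integrable_mul => //; exact: square_integrable_sum.
by apply: eq_Rintegral => w _; rewrite big_cons mulrDr.
Qed.

(** By Tonelli's theorem for the positive and the negative part. *)
Lemma measurable_Rintegral_param (R : realType) d1 d2 (T1 : measurableType d1)
    (T2 : measurableType d2) (m : {sigma_finite_measure set T1 -> \bar R}) (f : T1 * T2 -> R) :
  measurable_fun setT f -> measurable_fun setT (fun w => \int[m]_x f (x, w)).
Proof.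
move=> mf; apply: (measurableT_comp (@fine_measurable R setT measurableT)).
under eq_fun do rewrite integralE.
have mEf : measurable_fun setT (fun q : T2 * T1 => (f (q.2, q.1))%:E).
  apply/measurable_EFinP.
  exact: (measurableT_comp mf (@measurable_swap _ _ T2 T1)).
apply: emeasurable_funB.
  have := @measurable_fun_fubini_tonelli_F _ _ _ _ _ m _ (measurable_funepos mEf)
    (fun q => funepos_ge0 _ q).
  by congr measurable_fun; apply/funext => w; apply: eq_integral => x _; rewrite !funeposE.
have := @measurable_fun_fubini_tonelli_F _ _ _ _ _ m _ (measurable_funeneg mEf)
  (fun q => funeneg_ge0 _ q).
by congr measurable_fun; apply/funext => w; apply: eq_integral => x _; rewrite !funenegE.
Qed.

Section Covariance.
Variables (R : realType) (d : measure_display) (Omega : measurableType d).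
Variables (P : probability Omega R) (T : sphere R -> Omega -> R) (C : nat -> R).
Hypothesis IF : isotropic_field P T C.
Implicit Types x y : sphere R.

Local Notation ar l m := (fun w => complex.Re (harmonic_coef T l m w)).
Local Notation ai l m := (fun w => complex.Im (harmonic_coef T l m w)).

Lemma measurable_field_at x : measurable_fun setT (T x).
Proof. exact: (measurableT_comp (field_measurable IF) (pair1_measurable x)). Qed.

(** The identity rotation in the definition of weak isotropy. *)
Lemma square_integrable_field x : square_integrable P (T x).
Proof.
have g1 : (1%:M : 'M[R]_3)^T *m 1%:M = 1%:M by rewrite trmx1 mulmx1.
have [h _] := field_weakly_isotropic2 IF; have := h x (MkSO3 g1 (det1 R 3)).
have -> : so3_act (MkSO3 g1 (det1 R 3)) x = x by apply: val_inj; exact: mul1mx.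
by rewrite unlock => h'; apply: square_integrableP => //; exact: measurable_field_at.
Qed.

Let cmeasurable_integrand l m :
  cmeasurable (fun q : sphere R * Omega => (T q.1 q.2)%:C%C * conjc (Ylm l m q.1)).
Proof.
apply: cmeasurableM; first exact: cmeasurable_real (field_measurable IF).
apply: cmeasurableJ; have [h1 h2] := cmeasurable_Ylm R l m.
by split; [exact: (measurableT_comp h1 measurable_fst)|exact: (measurableT_comp h2 measurable_fst)].
Qed.

Lemma measurable_coef_Re l m : measurable_fun setT (ar l m).
Proof.
have [h _] := cmeasurable_integrand l m.
exact: (measurable_Rintegral_param (@surface_measure R) h).
Qed.

Lemma measurable_coef_Im l m : measurable_fun setT (ai l m).
Proof.
have [_ h] := cmeasurable_integrand l m.
exact: (measurable_Rintegral_param (@surface_measure R) h).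
Qed.

Lemma integral_coef_sqnorm l m : - l%:Z <= m <= l%:Z ->
  (\int[P]_w (complex.Re (harmonic_coef T l m w) ^+ 2 +
              complex.Im (harmonic_coef T l m w) ^+ 2)%:E = (C l)%:E)%E.
Proof.
move=> lm; have [/(_ l l m m lm lm)[h _] _] := field_spectrum IF.
move: h; rewrite unlock !eqxx !mul1r => <-.
by apply: eq_integral => w _; rewrite ReM ReJ ImJ mulrN opprK !expr2.
Qed.

Lemma spectrum_ge0 l : 0 <= C l.
Proof.
rewrite -lee_fin -(@integral_coef_sqnorm l 0) ?lexx ?oppr_le0 ?ler0n//.
by apply: integral_ge0 => w _; rewrite lee_fin addr_ge0 ?sqr_ge0.
Qed.

Lemma square_integrable_coef l m : - l%:Z <= m <= l%:Z ->
  square_integrable P (ar l m) /\ square_integrable P (ai l m).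
Proof.
move=> lm; have h := integral_coef_sqnorm lm.
have bound (f : Omega -> R) : (forall w, f w ^+ 2 <= complex.Re (harmonic_coef T l m w) ^+ 2
    + complex.Im (harmonic_coef T l m w) ^+ 2) -> (\int[P]_w (f w ^+ 2)%:E < +oo)%E.
  move=> fle; apply: (@le_lt_trans _ _ (C l)%:E); last by rewrite ltry.
  by rewrite -h; apply: ge0_le_integralT => w; rewrite lee_fin ?sqr_ge0.
split; apply: square_integrableP.
- exact: measurable_coef_Re.
- by apply: bound => w; rewrite lerDl sqr_ge0.
- exact: measurable_coef_Im.
- by apply: bound => w; rewrite lerDr sqr_ge0.
Qed.

Lemma coef0_Im l w : complex.Im (harmonic_coef T l 0 w) = 0.
Proof.
have h x : complex.Im ((T x w)%:C%C * conjc (Ylm l 0 x)) = 0.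
  by rewrite ImM ImJ Ylm0 /= oppr0 mul0r mulr0 addr0.
rewrite -[LHS]/(\int[@surface_measure R]_x complex.Im ((T x w)%:C%C * conjc (Ylm l 0 x))).
by rewrite /Rintegral integral0_eq// => x _; rewrite h.
Qed.

Let idx0 l : - l%:Z <= 0 <= l%:Z. Proof. by rewrite oppr_le0 le0z_nat. Qed.

(** As [a_l0] is real, the real and imaginary parts of the Hermitian product
    are, up to sign, the products with the two parts of the other coefficient. *)
Lemma Rintegral_coef0 l1 l2 m : - l2%:Z <= m <= l2%:Z ->
  \int[P]_w (complex.Re (harmonic_coef T l1 0 w) * complex.Re (harmonic_coef T l2 m w))
    = (l1 == l2)%:R * (0 == m)%:R * C l1 /\
  \int[P]_w (complex.Re (harmonic_coef T l1 0 w) * complex.Im (harmonic_coef T l2 m w)) = 0.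
Proof.
move=> lm; have [/(_ l1 l2 0 m (idx0 l1) lm)[h1 h2] _] := field_spectrum IF.
move: h1 h2; rewrite unlock => h1 h2; split.
  rewrite /Rintegral -[RHS]/(fine (EFin _)) -h1; congr fine.
  by apply: eq_integral => w _; rewrite ReM ReJ ImJ coef0_Im mul0r subr0.
have [s1 _] := square_integrable_coef (idx0 l1); have [_ s2] := square_integrable_coef lm.
apply: oppr_inj; rewrite -mulN1r -RintegralZl//; last exact: (integrable_mul s1 s2).
rewrite /Rintegral oppr0 -[RHS]/(fine 0%E) -[in RHS]h2; congr fine.
by apply: eq_integral => w _; rewrite ImM ImJ coef0_Im ReJ mul0r addr0 mulN1r mulrN.
Qed.

Let Re_Ylm0 l y : complex.Re (Ylm l 0 y) = zonal_norm R l * (legendre R l).[inner (north R) y].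
Proof. by rewrite Ylm0. Qed.

Let Im_Ylm0 l y : complex.Im (Ylm l 0 y) = 0.
Proof. by rewrite Ylm0. Qed.

Let S N y w : R := complex.Re (harmonic_sum T N y w).

Let SE N y w : S N y w = \sum_(l < N) \sum_(k < (2 * l).+1%N)
  (complex.Re (harmonic_coef T l (k%:Z - l%:Z) w) * complex.Re (Ylm l (k%:Z - l%:Z) y) -
   complex.Im (harmonic_coef T l (k%:Z - l%:Z) w) * complex.Im (Ylm l (k%:Z - l%:Z) y)).
Proof.
rewrite /S /harmonic_sum Re_sum; apply: eq_bigr => l _.
by rewrite Re_sum; apply: eq_bigr => k _; rewrite ReM.
Qed.

Let idx (l : nat) (k : 'I_(2 * l).+1) : - l%:Z <= k%:Z - l%:Z <= l%:Z.
Proof. by have kl := ltn_ord k; apply/andP; split; lia. Qed.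

Let sqi_term (l : nat) (k : 'I_(2 * l).+1) y : square_integrable P (fun w =>
  complex.Re (harmonic_coef T l (k%:Z - l%:Z) w) * complex.Re (Ylm l (k%:Z - l%:Z) y) -
  complex.Im (harmonic_coef T l (k%:Z - l%:Z) w) * complex.Im (Ylm l (k%:Z - l%:Z) y)).
Proof.
have [s1 s2] := square_integrable_coef (idx k).
apply: square_integrableB; [have := square_integrableZ (complex.Re (Ylm l (k%:Z - l%:Z) y)) s1|
  have := square_integrableZ (complex.Im (Ylm l (k%:Z - l%:Z) y)) s2];
  by congr square_integrable; apply/funext => w; rewrite mulrC.
Qed.

Let sqi_S N y : square_integrable P (S N y).
Proof.
rewrite (funext (SE N y)); apply: square_integrable_sum => l.
by apply: square_integrable_sum => k; exact: sqi_term.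
Qed.

Let cvg_S y : \int[P]_w (T y w - S N y w) ^+ 2 @[N --> \oo] --> 0.
Proof.
have [/(_ y) h _] := field_spectral IF.
have k : (\int[P]_w ((T y w - S N y w) ^+ 2)%:E @[N --> \oo] --> 0)%E.
  apply: (squeeze_cvge _ (cvg_cst 0%E) h); near=> N; apply/andP; split.
    by apply: integral_ge0 => w _; rewrite lee_fin sqr_ge0.
  rewrite unlock; apply: ge0_le_integralT => w; rewrite lee_fin ?sqr_ge0//.
  by rewrite /csqnorm ReD ReN lerDl sqr_ge0.
exact: (fine_cvg k).
Unshelve. all: by end_near. Qed.

Let S_north N w : S N (north R) w =
  \sum_(l < N) zonal_norm R l * complex.Re (harmonic_coef T l 0 w).
Proof.
rewrite SE; apply: eq_bigr => l _.
have ll : (l < (2 * l).+1)%N by lia.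
rewrite (bigD1 (Ordinal ll))// [X in _ + X = _]big1 ?addr0; last first.
  move=> k kl; rewrite Ylm_north ?mulr0 ?subr0//.
  by apply: contra kl; rewrite subr_eq0 => /eqP[kl]; apply/eqP/val_inj.
have -> : (Ordinal ll)%:Z - l%:Z = 0 by rewrite /= subrr.
by rewrite Re_Ylm0 Im_Ylm0 inner_sphere1 legendre1 mulr1 mulr0 subr0 mulrC.
Qed.

Let Rintegral_coef_S l N y : (l < N)%N ->
  \int[P]_w (complex.Re (harmonic_coef T l 0 w) * S N y w) =
  C l * zonal_norm R l * (legendre R l).[inner (north R) y].
Proof.
move=> lN; have [sl _] := square_integrable_coef (idx0 l).
under eq_Rintegral do rewrite SE.
rewrite Rintegral_mul_sum//; last first.
  by move=> j; apply: square_integrable_sum => k; exact: sqi_term.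
have inner_sum (j : 'I_N) : \int[P]_w (complex.Re (harmonic_coef T l 0 w) *
   \sum_(k < (2 * j).+1)
    (complex.Re (harmonic_coef T j (k%:Z - j%:Z) w) * complex.Re (Ylm j (k%:Z - j%:Z) y) -
     complex.Im (harmonic_coef T j (k%:Z - j%:Z) w) * complex.Im (Ylm j (k%:Z - j%:Z) y)))
   = \sum_(k < (2 * j).+1) (l == j)%:R * (0 == k%:Z - j%:Z)%:R * C l *
       complex.Re (Ylm j (k%:Z - j%:Z) y).
  rewrite Rintegral_mul_sum//; apply: eq_bigr => k _.
  have [s1 s2] := square_integrable_coef (idx k).
  have [e1 e2] := Rintegral_coef0 l (idx k).
  have i1 := integrable_mul sl s1; have i2 := integrable_mul sl s2.
  transitivity (\int[P]_w (complex.Re (Ylm j (k%:Z - j%:Z) y) *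
      (complex.Re (harmonic_coef T l 0 w) * complex.Re (harmonic_coef T j (k%:Z - j%:Z) w)) -
    complex.Im (Ylm j (k%:Z - j%:Z) y) *
      (complex.Re (harmonic_coef T l 0 w) * complex.Im (harmonic_coef T j (k%:Z - j%:Z) w)))).
    by apply: eq_Rintegral => w _; ring.
  rewrite RintegralB//; last 2 first.
  - exact: (integrableZl _ _ i1).
  - exact: (integrableZl _ _ i2).
  by rewrite !RintegralZl// e1 e2 mulr0 subr0 mulrC.
rewrite (eq_bigr _ (fun j _ => inner_sum j)) (bigD1 (Ordinal lN)) //= [X in _ + X]big1 ?addr0; last first.
  move=> j jl; rewrite big1// => k _; rewrite (_ : l == j = false) ?mul0r//.
  by apply/eqP => lj; move/eqP: jl; apply; exact: val_inj.
have ll : (l < (2 * l).+1)%N by lia.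
rewrite (bigD1 (Ordinal ll))// [X in _ + X = _]big1 ?addr0; last first.
  move=> k kl; rewrite (_ : (0 == k%:Z - l%:Z) = false) ?mulr0 ?mul0r//.
  by apply/negbTE; apply: contra kl; rewrite eq_sym subr_eq0 => /eqP[kl]; apply/eqP/val_inj.
have -> : (Ordinal ll)%:Z - (Ordinal lN)%:Z = 0 by rewrite /= subrr.
by rewrite !eqxx !mul1r Re_Ylm0 mulrA.
Qed.

(** In the expectation of the product of the partial sums at the north pole and
    at [y], orthogonality of the coefficients leaves the diagonal terms
    [zonal_norm l * C_l * Y_l0 y]. *)
Let covariance_north y :
  series (fun l => (2 * l + 1)%:R / (4 * pi) * C l * (legendre R l).[inner (north R) y])
    @ \oo --> \int[P]_w (T (north R) w * T y w).
Proof.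
suff -> : series (fun l => (2 * l + 1)%:R / (4 * pi) * C l * (legendre R l).[inner (north R) y])
    = (fun N => \int[P]_w (S N (north R) w * S N y w)).
  exact: cvg_Rintegral_mul (square_integrable_field (north R)) (square_integrable_field y)
  (fun N => sqi_S N (north R)) (fun N => sqi_S N y) (cvg_S (north R)) (cvg_S y).
apply/esym/funext => N.
transitivity (\int[P]_w (S N y w * \sum_(l < N) zonal_norm R l * complex.Re (harmonic_coef T l 0 w))).
  by apply: eq_Rintegral => w _; rewrite S_north mulrC.
have sl l : square_integrable P (ar l 0) by have [] := square_integrable_coef (idx0 l).
rewrite Rintegral_mul_sum//; last by move=> l; exact: square_integrableZ.
rewrite seriesEord; apply: eq_bigr => l _.
transitivity (zonal_norm R l * \int[P]_w (complex.Re (harmonic_coef T l 0 w) * S N y w)).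
  rewrite -RintegralZl//; last exact: integrable_mul.
  by apply: eq_Rintegral => w _; ring.
by rewrite Rintegral_coef_S// -zonal_norm_sqr; ring.
Qed.

Theorem covariance x y :
  series (fun l => (2 * l + 1)%:R / (4 * pi) * C l * (legendre R l).[inner x y])
    @ \oo --> \int[P]_w (T x w * T y w).
Proof.
have [g gx] := rotate_to_north x.
have [_ h] := field_weakly_isotropic2 IF.
(* Weak isotropy, for the rotation [g]. *)
have -> : \int[P]_w (T x w * T y w) = \int[P]_w (T (north R) w * T (so3_act g y) w).
  by have := h x y g; rewrite unlock gx /Rintegral => ->.
by rewrite -(inner_so3_act g x y) gx; exact: covariance_north.
Qed.

End Covariance.

Arguments covariance {R d Omega P T C} IF x y : rename.

(** * Composition of the field with the motions *)

Section Composition.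
Variables (R : realType) (d : measure_display) (Omega : measurableType d).
Variables (P : probability Omega R) (T : sphere R -> Omega -> R) (C : nat -> R).
Hypothesis IF : isotropic_field P T C.

Let c l : R := (2 * l + 1)%:R / (4 * pi) * C l.
Let K x y : R := \int[P]_w (T x w * T y w).

Let c_ge0 l : 0 <= c l.
Proof.
by rewrite mulr_ge0 ?(spectrum_ge0 IF)// divr_ge0// mulr_ge0// pi_ge0.
Qed.

Let cvg_c : cvgn (series c).
Proof.
have [_ h] := field_spectrum IF.
rewrite (_ : c = (4 * pi)^-1 *: (fun l => (2 * l + 1)%:R * C l)); first exact: is_cvg_seriesZ.
by apply/funext => l; rewrite /c -[RHS]/((4 * pi)^-1 * ((2 * l + 1)%:R * C l)) mulrA [_^-1 * _]mulrC.
Qed.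

Let V := limn (series c).

Let sum_c_le n : \sum_(l < n) c l <= V.
Proof.
rewrite -(big_mkord xpredT); apply: (nondecreasing_cvgn_le _ cvg_c).
by apply: nondecreasing_series => l _ _; exact: c_ge0.
Qed.

Let variance x : K x x = V.
Proof.
rewrite /K -(cvg_lim _ (covariance IF x x))//; congr (limn (series _)).
by apply/funext => l; rewrite inner_sphere1 legendre1 mulr1.
Qed.

Let integrable_TT x y := integrable_mul (square_integrable_field IF x) (square_integrable_field IF y).

(** This uniform bound on the kernel makes every exchange of integrals below
    legitimate. *)
Let abs_covariance x y : (\int[P]_w `|T x w * T y w|%:E <= V%:E)%E.
Proof.
have i1 := integrable_TT x x; have i2 := integrable_TT y y.
apply: (@le_trans _ _ (\int[P]_w (2^-1 * (T x w * T x w + T y w * T y w))%:E)%E).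
  apply: ge0_le_integralT => w; rewrite lee_fin// ler_norml.
  have := sqr_ge0 (T x w + T y w); have := sqr_ge0 (T x w - T y w).
  by move=> *; apply/andP; split; nra.
rewrite [leLHS](_ : _ = (2^-1 * (K x x + K y y))%:E); last first.
  rewrite /K -RintegralD// -RintegralZl//; last exact: (integrableD _ i1 i2).
  rewrite /Rintegral fineK//; apply: integrable_fin_num => //.
  exact: (integrableZl _ _ (integrableD _ i1 i2)).
rewrite !variance lee_fin; lra.
Qed.

(** The pair [(Z1, Z2)] is independent of [G], and the integrand is jointly
    measurable for [G]; so the expectation may be computed with the positions
    frozen. *)
Lemma integral_composition (G F : set (set Omega)) (Z1 Z2 : Omega -> sphere R) :
  sigma_algebra setT G -> G `<=` measurable -> sigma_algebra setT F -> F `<=` measurable ->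
  (forall U : set R, measurable U ->
    <<s [set A `*` B | A in @measurable _ (sphere R) & B in G] >>
      ((fun p : sphere R * Omega => T p.1 p.2) @^-1` U)) ->
  independent P G F ->
  (forall U, measurable U -> F (Z1 @^-1` U)) -> (forall U, measurable U -> F (Z2 @^-1` U)) ->
  (\int[P]_w (T (Z1 w) w * T (Z2 w) w)%:E = \int[P]_w (K (Z1 w) (Z2 w))%:E)%E.
Proof.
move=> sG mG sF mF mT GF mZ1 mZ2.
have mT' : measurable_fun setT
    ((fun p => T p.1 p.2) : sphere R * g_sigma_algebraType G -> R).
  exact: (measurable_fun_product_with sG mT).
pose Z w := (Z1 w, Z2 w).
have mZF : measurable_fun setT (Z : g_sigma_algebraType F -> (sphere R * sphere R)%type).
  apply/measurable_fun_pairP; split => _ U mU; rewrite setTI; apply: sub_sigma_algebra.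
    exact: mZ1.
  exact: mZ2.
have FZ U : measurable U -> F (Z @^-1` U).
  move=> mU; have := mZF measurableT U mU; rewrite setTI.
  by rewrite {1}/measurable /= (sigma_algebra_id sF).
have mZ : measurable_fun setT Z by move=> _ U mU; rewrite setTI; apply: mF; exact: FZ.
pose h (p : (sphere R * sphere R) * Omega) := T p.1.1 p.2 * T p.1.2 p.2.
have mh : measurable_fun setT (h : (sphere R * sphere R) * g_sigma_algebraType G -> R).
  apply: measurable_funM.
    apply: (measurableT_comp mT' (_ : measurable_fun setT (fun p => (p.1.1, p.2)))).
    apply/measurable_fun_pairP; split; last exact: measurable_snd.
    exact: (measurableT_comp measurable_fst measurable_fst).
  apply: (measurableT_comp mT' (_ : measurable_fun setT (fun p => (p.1.2, p.2)))).
  apply/measurable_fun_pairP; split; last exact: measurable_snd.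
  exact: (measurableT_comp measurable_snd measurable_fst).
have := integral_indep_algebra sG mG mZ _ mh; rewrite /h /Z /= => -> //.
- apply: eq_integral => w' _; rewrite /K /Rintegral fineK//.
  by apply: integrable_fin_num => //; exact: integrable_TT.
- by move=> A U GA mU; apply: GF => //; exact: FZ.
- apply: (@le_lt_trans _ _ V%:E); last by rewrite ltry.
  by apply: integral_le_cst => w'; [exact: integral_ge0|exact: abs_covariance].
Qed.

(** The partial sums of the covariance series are bounded by [V], the sum of its
    coefficients, so that the limit is dominated. *)
Lemma cvg_expected_covariance (Z1 Z2 : Omega -> sphere R) (e : nat -> R) :
  measurable_fun setT Z1 -> measurable_fun setT Z2 ->
  (forall l, \int[P]_w ((legendre R l).[inner (Z1 w) (Z2 w)])%:E = (e l)%:E)%E ->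
  cvgn (series (fun l => c l * e l)) /\
  (\int[P]_w (K (Z1 w) (Z2 w))%:E = (limn (series (fun l => c l * e l)))%:E)%E.
Proof.
move=> mZ1 mZ2 He.
pose f l w := (legendre R l).[inner (Z1 w) (Z2 w)].
have mf l : measurable_fun setT (f l).
  apply: (measurableT_comp (measurable_horner_fun _)).
  apply: (measurableT_comp (@measurable_inner2 R) (_ : measurable_fun setT (fun w => (Z1 w, Z2 w)))).
  exact/measurable_fun_pairP.
have f1 l w : `|f l w| <= 1 by exact: legendre_inner_le1.
pose S n w := \sum_(l < n) c l * f l w.
have mS n : measurable_fun setT (S n).
  by apply: measurable_sum => l; exact: measurable_funM.
have S_le n w : `|S n w| <= V.
  apply: le_trans (sum_c_le n); apply: le_trans (ler_norm_sum _ _ _) _.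
  apply: ler_sum => l _; rewrite normrM (ger0_norm (c_ge0 _)) -[leRHS]mulr1.
  by rewrite ler_wpM2l ?c_ge0.
have cS w : S n w @[n --> \oo] --> K (Z1 w) (Z2 w).
  have := covariance IF (Z1 w) (Z2 w).
  by rewrite seriesEord.
have mK : measurable_fun setT (fun w => (K (Z1 w) (Z2 w))%:E).
  by apply/measurable_EFinP; apply: (measurable_fun_cvg mS) => w _; exact: cS.
have cSE w : ((S n w)%:E @[n --> \oo] --> (K (Z1 w) (Z2 w))%:E)%E.
  by apply: cvg_EFin; [exact: nearW|exact: cS].
have S_leE n w : (`|(S n w)%:E| <= cst V%:E w)%E by rewrite lee_fin; exact: S_le.
have iV : P.-integrable setT (EFin \o cst V) by exact: finite_measure_integrable_cst.
have [iK _ dom] := @dominated_convergence _ _ _ P setT measurableT (fun n w => (S n w)%:E)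
   (fun w => (K (Z1 w) (Z2 w))%:E) (cst V%:E)
   (fun n => (measurable_EFinP _ _).2 (mS n)) mK (aeW _ (fun w _ => cSE w)) iV
   (aeW _ (fun w n _ => S_leE n w)).
have IS n : (\int[P]_w (S n w)%:E = (series (fun l => c l * e l) n)%:E)%E.
  elim: n => [|n IH].
    rewrite seriesEord /= big_ord0 /S; under eq_integral do rewrite big_ord0.
    exact: integral0.
  rewrite seriesEord /= big_ord_recr /= EFinD EFinM -He.
  have -> : (\sum_(i < n) c i * e i)%:E = (\int[P]_w (S n w)%:E)%E by rewrite IH seriesEord.
  have if_ := integrable_bounded (probability_setT P) (mf n) (f1 n).
  have iS := integrable_bounded (probability_setT P) (mS n) (S_le n).
  rewrite -integralZl// -integralD//; last exact: integrableZl.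
  by apply: eq_integral => w _; rewrite /S big_ord_recr.
have KE : (\int[P]_w (K (Z1 w) (Z2 w))%:E \is a fin_num)%E by exact: integrable_fin_num.
have lim_u : series (fun l => c l * e l) @ \oo --> fine (\int[P]_w (K (Z1 w) (Z2 w))%:E)%E.
  have : ((fun n => (series (fun l => c l * e l) n)%:E) @ \oo --> (fine (\int[P]_w (K (Z1 w) (Z2 w))%:E))%:E)%E.
    by rewrite fineK// -(funext IS); exact: dom.
  exact: fine_cvg.
split; first exact: cvgP lim_u.
by rewrite (cvg_lim _ lim_u)// fineK.
Qed.

End Composition.

Lemma measurable_legendre_inner (R : realType) d (Omega : measurableType d) l
    (Z1 Z2 : Omega -> sphere R) : measurable_fun setT Z1 -> measurable_fun setT Z2 ->
  measurable_fun setT (fun w => (legendre R l).[inner (Z1 w) (Z2 w)]).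
Proof.
move=> mZ1 mZ2; apply: (measurableT_comp (measurable_horner_fun _)).
apply: (measurableT_comp (@measurable_inner2 R)
  (_ : measurable_fun setT (fun w => (Z1 w, Z2 w)))).
exact/measurable_fun_pairP.
Qed.

Section FinalStep.
Variables (R : realType) (d : measure_display) (Omega : measurableType d).
Variables (P : probability Omega R) (nu t0 : R) (T : sphere R -> Omega -> R) (C : nat -> R).
Variables (B : sphere R -> R -> Omega -> sphere R) (H : sphere R -> R -> Omega -> R).
Hypotheses (nu01 : 0 < nu <= 1) (IF : isotropic_field P T C).
Hypothesis fam : time_changed_rbm_family P nu t0 B H.
Hypothesis indep : field_independent P T [set q : sphere R * R | t0 <= q.2]
  (fun q => time_changed nu t0 (B q.1) (H q.1) q.2).

Let Z x t := time_changed nu t0 (B x) (H x) t.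

Let mZ x t : t0 <= t -> measurable_fun setT (Z x t).
Proof.
move=> tt; exact: (measurable_time_changed nu01 (fam_rbm fam x)
  (fun h => fam_subordinator fam h x)).
Qed.

Let integral_composed x1 x2 t1 t2 : t0 <= t1 -> t0 <= t2 ->
  (\int[P]_w (T (Z x1 t1 w) w * T (Z x2 t2 w) w)%:E =
   \int[P]_w (\int[P]_w' (T (Z x1 t1 w) w' * T (Z x2 t2 w) w'))%:E)%E.
Proof.
move=> tt1 tt2; have [G [sG mG mT GF]] := indep.
pose D := [set q : sphere R * R | t0 <= q.2].
apply: (integral_composition IF sG mG (smallest_sigma_algebra _ _) _ mT GF).
- apply: smallest_sub; first exact: sigma_algebra_measurable.
  move=> _ [[y s] /= ts [U mU ->]]; rewrite -[X in measurable X]setTI.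
  exact: (mZ y ts).
- by move=> U mU; apply: sub_sigma_algebra; exists (x1, t1) => //; exists U.
- by move=> U mU; apply: sub_sigma_algebra; exists (x2, t2) => //; exists U.
Qed.

Let legendre_Z l z x t : t0 < t ->
  (\int[P]_w ((legendre R l).[inner (sphere_val z) (Z x t w)])%:E =
   (mittag_leffler nu (- mu_ R l * (t - t0) `^ nu) * (legendre R l).[inner z x])%:E)%E.
Proof.
move=> tt; exact: (integral_time_changed_legendre nu01 (fam_rbm fam x)
  (fun h => fam_subordinator fam h x) (fam_clock_independent fam (x:=x)) l z tt).
Qed.

Let start x : {ae P, forall w, Z x t0 w = x}.
Proof.
have := ae_clock0 (P := P) nu01 (fun h => fam_subordinator fam h x).
by apply: filterS => w h; rewrite /Z /time_changed subrr h (rbm_start (fam_rbm fam x)).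
Qed.

(** At the time [t0] the motion is almost surely at [x], and [P_l(<x,x>) = 1]. *)
Lemma covariance_from_start x t : t0 < t ->
  let u := fun l : nat => (2 * l + 1)%:R / (4 * pi) * C l *
    mittag_leffler nu (- mu_ R l * (t - t0) `^ nu) in
  cvgn (series u) /\
  (\int[P]_w (T (Z x t0 w) w * T (Z x t w) w)%:E = (limn (series u))%:E)%E.
Proof.
move=> tt u; have mZt := mZ x (ltW tt); have mZ0 := mZ x (lexx t0).
rewrite integral_composed//; last exact: ltW.
apply: (cvg_expected_covariance IF mZ0 mZt) => l.
rewrite -[in RHS](mulr1 (mittag_leffler _ _)) -(legendre1 R l) -[in RHS](inner_sphere1 x).
rewrite -legendre_Z//; apply: ae_eq_integral => //.
- by apply/measurable_EFinP; exact: measurable_legendre_inner.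
- by apply/measurable_EFinP; apply: measurable_legendre_inner; first exact: measurable_cst.
by apply: filterS (start x) => w h _; rewrite h.
Qed.

Lemma covariance_independent (x y : sphere R) t1 t2 : x <> y -> t0 < t1 -> t0 < t2 ->
  let u := fun l : nat => (2 * l + 1)%:R / (4 * pi) * C l *
    (mittag_leffler nu (- mu_ R l * (t1 - t0) `^ nu) *
     mittag_leffler nu (- mu_ R l * (t2 - t0) `^ nu)) *
    (legendre R l).[inner x y] in
  cvgn (series u) /\
  (\int[P]_w (T (Z x t1 w) w * T (Z y t2 w) w)%:E = (limn (series u))%:E)%E.
Proof.
move=> xy tt1 tt2 u; have mZ1 := mZ x (ltW tt1); have mZ2 := mZ y (ltW tt2).
rewrite integral_composed; [|exact: ltW..].
set e := fun l => mittag_leffler nu (- mu_ R l * (t1 - t0) `^ nu) *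
     mittag_leffler nu (- mu_ R l * (t2 - t0) `^ nu) * (legendre R l).[inner x y].
have := @cvg_expected_covariance _ _ _ _ _ _ IF _ _ e mZ1 mZ2.
rewrite (_ : (fun l => _ * e l) = u) => [|]; last by apply/funext => l; rewrite /u /e mulrA.
apply=> l.
have mh : measurable_fun setT (fun q : sphere R * sphere R => (legendre R l).[inner q.1 q.2]).
  by apply: measurable_legendre_inner; [exact: measurable_fst|exact: measurable_snd].
rewrite (integral_indep mZ1 mZ2 _ mh) => [|U V mU mV|].
- under eq_integral do rewrite /= legendre_Z// innerC.
  under eq_integral do rewrite EFinM.
  rewrite integralZl//; last first.
    apply: (integrable_bounded (probability_setT P) (c := 1)).
      by apply: measurable_legendre_inner; first exact: measurable_cst.
    by move=> w; exact: legendre_inner_le1.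
  by rewrite legendre_Z// -EFinM innerC /e; congr EFin; ring.
- apply: (fam_independent fam xy); apply: sub_sigma_algebra.
    by exists t1 => /=; [exact: ltW|exists U].
  by exists t2 => /=; [exact: ltW|exists V].
- apply: (@le_lt_trans _ _ 1%:E); last by rewrite ltry.
  apply: integral_le_cst => w'; first exact: integral_ge0.
  by apply: integral_le_cst => w //; rewrite lee_fin legendre_inner_le1.
Qed.

End FinalStep.

Theorem theorem1p2 (R : realType) (d : measure_display)
    (Omega : measurableType d) (P : probability Omega R)
    (nu t0 t1 t2 : R) (T : sphere R -> Omega -> R) (C : nat -> R)
    (B : sphere R -> R -> Omega -> sphere R)
    (H : sphere R -> R -> Omega -> R) :
  0 < nu <= 1 -> 0 <= t0 -> t0 < t1 -> t1 <= t2 ->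
  isotropic_field P T C ->
  time_changed_rbm_family P nu t0 B H ->
  field_independent P T [set q : sphere R * R | t0 <= q.2]
    (fun q => time_changed nu t0 (B q.1) (H q.1) q.2) ->
  (forall (x : sphere R) (g : SO3 R),
    let u := fun l : nat => (2 * l + 1)%:R / (4 * pi) * C l *
      mittag_leffler nu (- mu_ R l * (t1 - t0) `^ nu) in
    cvgn (series u) /\
    'E_P[(fun w => composed_field nu t0 T B H t0 (so3_act g x) w *
                  composed_field nu t0 T B H t1 (so3_act g x) w)%R]%E
    = (limn (series u))%:E) /\
  (forall x y : sphere R, x <> y ->
    let u := fun l : nat => (2 * l + 1)%:R / (4 * pi) * C l *
      (mittag_leffler nu (- mu_ R l * (t1 - t0) `^ nu) *
       mittag_leffler nu (- mu_ R l * (t2 - t0) `^ nu)) *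
      (legendre R l).[inner x y] in
    cvgn (series u) /\
    'E_P[(fun w => composed_field nu t0 T B H t1 x w *
                  composed_field nu t0 T B H t2 y w)%R]%E
    = (limn (series u))%:E).
Proof.
move=> nu01 t00 t01 t12 IF fam indep; split => [x g|x y xy] u.
  have := covariance_from_start nu01 IF fam indep (so3_act g x) t01.
  by rewrite unlock.
have := covariance_independent nu01 IF fam indep xy t01 (lt_le_trans t01 t12).
by rewrite unlock.
Qed.
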